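(* Let $\alpha\ge\beta\ge-\frac12$, $\alpha>-\frac12$, let $\zeta\ge0$, $1<p,q<\infty$ and $\kappa,\sigma\in\mathbb R$, and set $$\tilde{\mathcal J}^\zeta_{\kappa,\sigma}f(\lambda)=(\lambda^2+\zeta^2)^{-\frac\sigma2}\int_0^\infty t^{-\kappa}f(t)\tilde\varphi_\lambda(t)\tilde m(t)\,dt .$$ Suppose that there is a constant $C$ such that $$\left(\int_0^\infty|\tilde{\mathcal J}^\zeta_{\kappa,\sigma}f(\lambda)|^q n(\lambda)\,d\lambda\right)^{\frac1q}\le C\left(\int_0^\infty|f(t)|^p\tilde m(t)\,dt\right)^{\frac1p}$$ for all $f\in C_c^\infty(\mathbb R_+)$. Then the following conditions are necessary: (1) if $\zeta\ne0$, then $\kappa p'<2(\alpha+1)$, $\ \sigma-\kappa\ge2(\alpha+1)\left(\frac1p+\frac1q-1\right)$, and $\ \kappa\ge3\left(1-\frac1p-\frac1q\right)$; (2) if $\zeta=0$, then $\kappa p'<2(\alpha+1)$, $\ \sigma q<3$, $\ \sigma-\kappa\ge2(\alpha+1)\left(\frac1p+\frac1q-1\right)$, and $\ \sigma-\kappa\le3\left(\frac1p+\frac1q-1\right)$.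
   Context: Let $\rho=\alpha+\beta+1$. The Jacobi functions are $\varphi_\lambda(t)=\varphi_\lambda^{(\alpha,\beta)}(t)={}_2F_1\!\left(\frac{\rho+i\lambda}2,\frac{\rho-i\lambda}2;\alpha+1;-(\sinh t)^2\right)$, $t\ge0$, with ${}_2F_1$ the Gauss hypergeometric function. The weights are $$m(t)=(2\pi)^{-1/2}2^{2\rho}(\sinh t)^{2\alpha+1}(\cosh t)^{2\beta+1},\qquad n(\lambda)=(2\pi)^{-1/2}|\mathbf c(\lambda)|^{-2},$$ $$\mathbf c(\lambda)=\frac{2^{\rho-i\lambda}\Gamma(\alpha+1)\Gamma(i\lambda)}{\Gamma\left(\frac{\rho+i\lambda}2\right)\Gamma\left(\frac{\rho+i\lambda}2-\beta\right)}.$$ The modified quantities are $\tilde\varphi_\lambda(t)=\varphi_\lambda(t)/\varphi_0(t)$ and $\tilde m(t)=\varphi_0(t)^2m(t)$. $\mathbb R_+=(0,\infty)$ and $p'=p/(p-1)$. *)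

(* Defs.v *)
From Stdlib Require Import Reals Factorial ClassicalEpsilon.
From Coquelicot Require Import Coquelicot.
Open Scope R_scope.

(* Powers of nonnegative reals with a positive exponent.  [Rpower] alone will
   not do: [Rpower 0 y = 1], since [ln 0 = 0]. *)
Definition rpow (x y : R) : R :=
  if Req_EM_T x 0 then 0 else Rpower x y.

Definition Cexp (z : C) : C :=
  (exp (Re z) * cos (Im z), exp (Re z) * sin (Im z)).

(* x ^ z for x > 0, principal value. *)
Definition Rpow_C (x : R) (z : C) : C := Cexp (z * RtoC (ln x))%C.

(* Pochhammer symbol z (z+1) ... (z+n-1). *)
Fixpoint pochhammer (z : C) (n : nat) : C :=
  match n with
  | O => RtoC 1
  | S k => (pochhammer z k * (z + RtoC (INR k)))%C
  end.

(* Gamma(z) = lim n! n^z / (z (z+1) ... (z+n)) (Euler, Gauss): the limit exists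
   at every z other than 0, -1, -2, ..., so no separate continuation to
   Re z <= 0 is needed. *)
Definition Gamma_approx (z : C) (n : nat) : C :=
  (RtoC (INR (fact n)) * Rpow_C (INR n) z / pochhammer z (S n))%C.

Definition CGamma (z : C) : C :=
  (real (Lim_seq (fun n => Re (Gamma_approx z n))),
   real (Lim_seq (fun n => Im (Gamma_approx z n)))).

Definition gauss_coef (a b c : C) (n : nat) : C :=
  (pochhammer a n * pochhammer b n
     / (pochhammer c n * RtoC (INR (fact n))))%C.

Definition is_pseries_C (u : nat -> C) (x : R) (l : C) : Prop :=
  @is_pseries R_AbsRing C_R_NormedModule u x l.

Definition analytic_at (F : R -> C) (x0 : R) : Prop :=
  exists (u : nat -> C) (r : R), 0 < r /\
    forall x : R, Rabs (x - x0) < r -> is_pseries_C u (x - x0) (F x).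

(* The Gauss series converges only on the unit disc, whereas the Jacobi
   functions need all real arguments x <= 0.  On (-oo,1) the principal branch
   of 2F1 is the analytic continuation of the sum of the series on (-1,1);
   by the identity theorem it is unique there. *)
Definition is_gauss_2F1 (a b c : C) (F : R -> C) : Prop :=
  (forall x : R, Rabs x < 1 -> is_pseries_C (gauss_coef a b c) x (F x)) /\
  (forall x : R, x < 1 -> analytic_at F x).

(* Meaningful for x < 1 and c not in {0, -1, -2, ...}. *)
Definition gauss_2F1 (a b c : C) : R -> C :=
  epsilon (inhabits (fun _ : R => RtoC 0)) (is_gauss_2F1 a b c).

Definition rho (alpha beta : R) : R := alpha + beta + 1.

(* For real lambda the first two parameters are complex conjugates and the
   third is real, so the series has real coefficients and the value of 2F1 is
   real: taking [Re] only changes the type. *)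
Definition jacobi (alpha beta lambda t : R) : R :=
  Re (gauss_2F1 ((RtoC (rho alpha beta) + Ci * RtoC lambda) / RtoC 2)%C
                ((RtoC (rho alpha beta) - Ci * RtoC lambda) / RtoC 2)%C
                (RtoC (alpha + 1))
                (- (sinh t) ^ 2)).

Definition c_function (alpha beta lambda : R) : C :=
  let s := ((RtoC (rho alpha beta) + Ci * RtoC lambda) / RtoC 2)%C in
  (Rpow_C 2 (RtoC (rho alpha beta) - Ci * RtoC lambda)
     * CGamma (RtoC (alpha + 1)) * CGamma (Ci * RtoC lambda)
     / (CGamma s * CGamma (s - RtoC beta)))%C.

Definition m_weight (alpha beta t : R) : R :=
  / sqrt (2 * PI) * Rpower 2 (2 * rho alpha beta)
    * Rpower (sinh t) (2 * alpha + 1) * Rpower (cosh t) (2 * beta + 1).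

Definition n_weight (alpha beta lambda : R) : R :=
  / sqrt (2 * PI) * / (Cmod (c_function alpha beta lambda)) ^ 2.

Definition jacobi_tilde (alpha beta lambda t : R) : R :=
  jacobi alpha beta lambda t / jacobi alpha beta 0 t.

Definition m_tilde (alpha beta t : R) : R :=
  (jacobi alpha beta 0 t) ^ 2 * m_weight alpha beta t.

(* C_c^oo(R_+), complex valued.  The compact support lies in the open
   half-line; functions are extended by 0 to the whole line. *)
Definition test_function (f : R -> C) : Prop :=
  (forall (n : nat) (t : R), ex_derive_n (fun s => Re (f s)) n t) /\
  (forall (n : nat) (t : R), ex_derive_n (fun s => Im (f s)) n t) /\
  (exists a b : R, 0 < a /\ a < b /\ forall t : R, f t <> RtoC 0 -> a <= t <= b).

Definition jacobi_transform (alpha beta zeta kappa sigma : R)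
    (f : R -> C) (lambda : R) : C :=
  (RtoC (Rpower (lambda ^ 2 + zeta ^ 2) (- (sigma / 2)))
   * @RInt_gen C_R_CompleteNormedModule
       (fun t => RtoC (Rpower t (- kappa)) * f t
                 * RtoC (jacobi_tilde alpha beta lambda t)
                 * RtoC (m_tilde alpha beta t))%C
       (at_right 0) (Rbar_locally p_infty))%C.

(* N is the (finite) value of (int_0^oo |g|^r w)^(1/r). *)
Definition is_weighted_norm (w : R -> R) (r : R) (g : R -> C) (N : R) : Prop :=
  exists I : R,
    is_RInt_gen (fun x => rpow (Cmod (g x)) r * w x)
      (at_right 0) (Rbar_locally p_infty) I /\
    N = rpow I (1 / r).

(* Main.v *)
Require Import Defs.
From Stdlib Require Import Reals.
From Coquelicot Require Import Coquelicot.
From Stdlib Require Import Lra Lia Psatz Factorial Classical ClassicalEpsilon.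
Open Scope R_scope.

(** The inequality is tested on functions concentrated near one scale.  For
    [2a < b] take a smooth [f >= 0] comparable to [t^(-kappa/(p-1))] on [[2a, b]]
    and supported in [[a, 2b]].  This is the extremal choice in Hoelder's
    inequality: [f^p] is dominated by [t^(-kappa) f], so with
    [X = int t^(-kappa) f m~] the right-hand side is [O(X^(1/p))], while [X] itself
    dominates [int_(2a)^b t^(-kappa p') m~].  On the other side, the quotient
    [phi~_lam] is at least [1/2] on the support of [f] as soon as
    [lam <= 1/(4b)], so no cancellation occurs and the transform is at least
    [(lam^2 + zeta^2)^(-sigma/2) X/2] there.  Dividing by [X^(1/p)] gives, for
    [0 < l1 < l2 <= 1/(4b)],
    [(int_(2a)^b t^(-kappa p') m~)^(1/p')
      * (int_(l1)^(l2) (lam^2 + zeta^2)^(-sigma q/2) n)^(1/q) <= K']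
    with [K'] independent of [a, b, l1, l2] ([main_inequality]).

    All the conditions follow by choosing the two intervals.  Fixing the
    frequencies and letting [a -> 0] gives [kappa p' < 2 (alpha + 1)]; fixing
    [a, b] and letting [l1 -> 0] gives [sigma q < 3] when [zeta = 0]; taking [t] of
    size [r] and [lam] of size [1/r] gives the two remaining inequalities as
    [r -> 0] and [r -> oo].  Only lower bounds of the weights are involved:
    [m~ >= k t^(2 alpha + 1)] and [m~ >= k t^2] for small and large [t],
    [n >= k lam^2] and [n >= k lam^(2 alpha + 1)] for small and large [lam].

    The bound [phi~_lam(t) >= 1 - lam t] is an energy estimate.  The quotient
    [u = phi~_lam] solves [u'' + (log m~)' u' + lam^2 u = 0] with [u(0) = 1] and
    [u'(0) = 0]; since [m~] increases, [u'^2 + lam^2 u^2] decreases and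
    [|u'| <= lam] ([jacobi_tilde_ge]).  That [m~] increases, and the bound
    [phi_0(t) >= (1 + rho t) exp(- rho t)] behind [m~ >= k t^2], both come from
    the equation of [g = exp(rho t) phi_0], a first-order inequality for [g']
    ([ground_slope], [ground_value]).

    To use these differential equations for all [t], the Gauss function must be
    continued from [(-1, 1)] to [(-oo, 1)].  Pfaff's substitution [z = x/(x-1)]
    maps [(-oo, 1/2)] into the unit interval around 0, where the transformed
    equation has a power series solution of radius 1; an energy argument matches
    it with the Gauss series ([pfaff_eq_hyper_series]), every solution is analytic
    at regular points ([regular_solution_analytic]), and by the identity theorem
    this is the only continuation ([gauss_2F1_real]).

    For [n] one needs the size of the c-function.  The product in Euler's limit
    for Gamma has factors [1 + O(1/n^2)], so it converges to a nonzero value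
    ([CGamma_limit]).  The moduli of the approximants are products of the numbers
    [(x+k)^2 + y^2]; the duplication identity turns the product for
    [Gamma(i lam)] into the products at [0] and [1/2] with [y = lam/2], and
    shifting [x] changes such products in a telescoping way
    ([ln_sqprod_shift], [Gamma_quotient_bound]). *)


(** * Elementary calculus *)

Ltac rewrite_derive G :=
  match type of G with
  | is_derive ?f ?x ?l =>
      let E := fresh in
      assert (E : Derive (fun z => f z) x = l) by exact (is_derive_unique _ _ _ G);
      rewrite E; clear E
  end.

Ltac real_eq := match goal with |- @eq _ ?u ?v => change (@eq R u v) end.

Lemma derive_nonpos_decreasing (f df : R -> R) (a b : R) :
  a <= b ->
  (forall x, a <= x <= b -> is_derive f x (df x)) ->
  (forall x, a < x < b -> df x <= 0) -> f b <= f a.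
Proof.
  intros Hab Hd Hs.
  destruct (Req_dec a b) as [->|Hne]; [lra|].
  destruct (MVT_cor2 f df a b) as [c [Hc1 Hc2]]; [lra| |].
  { intros c Hc. apply is_derive_Reals. now apply Hd. }
  assert (df c <= 0) by now apply Hs.
  assert (0 < b - a) by lra. nra.
Qed.

Lemma derive_nonneg_increasing (f df : R -> R) (a b : R) :
  a <= b ->
  (forall x, a <= x <= b -> is_derive f x (df x)) ->
  (forall x, a < x < b -> 0 <= df x) -> f a <= f b.
Proof.
  intros Hab Hd Hs.
  enough (- f b <= - f a) by lra.
  apply (derive_nonpos_decreasing (fun x => - f x) (fun x => - df x)); auto.
  - intros x Hx. apply (is_derive_opp f x (df x)). now apply Hd.
  - intros x Hx. specialize (Hs x Hx). lra.
Qed.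

Lemma is_derive_continuous (f : R -> R) (x l : R) :
  is_derive f x l -> continuous f x.
Proof.
  intros H. apply (ex_derive_continuous (V := R_NormedModule)). now exists l.
Qed.

(** Gronwall: [(D^2 + D'^2) exp(- C h)] decreases for [C = 1 + 3 L]. *)
Lemma second_order_zero_right (D D1 D2 : R -> R) (d L : R) :
  0 <= L ->
  (forall h, 0 <= h < d -> is_derive D h (D1 h)) ->
  (forall h, 0 <= h < d -> is_derive D1 h (D2 h)) ->
  (forall h, 0 <= h < d -> Rabs (D2 h) <= L * (Rabs (D h) + Rabs (D1 h))) ->
  D 0 = 0 -> D1 0 = 0 -> forall h, 0 <= h < d -> D h = 0.
Proof.
  intros HL H1 H2 HB E0 E1 h Hh.
  set (Cst := 1 + 3 * L).
  set (F := fun x => (D x ^ 2 + D1 x ^ 2) * exp (- Cst * x)).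
  set (F' := fun x => (2 * D x * D1 x + 2 * D1 x * D2 x
                       - Cst * (D x ^ 2 + D1 x ^ 2)) * exp (- Cst * x)).
  assert (HF : F h <= F 0).
  { apply (derive_nonpos_decreasing F F' 0 h); [lra| |].
    - intros x Hx. unfold F, F'.
      assert (G1 := H1 x ltac:(lra)). assert (G2 := H2 x ltac:(lra)).
      auto_derive.
      + repeat split; eexists; eassumption.
      + rewrite_derive G1. rewrite_derive G2. ring.
    - intros x Hx. unfold F'.
      assert (HBx := HB x ltac:(lra)).
      assert (He := exp_pos (- Cst * x)).
      enough (2 * D x * D1 x + 2 * D1 x * D2 x <= Cst * (D x ^ 2 + D1 x ^ 2)) by nra.
      set (u := Rabs (D x)) in *. set (v := Rabs (D1 x)) in *.
      assert (Hu : 0 <= u) by apply Rabs_pos.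
      assert (Hv : 0 <= v) by apply Rabs_pos.
      assert (A1 : D x * D1 x <= u * v).
      { unfold u, v. rewrite <- Rabs_mult. apply Rle_abs. }
      assert (A2 : D1 x * D2 x <= v * (L * (u + v))).
      { eapply Rle_trans; [apply Rle_abs|]. rewrite Rabs_mult. fold v.
        now apply Rmult_le_compat_l. }
      assert (A3 : D x ^ 2 = u ^ 2) by (unfold u; now rewrite pow2_abs).
      assert (A4 : D1 x ^ 2 = v ^ 2) by (unfold v; now rewrite pow2_abs).
      rewrite A3, A4. unfold Cst. clearbody u v. clear - Hu Hv HL A1 A2.
      assert (A5 : 2 * (u * v) <= u ^ 2 + v ^ 2) by (pose proof (pow2_ge_0 (u - v)); nra).
      assert (A6 : L * (2 * (u * v)) <= L * (u ^ 2 + v ^ 2))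
        by now apply Rmult_le_compat_l.
      assert (0 <= L * u ^ 2) by (apply Rmult_le_pos; [lra|nra]).
      nra. }
  unfold F in HF. rewrite E0, E1 in HF.
  assert (He := exp_pos (- Cst * h)).
  assert (D h ^ 2 + D1 h ^ 2 <= 0) by nra.
  nra.
Qed.

Lemma second_order_zero (D D1 D2 : R -> R) (d L : R) :
  0 <= L ->
  (forall h, Rabs h < d -> is_derive D h (D1 h)) ->
  (forall h, Rabs h < d -> is_derive D1 h (D2 h)) ->
  (forall h, Rabs h < d -> Rabs (D2 h) <= L * (Rabs (D h) + Rabs (D1 h))) ->
  D 0 = 0 -> D1 0 = 0 -> forall h, Rabs h < d -> D h = 0.
Proof.
  intros HL H1 H2 HB E0 E1 h Hh.
  destruct (Rle_dec 0 h) as [Hp|Hn].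
  - rewrite Rabs_pos_eq in Hh by lra.
    apply (second_order_zero_right D D1 D2 d L HL); auto; try lra;
      intros k Hk; [apply H1|apply H2|apply HB]; rewrite Rabs_pos_eq; lra.
  - rewrite Rabs_left in Hh by lra.
    replace h with (- (- h)) by ring.
    assert (Q : forall k, 0 <= k < d -> Rabs (- k) < d)
      by (intros k Hk; rewrite Rabs_Ropp, Rabs_pos_eq; lra).
    apply (second_order_zero_right (fun k => D (- k)) (fun k => - D1 (- k))
             (fun k => D2 (- k)) d L HL); try lra.
    + intros k Hk. assert (G := H1 (- k) (Q k Hk)).
      auto_derive; [eexists; eassumption|].
      rewrite_derive G. ring.
    + intros k Hk. assert (G := H2 (- k) (Q k Hk)).
      auto_derive; [eexists; eassumption|].
      rewrite_derive G. ring.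
    + intros k Hk. rewrite Rabs_Ropp. now apply HB, Q.
    + now rewrite Ropp_0.
    + rewrite Ropp_0, E1. ring.
Qed.

(** * Power series and linear differential equations *)

Lemma CV_radius_ge_geometric (a : nat -> R) (M L : R) :
  0 < L -> (forall n, Rabs (a n) <= M * L ^ n) -> Rbar_le (/ L) (CV_radius a).
Proof.
  intros HL Ha.
  apply (proj1 (CV_radius_bounded a)).
  exists M. intros n.
  rewrite Rabs_mult, <- RPow_abs, (Rabs_pos_eq (/ L)).
  2: left; now apply Rinv_0_lt_compat.
  rewrite pow_inv.
  assert (0 < L ^ n) by now apply pow_lt.
  apply (Rmult_le_reg_r (L ^ n)); [easy|].
  rewrite Rmult_assoc, Rinv_l by lra. rewrite Rmult_1_r. apply Ha.
Qed.

Lemma CV_radius_dominated (a b : nat -> R) :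
  (forall n, Rabs (a n) <= Rabs (b n)) -> Rbar_le (CV_radius b) (CV_radius a).
Proof.
  intros Hab. apply (proj2 (CV_radius_bounded b)).
  intros r [M HM]. apply (proj1 (CV_radius_bounded a)).
  exists M. intros n. eapply Rle_trans; [|apply HM].
  rewrite !Rabs_mult. apply Rmult_le_compat_r; [apply Rabs_pos|easy].
Qed.

Lemma is_derive2_PSeries (a : nat -> R) (x : R) :
  Rbar_lt (Rabs x) (CV_radius a) ->
  is_derive (PSeries (PS_derive a)) x (PSeries (PS_derive (PS_derive a)) x).
Proof.
  intros H. apply is_derive_PSeries. now rewrite CV_radius_derive.
Qed.

(** The coefficient of [x^n] in the left-hand side of
    [(P0 + P1 x + P2 x^2 + P3 x^3) y'' + (Q0 + Q1 x + Q2 x^2) y' + S y]. *)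
Definition ode_coef (P0 P1 P2 P3 Q0 Q1 Q2 S : R) (a : nat -> R) (n : nat) : R :=
  let d1 := PS_derive a in
  let d2 := PS_derive d1 in
  let sh := @PS_incr_1 R_AbsRing R_NormedModule in
  P0 * d2 n + P1 * sh d2 n + P2 * sh (sh d2) n + P3 * sh (sh (sh d2)) n
  + (Q0 * d1 n + Q1 * sh d1 n + Q2 * sh (sh d1) n) + S * a n.

Lemma PSeries_solves_ode (P0 P1 P2 P3 Q0 Q1 Q2 S : R) (a : nat -> R) (x : R) :
  (forall n, ode_coef P0 P1 P2 P3 Q0 Q1 Q2 S a n = 0) ->
  Rbar_lt (Rabs x) (CV_radius a) ->
  (P0 + P1 * x + P2 * x ^ 2 + P3 * x ^ 3) * PSeries (PS_derive (PS_derive a)) x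
  + (Q0 + Q1 * x + Q2 * x ^ 2) * PSeries (PS_derive a) x + S * PSeries a x = 0.
Proof.
  intros Hc Hx.
  set (d1 := PS_derive a). set (d2 := PS_derive d1).
  assert (Ha : is_pseries a x (PSeries a x))
    by now apply PSeries_correct, CV_radius_inside.
  assert (H1 : is_pseries d1 x (PSeries d1 x)).
  { apply PSeries_correct, CV_radius_inside. unfold d1. now rewrite CV_radius_derive. }
  assert (H2 : is_pseries d2 x (PSeries d2 x)).
  { apply PSeries_correct, CV_radius_inside. unfold d2, d1. now rewrite !CV_radius_derive. }
  assert (Hsh : forall (u : nat -> R) (l : R), is_pseries u x l ->
     is_pseries (@PS_incr_1 R_AbsRing R_NormedModule u) x (x * l))
    by (intros u l Hu; exact (is_pseries_incr_1 u x l Hu)).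
  assert (Hsc : forall (k : R) (u : nat -> R) (l : R), is_pseries u x l ->
     is_pseries (fun n => k * u n) x (k * l))
    by (intros k u l Hu; exact (is_pseries_scal k u x l (Rmult_comm _ _) Hu)).
  assert (Hpl : forall (u v : nat -> R) (l m : R), is_pseries u x l -> is_pseries v x m ->
     is_pseries (fun n => u n + v n) x (l + m))
    by (intros u v l m Hu Hv; exact (is_pseries_plus u v x l m Hu Hv)).
  assert (T : is_pseries (ode_coef P0 P1 P2 P3 Q0 Q1 Q2 S a) x
     (P0 * PSeries d2 x + P1 * (x * PSeries d2 x) + P2 * (x * (x * PSeries d2 x))
      + P3 * (x * (x * (x * PSeries d2 x)))
      + (Q0 * PSeries d1 x + Q1 * (x * PSeries d1 x) + Q2 * (x * (x * PSeries d1 x)))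
      + S * PSeries a x)).
  { exact (Hpl _ _ _ _ (Hpl _ _ _ _
        (Hpl _ _ _ _ (Hpl _ _ _ _ (Hpl _ _ _ _ (Hsc P0 _ _ H2) (Hsc P1 _ _ (Hsh _ _ H2)))
          (Hsc P2 _ _ (Hsh _ _ (Hsh _ _ H2)))) (Hsc P3 _ _ (Hsh _ _ (Hsh _ _ (Hsh _ _ H2)))))
        (Hpl _ _ _ _ (Hpl _ _ _ _ (Hsc Q0 _ _ H1) (Hsc Q1 _ _ (Hsh _ _ H1)))
          (Hsc Q2 _ _ (Hsh _ _ (Hsh _ _ H1)))))
        (Hsc S _ _ Ha)). }
  assert (Z : is_pseries (ode_coef P0 P1 P2 P3 Q0 Q1 Q2 S a) x 0).
  { assert (Z0 := Hsc 0 a _ Ha). rewrite Rmult_0_l in Z0.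
    revert Z0. apply is_pseries_ext. intros n. rewrite Hc. apply Rmult_0_l. }
  apply is_pseries_unique in T. apply is_pseries_unique in Z.
  rewrite Z in T. rewrite T. ring.
Qed.

Definition analyticR (f : R -> R) (x0 : R) : Prop :=
  exists (u : nat -> R) (r : R), 0 < r /\
    forall x : R, Rabs (x - x0) < r -> is_pseries u (x - x0) (f x).

(** The recurrence for the coefficients at a point where the leading coefficient
    [P0 + P1 h + P2 h^2] does not vanish. *)
Definition regular_step (P0 P1 P2 Q0 Q1 S : R) (n : nat) (an an1 : R) : R :=
  - ((P1 * (INR n + 1) * INR n + Q0 * (INR n + 1)) * an1
     + (P2 * INR n * (INR n - 1) + Q1 * INR n + S) * an)
  / (P0 * (INR n + 2) * (INR n + 1)).

(** Consecutive coefficients are carried in pairs because the recurrence has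
    order two. *)
Fixpoint regular_pair (P0 P1 P2 Q0 Q1 S a0 a1 : R) (n : nat) : R * R :=
  match n with
  | O => (a0, a1)
  | Datatypes.S k =>
      let (u, v) := regular_pair P0 P1 P2 Q0 Q1 S a0 a1 k in
      (v, regular_step P0 P1 P2 Q0 Q1 S k u v)
  end.

Section Regular.
Variables P0 P1 P2 Q0 Q1 S : R.
Hypothesis HP0 : P0 <> 0.

Lemma regular_coefs (a0 a1 : R) :
  exists a : nat -> R, a 0%nat = a0 /\ a 1%nat = a1 /\
    forall n, a (n + 2)%nat = regular_step P0 P1 P2 Q0 Q1 S n (a n) (a (n + 1)%nat).
Proof.
  exists (fun n => fst (regular_pair P0 P1 P2 Q0 Q1 S a0 a1 n)).
  split; [easy|split; [easy|]]. intros n.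
  replace (n + 2)%nat with (Datatypes.S (Datatypes.S n)) by lia.
  replace (n + 1)%nat with (Datatypes.S n) by lia.
  simpl. destruct (regular_pair P0 P1 P2 Q0 Q1 S a0 a1 n). easy.
Qed.

Let B := (Rabs P1 + Rabs Q0 + Rabs P2 + Rabs Q1 + Rabs S) / Rabs P0.

Lemma regular_step_bound n u v :
  Rabs (regular_step P0 P1 P2 Q0 Q1 S n u v) <= B * (Rabs v + Rabs u).
Proof.
  unfold regular_step, B. set (x := INR n).
  assert (Hx : x = 0 \/ 1 <= x).
  { unfold x. destruct n; [now left|right]. rewrite S_INR. assert (0 <= INR n) by apply pos_INR. lra. }
  assert (Hx0 : 0 <= x) by (destruct Hx; lra).
  assert (HA : 0 < Rabs P0) by now apply Rabs_pos_lt.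
  unfold Rdiv at 1. rewrite Rabs_mult, Rabs_Ropp, Rabs_inv.
  rewrite !Rabs_mult, (Rabs_pos_eq (x + 2)), (Rabs_pos_eq (x + 1)) by lra.
  set (w := (x + 2) * (x + 1)).
  assert (Hw : 0 < w) by (unfold w; nra).
  replace (Rabs P0 * (x + 2) * (x + 1)) with (Rabs P0 * w) by (unfold w; ring).
  apply (Rmult_le_reg_r (Rabs P0 * w)); [nra|].
  rewrite Rmult_assoc, Rinv_l, Rmult_1_r by nra.
  replace ((Rabs P1 + Rabs Q0 + Rabs P2 + Rabs Q1 + Rabs S) / Rabs P0 *
           (Rabs v + Rabs u) * (Rabs P0 * w))
    with (((Rabs P1 + Rabs Q0) * w + (Rabs P2 + Rabs Q1 + Rabs S) * w) * (Rabs v + Rabs u))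
    by (field; lra).
  assert (G : forall c k, 0 <= k <= w -> Rabs (c * k) <= Rabs c * w).
  { intros c k Hk. rewrite Rabs_mult, (Rabs_pos_eq k) by lra.
    apply Rmult_le_compat_l; [apply Rabs_pos|lra]. }
  assert (N : forall z, 0 <= Rabs z) by (intros; apply Rabs_pos).
  assert (U : Rabs (P1 * (x + 1) * x + Q0 * (x + 1)) <= (Rabs P1 + Rabs Q0) * w).
  { eapply Rle_trans; [apply Rabs_triang|].
    rewrite Rmult_plus_distr_r. apply Rplus_le_compat.
    - rewrite Rmult_assoc. apply G. unfold w; nra.
    - apply G. unfold w; nra. }
  assert (V : Rabs (P2 * x * (x - 1) + Q1 * x + S) <= (Rabs P2 + Rabs Q1 + Rabs S) * w).
  { eapply Rle_trans; [apply Rabs_triang|].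
    rewrite Rmult_plus_distr_r. apply Rplus_le_compat.
    - eapply Rle_trans; [apply Rabs_triang|].
      rewrite Rmult_plus_distr_r. apply Rplus_le_compat.
      + rewrite Rmult_assoc. apply G. unfold w. destruct Hx; nra.
      + apply G. unfold w; nra.
    - assert (1 <= w) by (unfold w; nra). specialize (N S). nra. }
  eapply Rle_trans; [apply Rabs_triang|]. rewrite !Rabs_mult.
  assert (Nu := N u). assert (Nv := N v).
  assert (0 <= (Rabs P1 + Rabs Q0) * w) by (eapply Rle_trans; [apply N|exact U]).
  assert (0 <= (Rabs P2 + Rabs Q1 + Rabs S) * w) by (eapply Rle_trans; [apply N|exact V]).
  nra.
Qed.

(** [|a_(n+2)| <= B (|a_(n+1)| + |a_n|)] gives geometric growth of ratio at most
    [2 B + 1]; any positive radius is enough for analyticity. *)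
Lemma regular_coefs_bound (a : nat -> R) :
  (forall n, a (n + 2)%nat = regular_step P0 P1 P2 Q0 Q1 S n (a n) (a (n + 1)%nat)) ->
  Rbar_le (/ (2 * B + 1)) (CV_radius a).
Proof.
  intros Ha.
  assert (HB : 0 <= B).
  { unfold B. apply Rmult_le_pos.
    - pose proof (Rabs_pos P1); pose proof (Rabs_pos P2); pose proof (Rabs_pos Q0);
      pose proof (Rabs_pos Q1); pose proof (Rabs_pos S). lra.
    - left. apply Rinv_0_lt_compat. now apply Rabs_pos_lt. }
  set (L := 2 * B + 1). assert (HL : 1 <= L) by (unfold L; lra).
  set (M := Rabs (a 0%nat) + Rabs (a 1%nat)).
  assert (M0 := Rabs_pos (a 0%nat)). assert (M1 := Rabs_pos (a 1%nat)).
  apply CV_radius_ge_geometric with M; [lra|].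
  assert (HH : forall n, Rabs (a n) <= M * L ^ n /\ Rabs (a (n + 1)%nat) <= M * L ^ (n + 1)).
  { induction n as [|n [I1 I2]].
    - simpl. unfold M. split; nra.
    - replace (Datatypes.S n) with (n + 1)%nat by lia. split; [easy|].
      replace (n + 1 + 1)%nat with (n + 2)%nat by lia. rewrite Ha.
      eapply Rle_trans; [apply regular_step_bound|].
      rewrite !pow_add in *. simpl. simpl in I2.
      assert (0 < L ^ n) by (apply pow_lt; lra).
      assert (0 <= M * L ^ n) by (unfold M; nra).
      set (z := M * L ^ n) in *.
      replace (M * (L ^ n * (L * (L * 1)))) with (z * L * L) by (unfold z; ring).
      replace (M * (L ^ n * (L * 1))) with (z * L) in I2 by (unfold z; ring).
      assert (B * (Rabs (a (n + 1)%nat) + Rabs (a n)) <= B * (z * L + z))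
        by (apply Rmult_le_compat_l; lra).
      assert (B * (z * L + z) <= B * (2 * (z * L))) by (apply Rmult_le_compat_l; nra).
      unfold L in *. nra. }
  intros n. apply HH.
Qed.

(** A solution is compared with the power series solution having the same value
    and slope at [x0]; Gronwall's inequality makes them agree near [x0]. *)
Lemma regular_solution_analytic (y y1 y2 : R -> R) (x0 d : R) :
  0 < d ->
  (forall x, Rabs (x - x0) < d -> is_derive y x (y1 x)) ->
  (forall x, Rabs (x - x0) < d -> is_derive y1 x (y2 x)) ->
  (forall x, Rabs (x - x0) < d ->
     (P0 + P1 * (x - x0) + P2 * (x - x0) ^ 2) * y2 x
     + (Q0 + Q1 * (x - x0)) * y1 x + S * y x = 0) ->
  analyticR y x0.
Proof.
  intros Hd Hy1 Hy2 Hode.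
  destruct (regular_coefs (y x0) (y1 x0)) as [a [A0 [A1 Arec]]].
  assert (Hrad := regular_coefs_bound a Arec).
  assert (HB : 0 <= B).
  { unfold B. apply Rmult_le_pos.
    - pose proof (Rabs_pos P1); pose proof (Rabs_pos P2); pose proof (Rabs_pos Q0);
      pose proof (Rabs_pos Q1); pose proof (Rabs_pos S). lra.
    - left. apply Rinv_0_lt_compat. now apply Rabs_pos_lt. }
  set (r0 := / (2 * B + 1)) in *.
  assert (Hr0 : 0 < r0) by (apply Rinv_0_lt_compat; lra).
  assert (Hin : forall h, Rabs h < r0 -> Rbar_lt (Rabs h) (CV_radius a)).
  { intros h Hh. eapply Rbar_lt_le_trans; [|exact Hrad]. exact Hh. }
  assert (HAP : 0 < Rabs P0) by now apply Rabs_pos_lt.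
  (* For |h| <= r1 <= 1 the leading coefficient stays above |P0|/2. *)
  set (K := Rabs P1 + Rabs P2 + 1).
  assert (HK : 1 <= K) by (unfold K; pose proof (Rabs_pos P1); pose proof (Rabs_pos P2); lra).
  set (r1 := Rabs P0 / (2 * K)).
  assert (Hr1 : 0 < r1) by (apply Rdiv_lt_0_compat; lra).
  set (r := Rmin (Rmin d r0) (Rmin r1 1)).
  assert (Hr : 0 < r) by (unfold r; repeat apply Rmin_pos; lra).
  assert (Hrle : r <= d /\ r <= r0 /\ r <= r1 /\ r <= 1).
  { unfold r. repeat split.
    - eapply Rle_trans; apply Rmin_l.
    - eapply Rle_trans; [apply Rmin_l|apply Rmin_r].
    - eapply Rle_trans; [apply Rmin_r|apply Rmin_l].
    - eapply Rle_trans; apply Rmin_r. }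
  destruct Hrle as [Hd' [Hr0' [Hr1' Hr2']]].
  set (d1 := PS_derive a). set (d2 := PS_derive d1).
  assert (Hser : forall h, Rabs h < r0 ->
     (P0 + P1 * h + P2 * h ^ 2) * PSeries d2 h + (Q0 + Q1 * h) * PSeries d1 h
     + S * PSeries a h = 0).
  { intros h Hh.
    assert (E := PSeries_solves_ode P0 P1 P2 0 Q0 Q1 0 S a h).
    fold d1 d2 in E. rewrite <- E.
    - ring.
    - intros n. unfold ode_coef. fold d1 d2.
      assert (R2 : forall k, d2 k = (INR k + 1) * ((INR k + 2) * a (k + 2)%nat)).
      { intros k. unfold d2, d1, PS_derive. rewrite !S_INR.
        replace (Datatypes.S (Datatypes.S k)) with (k + 2)%nat by lia. ring. }
      assert (R1 : forall k, d1 k = (INR k + 1) * a (k + 1)%nat).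
      { intros k. unfold d1, PS_derive. rewrite S_INR.
        replace (Datatypes.S k) with (k + 1)%nat by lia. ring. }
      assert (T : P0 * d2 n = - ((P1 * (INR n + 1) * INR n + Q0 * (INR n + 1)) * a (n + 1)%nat
          + (P2 * INR n * (INR n - 1) + Q1 * INR n + S) * a n)).
      { rewrite R2, Arec. unfold regular_step. field.
        pose proof (pos_INR n). repeat split; try lra. }
      rewrite T.
      destruct n as [|[|n]]; cbn [PS_incr_1]; change zero with 0.
      + rewrite R1. simpl. ring.
      + rewrite R1, R2, R1. simpl. ring.
      + rewrite !R1, !R2. rewrite !S_INR.
        replace (Datatypes.S (Datatypes.S n) + 1)%nat with (n + 3)%nat by lia.
        replace (Datatypes.S n + 2)%nat with (n + 3)%nat by lia.
        replace (Datatypes.S (Datatypes.S n)) with (n + 2)%nat by lia.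
        replace (Datatypes.S n + 1)%nat with (n + 2)%nat by lia.
        ring.
    - now apply Hin. }
  assert (Hz0 : forall u : nat -> R, PSeries u 0 = u 0%nat) by (intros; apply PSeries_0).
  assert (Heq : forall h, Rabs h < r -> y (x0 + h) - PSeries a h = 0).
  { intros h Hh.
    set (LL := (Rabs Q0 + Rabs Q1 + Rabs S) * (2 / Rabs P0)).
    assert (Hsh : forall k, Rabs k < r -> Rabs (x0 + k - x0) < d)
      by (intros k Hk; replace (x0 + k - x0) with k by ring; lra).
    apply (second_order_zero (fun h => y (x0 + h) - PSeries a h)
             (fun h => y1 (x0 + h) - PSeries d1 h)
             (fun h => y2 (x0 + h) - PSeries d2 h) r LL); auto.
    - unfold LL. apply Rmult_le_pos.
      + pose proof (Rabs_pos Q0); pose proof (Rabs_pos Q1); pose proof (Rabs_pos S). lra.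
      + left. apply Rdiv_lt_0_compat; lra.
    - intros k Hk. apply (is_derive_minus (fun h => y (x0 + h)) (PSeries a)).
      + assert (G := Hy1 (x0 + k) (Hsh k Hk)).
        auto_derive; [eexists; eassumption|].
        rewrite_derive G. ring.
      + apply is_derive_PSeries. apply Hin. lra.
    - intros k Hk. apply (is_derive_minus (fun h => y1 (x0 + h)) (PSeries d1)).
      + assert (G := Hy2 (x0 + k) (Hsh k Hk)).
        auto_derive; [eexists; eassumption|].
        rewrite_derive G. ring.
      + apply is_derive2_PSeries. apply Hin. lra.
    - intros k Hk.
      assert (E1 := Hode (x0 + k) (Hsh k Hk)).
      replace (x0 + k - x0) with k in E1 by ring.
      assert (E2 := Hser k ltac:(lra)).
      set (D := y (x0 + k) - PSeries a k).
      set (D1 := y1 (x0 + k) - PSeries d1 k).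
      set (D2 := y2 (x0 + k) - PSeries d2 k).
      set (pk := P0 + P1 * k + P2 * k ^ 2) in *.
      assert (E3 : pk * D2 = - ((Q0 + Q1 * k) * D1 + S * D)) by (unfold D, D1, D2; nra).
      assert (Hk1 : Rabs k <= 1) by lra.
      assert (Hk0 := Rabs_pos k).
      assert (Hpk : Rabs P0 / 2 <= Rabs pk).
      { assert (Hq : Rabs (P1 * k + P2 * k ^ 2) <= Rabs P0 / 2).
        { eapply Rle_trans; [apply Rabs_triang|].
          rewrite !Rabs_mult, <- RPow_abs.
          assert (K * Rabs k <= Rabs P0 / 2).
          { replace (Rabs P0 / 2) with (K * r1) by (unfold r1; field; lra).
            apply Rmult_le_compat_l; lra. }
          pose proof (Rabs_pos P1); pose proof (Rabs_pos P2).
          assert (Rabs P2 * Rabs k ^ 2 <= Rabs P2 * Rabs k)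
            by (apply Rmult_le_compat_l; nra).
          unfold K in *. nra. }
        assert (Rabs P0 <= Rabs pk + Rabs (P1 * k + P2 * k ^ 2)).
        { replace P0 with (pk + - (P1 * k + P2 * k ^ 2)) by (unfold pk; ring).
          eapply Rle_trans; [apply Rabs_triang|]. rewrite Rabs_Ropp.
          unfold pk. right. f_equal; f_equal; ring. }
        lra. }
      assert (E4 : Rabs pk * Rabs D2 <= (Rabs Q0 + Rabs Q1 + Rabs S) * (Rabs D + Rabs D1)).
      { rewrite <- Rabs_mult, E3, Rabs_Ropp.
        eapply Rle_trans; [apply Rabs_triang|]. rewrite !Rabs_mult.
        assert (Rabs (Q0 + Q1 * k) <= Rabs Q0 + Rabs Q1).
        { eapply Rle_trans; [apply Rabs_triang|]. rewrite Rabs_mult.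
          pose proof (Rabs_pos Q1). nra. }
        pose proof (Rabs_pos D); pose proof (Rabs_pos D1); pose proof (Rabs_pos S);
        pose proof (Rabs_pos Q0); pose proof (Rabs_pos Q1). nra. }
      assert (Rabs P0 / 2 * Rabs D2 <= Rabs pk * Rabs D2)
        by (apply Rmult_le_compat_r; [apply Rabs_pos|easy]).
      unfold LL.
      apply (Rmult_le_reg_l (Rabs P0 / 2)); [lra|].
      replace (Rabs P0 / 2 * ((Rabs Q0 + Rabs Q1 + Rabs S) * (2 / Rabs P0) * (Rabs D + Rabs D1)))
        with ((Rabs Q0 + Rabs Q1 + Rabs S) * (Rabs D + Rabs D1)) by (field; lra).
      lra.
    - rewrite Hz0, A0, Rplus_0_r. ring.
    - rewrite Hz0. unfold d1, PS_derive. rewrite A1, Rplus_0_r. simpl. ring. }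
  exists a, r. split; [easy|]. intros x Hx.
  replace (y x) with (PSeries a (x - x0)).
  - apply PSeries_correct, CV_radius_inside, Hin. lra.
  - specialize (Heq (x - x0) Hx). replace (x0 + (x - x0)) with x in Heq by ring. lra.
Qed.

End Regular.

(** * The Gauss equation and its real analytic continuation *)

(** The Gauss equation with [a + b = al + be + 1], [a b = mu], [c = al + 1]. *)
Definition hyper_ode (al be mu : R) (y y1 y2 : R -> R) (x : R) : Prop :=
  is_derive y x (y1 x) /\ is_derive y1 x (y2 x) /\
  x * (1 - x) * y2 x + (al + 1 - (al + be + 2) * x) * y1 x - mu * y x = 0.

(** For conjugate [a], [b] the factor [(a + n)(b + n)] is the real number
    [n^2 + (a + b) n + a b]. *)
Fixpoint hyper_coef (al be mu : R) (n : nat) : R :=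
  match n with
  | O => 1
  | S k => hyper_coef al be mu k
           * ((INR k ^ 2 + (al + be + 1) * INR k + mu)
              / ((al + 1 + INR k) * (INR k + 1)))
  end.

Lemma is_lim_seq_inv_INR_S : is_lim_seq (fun n => / (INR n + 1)) 0.
Proof.
  apply is_lim_seq_ext with (fun n => / INR (S n)).
  - intros n. now rewrite S_INR.
  - apply (is_lim_seq_incr_1 (fun n => / INR n)).
    assert (E : Rbar_inv p_infty = 0) by easy. rewrite <- E.
    apply is_lim_seq_inv; [apply is_lim_seq_INR|easy].
Qed.

Section HyperSeries.
Variables al be mu : R.
Hypothesis Hal : -1/2 < al.
Hypothesis Hbe : -1/2 <= be.
Hypothesis Hab : be <= al.
Hypothesis Hmu : 0 < mu.

Lemma hyper_coef_pos n : 0 < hyper_coef al be mu n.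
Proof.
  induction n as [|n IH]; simpl; [lra|].
  apply Rmult_lt_0_compat; [easy|].
  assert (0 <= INR n) by apply pos_INR.
  apply Rdiv_lt_0_compat; nra.
Qed.

Lemma hyper_coef_radius : CV_radius (hyper_coef al be mu) = 1.
Proof.
  assert (HA := CV_radius_finite_DAlembert (hyper_coef al be mu) 1).
  rewrite Rinv_1 in HA. apply HA; [|lra|].
  { intros n. generalize (hyper_coef_pos n). lra. }
  set (v := fun n => / (INR n + 1)).
  apply is_lim_seq_ext with
    (fun n => (1 + ((al + be + 1) - 2) * v n
               + (mu - (al + be + 1) + 1) * (v n * v n)) / (1 + al * v n)).
  - intros n. generalize (hyper_coef_pos n). intros Hn. unfold v.
    assert (H0 : 0 <= INR n) by apply pos_INR.
    simpl. rewrite Rabs_pos_eq.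
    + field. repeat split; lra.
    + left. apply Rdiv_lt_0_compat; [|easy].
      apply Rmult_lt_0_compat; [easy|]. apply Rdiv_lt_0_compat; nra.
  - assert (Hv := is_lim_seq_inv_INR_S). fold v in Hv.
    assert (Hvv := is_lim_seq_mult' _ _ _ _ Hv Hv).
    assert (L1 : is_lim_seq (fun n => 1 + ((al + be + 1) - 2) * v n
               + (mu - (al + be + 1) + 1) * (v n * v n))
               (1 + ((al + be + 1) - 2) * 0 + (mu - (al + be + 1) + 1) * (0 * 0))).
    { apply is_lim_seq_plus'; [apply is_lim_seq_plus'|].
      - apply is_lim_seq_const.
      - now apply (is_lim_seq_scal_l v _ 0).
      - now apply (is_lim_seq_scal_l (fun n => v n * v n) _ (0 * 0)). }
    assert (L2 : is_lim_seq (fun n => 1 + al * v n) (1 + al * 0)).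
    { apply is_lim_seq_plus'; [apply is_lim_seq_const|].
      now apply (is_lim_seq_scal_l v _ 0). }
    assert (L3 := is_lim_seq_div' _ _ _ _ L1 L2).
    match type of L3 with _ -> is_lim_seq _ (Finite ?l) => replace l with 1 in L3 by field end.
    apply L3. lra.
Qed.

Lemma hyper_coef_recurrence n :
  (al + 1 + INR n) * (INR n + 1) * hyper_coef al be mu (S n)
  = (INR n ^ 2 + (al + be + 1) * INR n + mu) * hyper_coef al be mu n.
Proof. simpl hyper_coef. generalize (pos_INR n). intros H0. field. lra. Qed.

Lemma hyper_series_ode x : Rabs x < 1 ->
  hyper_ode al be mu (PSeries (hyper_coef al be mu))
    (PSeries (PS_derive (hyper_coef al be mu)))
    (PSeries (PS_derive (PS_derive (hyper_coef al be mu)))) x.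
Proof.
  intros Hx.
  assert (HR : Rbar_lt (Rabs x) (CV_radius (hyper_coef al be mu)))
    by (rewrite hyper_coef_radius; exact Hx).
  split; [now apply is_derive_PSeries|split; [now apply is_derive2_PSeries|]].
  assert (E := PSeries_solves_ode 0 1 (-1) 0 (al + 1) (- (al + be + 2)) 0 (- mu)
                 (hyper_coef al be mu) x).
  rewrite <- E; [ring| |easy].
  intros n. unfold ode_coef, PS_derive, PS_incr_1. change zero with 0.
  assert (Hrec := hyper_coef_recurrence n).
  destruct n as [|[|[|n]]]; rewrite ?S_INR in *; simpl INR in *; lra.
Qed.

(** Coefficients of [K(z) = 2F1(a,b;c;z/(z-1))], given as pairs [(k_n, k_{n+1} - k_n)]:
    the differences satisfy a recurrence whose leading coefficients have
    quotient tending to 1, which makes the radius of convergence 1 visible. *)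
Fixpoint pfaff_pair (n : nat) : R * R :=
  match n with
  | O => (1, - mu / (al + 1) - 1)
  | S m =>
      let (k, d) := pfaff_pair m in
      (k + d, (INR m * (INR m - be) * d - (al + be + 2 + mu) * (k + d))
              / ((INR m + 2) * (INR m + 2 + al)))
  end.

Definition pfaff_coef (n : nat) : R := fst (pfaff_pair n).
Definition pfaff_diff (n : nat) : R := snd (pfaff_pair n).

Lemma pfaff_coef_S n : pfaff_coef (S n) = pfaff_coef n + pfaff_diff n.
Proof. unfold pfaff_coef, pfaff_diff. simpl. now destruct (pfaff_pair n). Qed.

Lemma pfaff_diff_S n : pfaff_diff (S n) =
  (INR n * (INR n - be) * pfaff_diff n - (al + be + 2 + mu) * pfaff_coef (S n))
  / ((INR n + 2) * (INR n + 2 + al)).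
Proof.
  rewrite pfaff_coef_S.
  unfold pfaff_coef, pfaff_diff. simpl. now destruct (pfaff_pair n).
Qed.

(** The comparison sequence [prod (1 + M/(k+1))] grows like [n^M], and its ratio
    test is immediate. *)
Fixpoint pfaff_majorant (M : R) (n : nat) : R :=
  match n with
  | O => 1
  | S k => pfaff_majorant M k * (1 + M / (INR k + 1))
  end.

Lemma pfaff_majorant_pos M n : 0 <= M -> 0 < pfaff_majorant M n.
Proof.
  intros HM. induction n as [|n IH]; simpl; [lra|].
  apply Rmult_lt_0_compat; [easy|].
  assert (0 <= INR n) by apply pos_INR.
  assert (0 <= M / (INR n + 1)) by (apply Rdiv_le_0_compat; lra). lra.
Qed.

Lemma pfaff_majorant_radius M : 0 <= M -> CV_radius (pfaff_majorant M) = 1.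
Proof.
  intros HM. assert (HA := CV_radius_finite_DAlembert (pfaff_majorant M) 1).
  rewrite Rinv_1 in HA. apply HA; [|lra|].
  { intros n. generalize (pfaff_majorant_pos M n HM). lra. }
  apply is_lim_seq_ext with (fun n => 1 + M * / (INR n + 1)).
  - intros n. generalize (pfaff_majorant_pos M n HM). intros Hn.
    assert (H0 : 0 <= INR n) by apply pos_INR.
    simpl. rewrite Rabs_pos_eq.
    + field. lra.
    + assert (0 <= M / (INR n + 1)) by (apply Rdiv_le_0_compat; lra).
      left. apply Rdiv_lt_0_compat; [|easy]. apply Rmult_lt_0_compat; lra.
  - assert (L : is_lim_seq (fun n => 1 + M * / (INR n + 1)) (1 + M * 0)).
    { apply is_lim_seq_plus'; [apply is_lim_seq_const|].
      apply (is_lim_seq_scal_l _ _ 0). apply is_lim_seq_inv_INR_S. }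
    now rewrite Rmult_0_r, Rplus_0_r in L.
Qed.

(** [N_n = |k_n| + (n + 1) |d_n|] satisfies [N_(n+1) <= N_n (1 + (M+2)/(n+1))]: the
    weight [n + 1] absorbs the sum [k_(n+1) = k_n + d_n], which alone would only
    give exponential growth. *)
Lemma pfaff_radius : Rbar_le 1 (CV_radius pfaff_coef).
Proof.
  set (M := al + be + 2 + mu). assert (HM : 0 < M) by (unfold M; lra).
  set (N := fun n => Rabs (pfaff_coef n) + (INR n + 1) * Rabs (pfaff_diff n)).
  assert (Hstep : forall n, N (S n) <= N n * (1 + (M + 2) / (INR n + 1))).
  { intros n. unfold N. rewrite S_INR.
    set (m := INR n). assert (Hm : 0 <= m) by apply pos_INR.
    set (k := Rabs (pfaff_coef n)). set (d := Rabs (pfaff_diff n)).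
    assert (Hk0 : 0 <= k) by apply Rabs_pos. assert (Hd0 : 0 <= d) by apply Rabs_pos.
    assert (Hk : Rabs (pfaff_coef (S n)) <= k + d)
      by (rewrite pfaff_coef_S; apply Rabs_triang).
    assert (Hw : 0 < (m + 2) * (m + 2 + al)) by nra.
    assert (Hd : (m + 2) * Rabs (pfaff_diff (S n)) <= (m + 2) * d + M / (m + 1) * (k + d)).
    { rewrite pfaff_diff_S. fold m M. unfold Rdiv at 1.
      rewrite Rabs_mult, Rabs_inv, (Rabs_pos_eq ((m + 2) * (m + 2 + al))) by lra.
      apply (Rmult_le_reg_r (m + 2 + al)); [lra|].
      replace ((m + 2) * (Rabs (m * (m - be) * pfaff_diff n - M * pfaff_coef (S n))
               * / ((m + 2) * (m + 2 + al))) * (m + 2 + al))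
        with (Rabs (m * (m - be) * pfaff_diff n - M * pfaff_coef (S n)))
        by (field; lra).
      eapply Rle_trans; [apply Rabs_triang|].
      rewrite Rabs_Ropp, !Rabs_mult, (Rabs_pos_eq m), (Rabs_pos_eq M) by lra. fold d.
      assert (Hmb : Rabs (m - be) <= m + 2 + al) by (apply Rabs_le; lra).
      assert (T1 : m * Rabs (m - be) * d <= (m + 2) * d * (m + 2 + al)).
      { replace ((m + 2) * d * (m + 2 + al)) with ((m + 2) * (m + 2 + al) * d) by ring.
        apply Rmult_le_compat_r; [easy|]. apply Rmult_le_compat; try lra. apply Rabs_pos. }
      assert (T2 : M * Rabs (pfaff_coef (S n)) <= M / (m + 1) * (k + d) * (m + 2 + al)).
      { replace (M / (m + 1) * (k + d) * (m + 2 + al))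
          with (M * ((k + d) * ((m + 2 + al) / (m + 1)))) by (field; lra).
        apply Rmult_le_compat_l; [lra|].
        eapply Rle_trans; [exact Hk|]. rewrite <- (Rmult_1_r (k + d)) at 1.
        apply Rmult_le_compat_l; [lra|].
        apply (Rmult_le_reg_r (m + 1)); [lra|].
        unfold Rdiv. rewrite Rmult_assoc, Rinv_l by lra. lra. }
      lra. }
    replace (m + 1 + 1) with (m + 2) by ring.
    apply Rle_trans with ((k + d) + ((m + 2) * d + M / (m + 1) * (k + d))); [lra|].
    set (i := / (m + 1)). assert (Hi : i * (m + 1) = 1) by (apply Rinv_l; lra).
    assert (Hi0 : 0 < i) by (apply Rinv_0_lt_compat; lra).
    unfold Rdiv. fold i.
    replace ((k + (m + 1) * d) * (1 + (M + 2) * i))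
      with (k + (m + 1) * d + M * i * k + 2 * (i * k) + (i * (m + 1)) * ((M + 2) * d)) by ring.
    rewrite Hi.
    assert (i * 1 <= i * (m + 1)) by (apply Rmult_le_compat_l; lra).
    assert (0 <= i * k) by nra. assert (M * (i * d) <= M * d).
    { apply Rmult_le_compat_l; [lra|]. rewrite Hi in *. nra. }
    nra. }
  assert (HN0 : 0 <= N 0%nat).
  { unfold N. simpl. pose proof (Rabs_pos (pfaff_coef 0)).
    pose proof (Rabs_pos (pfaff_diff 0)). lra. }
  assert (HN : forall n, N n <= N 0%nat * pfaff_majorant (M + 2) n).
  { induction n as [|n IH]; [simpl; lra|].
    eapply Rle_trans; [apply Hstep|]. simpl pfaff_majorant.
    rewrite <- Rmult_assoc. apply Rmult_le_compat_r; [|easy].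
    assert (0 <= (M + 2) / (INR n + 1)).
    { apply Rdiv_le_0_compat; [lra|]. generalize (pos_INR n); lra. } lra. }
  assert (E : CV_radius (fun n => (N 0%nat + 1) * pfaff_majorant (M + 2) n) = 1).
  { transitivity (CV_radius (PS_scal (N 0%nat + 1) (pfaff_majorant (M + 2)))); [easy|].
    rewrite CV_radius_scal by lra. apply pfaff_majorant_radius. lra. }
  rewrite <- E. apply CV_radius_dominated. intros n.
  assert (Hp := pfaff_majorant_pos (M + 2) n ltac:(lra)).
  rewrite (Rabs_pos_eq (_ * _)) by (apply Rmult_le_pos; lra).
  apply Rle_trans with (N n).
  - unfold N. assert (0 <= (INR n + 1) * Rabs (pfaff_diff n)).
    { apply Rmult_le_pos; [generalize (pos_INR n); lra|apply Rabs_pos]. } lra.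
  - eapply Rle_trans; [apply HN|]. apply Rmult_le_compat_r; lra.
Qed.

Lemma pfaff_recurrence n :
  (INR n + 2) * (INR n + 2 + al) * pfaff_coef (S (S n)) =
  (2 * (INR n + 1) * INR n - (be - 2 - al) * (INR n + 1) - mu) * pfaff_coef (S n)
  - (INR n * (INR n - 1) - (be - 1) * INR n) * pfaff_coef n.
Proof.
  assert (Hn := pos_INR n).
  rewrite (pfaff_coef_S (S n)), (pfaff_diff_S n).
  replace (pfaff_diff n) with (pfaff_coef (S n) - pfaff_coef n)
    by (rewrite pfaff_coef_S; ring).
  field. lra.
Qed.

Lemma pfaff_ode_coef n :
  ode_coef 0 1 (-2) 1 (al + 1) (be - 2 - al) (1 - be) mu pfaff_coef n = 0.
Proof.
  assert (R0 : (al + 1) * pfaff_coef 1 = - mu * pfaff_coef 0).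
  { unfold pfaff_coef. simpl. field. lra. }
  unfold ode_coef, PS_derive, PS_incr_1. change zero with 0.
  destruct n as [|[|[|n]]].
  - simpl INR. lra.
  - assert (R1 := pfaff_recurrence 0). simpl INR in *. lra.
  - assert (R1 := pfaff_recurrence 1). simpl INR in *. lra.
  - assert (R1 := pfaff_recurrence (S (S n))). rewrite !S_INR in *.
    transitivity ((INR n + 1 + 1 + 2) * (INR n + 1 + 1 + 2 + al) * pfaff_coef (S (S (S (S n)))) -
       ((2 * (INR n + 1 + 1 + 1) * (INR n + 1 + 1) - (be - 2 - al) * (INR n + 1 + 1 + 1) - mu) *
       pfaff_coef (S (S (S n))) -
       ((INR n + 1 + 1) * (INR n + 1 + 1 - 1) - (be - 1) * (INR n + 1 + 1)) *
       pfaff_coef (S (S n)))); [ring|]. rewrite R1. ring.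
Qed.

(** [x -> x/(x-1)] exchanges the singular points 1 and infinity of the Gauss
    equation and maps [(-oo, 1/2)] onto [(-1, 1)]; [pfaff1] and [pfaff2] are the
    first two derivatives of [pfaff]. *)
Definition pfaff (x : R) : R := PSeries pfaff_coef (x / (x - 1)).
Definition pfaff1 (x : R) : R :=
  - PSeries (PS_derive pfaff_coef) (x / (x - 1)) / (x - 1) ^ 2.
Definition pfaff2 (x : R) : R :=
  PSeries (PS_derive (PS_derive pfaff_coef)) (x / (x - 1)) / (x - 1) ^ 4
  + 2 * PSeries (PS_derive pfaff_coef) (x / (x - 1)) / (x - 1) ^ 3.

Lemma pfaff_hyper_ode x : x < 1 / 2 -> hyper_ode al be mu pfaff pfaff1 pfaff2 x.
Proof.
  intros Hx.
  set (z := x / (x - 1)).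
  assert (Hz : Rabs z < 1).
  { assert (z * (x - 1) = x) by (unfold z; field; lra). apply Rabs_def1; nra. }
  assert (HR : Rbar_lt (Rabs z) (CV_radius pfaff_coef))
    by (eapply Rbar_lt_le_trans; [|apply pfaff_radius]; exact Hz).
  assert (Dz : is_derive (fun x => x / (x - 1)) x (- / (x - 1) ^ 2)).
  { auto_derive; [lra|]. field. lra. }
  assert (G0 := is_derive_PSeries _ _ HR).
  assert (G1 := is_derive2_PSeries _ _ HR).
  assert (D0 := is_derive_comp (PSeries pfaff_coef) (fun x => x / (x - 1)) x _ _ G0 Dz).
  assert (D1 := is_derive_comp (PSeries (PS_derive pfaff_coef)) (fun x => x / (x - 1)) x _ _ G1 Dz).
  unfold scal in D0, D1; simpl in D0, D1; unfold mult in D0, D1; simpl in D0, D1.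
  split; [|split].
  - unfold pfaff, pfaff1. fold z. evar_last; [exact D0|]. field. lra.
  - unfold pfaff1, pfaff2. fold z.
    apply (is_derive_ext (fun u => (- / (u - 1) ^ 2) * PSeries (PS_derive pfaff_coef) (u / (u - 1)))).
    { intros t. unfold Rdiv. real_eq. ring. }
    assert (Dq : is_derive (fun u => - / (u - 1) ^ 2) x (2 / (x - 1) ^ 3)).
    { auto_derive; [apply (pow_nonzero (x - 1) 2); lra|]. field. lra. }
    assert (DM := is_derive_mult _ _ x _ _ Dq D1 Rmult_comm).
    evar_last; [exact DM|]. unfold plus, mult; simpl. fold z. real_eq. field. lra.
  - assert (E := PSeries_solves_ode 0 1 (-2) 1 (al + 1) (be - 2 - al) (1 - be) mu
                   pfaff_coef z pfaff_ode_coef HR).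
    unfold pfaff, pfaff1, pfaff2. fold z.
    set (K0 := PSeries pfaff_coef z) in *.
    set (K1 := PSeries (PS_derive pfaff_coef) z) in *.
    set (K2 := PSeries (PS_derive (PS_derive pfaff_coef)) z) in *.
    rewrite <- Ropp_0, <- E. unfold z. field. lra.
Qed.

Lemma cosh_sqr s : cosh s ^ 2 = 1 + sinh s ^ 2.
Proof.
  unfold cosh, sinh. assert (exp s * exp (- s) = 1)
    by (rewrite <- exp_plus, Rplus_opp_r; apply exp_0). nra.
Qed.

Lemma sinh_pos s : 0 < s -> 0 < sinh s.
Proof. intros Hs. rewrite <- sinh_0. now apply sinh_lt. Qed.

Lemma sinh_nonneg s : 0 <= s -> 0 <= sinh s.
Proof.
  intros Hs. destruct (Req_dec s 0) as [->|]; [rewrite sinh_0; lra|].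
  left. apply sinh_pos. lra.
Qed.

Lemma sinh_le s t : s <= t -> sinh s <= sinh t.
Proof. intros [H| ->]; [left; now apply sinh_lt|lra]. Qed.

(** In the variable [t] with [x = - sinh^2 t] the Gauss equation on [x <= 0] becomes
    that of a damped oscillator; [radial1] and [radial2] are the derivatives. *)
Definition radial (y : R -> R) (t : R) : R := y (- sinh t ^ 2).
Definition radial1 (y1 : R -> R) (t : R) : R :=
  - (2 * sinh t * cosh t) * y1 (- sinh t ^ 2).
Definition radial2 (y y1 : R -> R) (t : R) : R :=
  2 * (2 * al + 1 + 2 * (al + be + 1) * sinh t ^ 2) * y1 (- sinh t ^ 2)
  - 4 * mu * y (- sinh t ^ 2).

Lemma radial_derive (y y1 y2 : R -> R) (t : R) :
  hyper_ode al be mu y y1 y2 (- sinh t ^ 2) ->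
  is_derive (radial y) t (radial1 y1 t) /\
  is_derive (radial1 y1) t (radial2 y y1 t).
Proof.
  intros [G1 [G2 G3]]. unfold radial, radial1, radial2.
  simpl in G1, G2.
  split.
  - auto_derive; [repeat split; eexists; exact G1|].
    rewrite_derive G1. simpl. ring.
  - auto_derive; [repeat split; eexists; exact G2|].
    rewrite_derive G2. simpl.
    replace (- (sinh t * (sinh t * 1))) with (- sinh t ^ 2) by ring.
    assert (Hcs := cosh_sqr t).
    set (X := - sinh t ^ 2) in *. set (S := sinh t) in *. set (C := cosh t) in *.
    assert (HCS : C * C = 1 + S * S) by nra.
    assert (HX : X = - (S * S)) by (unfold X; ring).
    set (w0 := y X) in *. set (w1 := y1 X) in *. set (w2 := y2 X) in *.
    assert (HW : S * S * (C * C) * w2 = (al + 1 + (al + be + 2) * (S * S)) * w1 - mu * w0).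
    { rewrite HCS. clearbody w0 w1 w2. rewrite HX in G3. lra. }
    transitivity (-2 * (C * C + S * S) * w1 + 4 * (S * S * (C * C) * w2)); [ring|].
    rewrite HW, HCS. ring.
Qed.

(** In the variable [t] the equation reads [phi'' + 2 h phi' + 4 mu phi = 0]
    with [h >= 0], so the energy [phi'^2 + 4 mu phi^2] decreases; a solution that is
    regular at 0 and vanishes there vanishes identically. *)
Lemma hyper_ode_unique (y y1 y2 : R -> R) (T t : R) :
  (forall x, - T < x <= 0 -> hyper_ode al be mu y y1 y2 x) ->
  y 0 = 0 -> 0 <= t -> sinh t ^ 2 < T -> y (- sinh t ^ 2) = 0.
Proof.
  intros Hode Hy0 Ht HtT.
  set (E := fun s => radial1 y1 s ^ 2 + 4 * mu * radial y s ^ 2).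
  set (E' := fun s => 2 * radial1 y1 s * radial2 y y1 s
                      + 8 * mu * radial y s * radial1 y1 s).
  assert (Hrange : forall s, 0 <= s <= t -> - T < - sinh s ^ 2 <= 0).
  { intros s Hs. assert (0 <= sinh s) by (apply sinh_nonneg; lra).
    assert (sinh s <= sinh t) by (apply sinh_le; lra).
    split; nra. }
  assert (HE : E t <= E 0).
  { apply (derive_nonpos_decreasing E E' 0 t Ht).
    - intros s Hs. destruct (radial_derive y y1 y2 s (Hode _ (Hrange s Hs))) as [C0 C1].
      unfold E, E'. auto_derive.
      + repeat split; eexists; eassumption.
      + rewrite_derive C0. rewrite_derive C1. ring.
    - intros s Hs. unfold E', radial, radial1, radial2.
      set (w0 := y (- sinh s ^ 2)). set (w1 := y1 (- sinh s ^ 2)).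
      assert (0 <= sinh s * cosh s).
      { apply Rmult_le_pos; [apply sinh_nonneg; lra|].
        unfold cosh. pose proof (exp_pos s); pose proof (exp_pos (- s)). lra. }
      assert (0 <= sinh s ^ 2) by apply pow2_ge_0.
      assert (0 <= w1 ^ 2) by apply pow2_ge_0.
      assert (0 <= 2 * al + 1 + 2 * (al + be + 1) * sinh s ^ 2) by nra.
      replace (2 * (- (2 * sinh s * cosh s) * w1) *
        (2 * (2 * al + 1 + 2 * (al + be + 1) * sinh s ^ 2) * w1 - 4 * mu * w0) +
        8 * mu * w0 * (- (2 * sinh s * cosh s) * w1))
      with (- (8 * ((sinh s * cosh s) * w1 ^ 2
                    * (2 * al + 1 + 2 * (al + be + 1) * sinh s ^ 2)))) by ring.
      assert (0 <= (sinh s * cosh s) * w1 ^ 2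
                    * (2 * al + 1 + 2 * (al + be + 1) * sinh s ^ 2))
        by (apply Rmult_le_pos; [apply Rmult_le_pos|]; easy).
      lra. }
  assert (E0 : E 0 = 0).
  { unfold E, radial, radial1. rewrite sinh_0. replace (- 0 ^ 2) with 0 by ring.
    rewrite Hy0. ring. }
  assert (0 <= radial1 y1 t ^ 2) by apply pow2_ge_0.
  unfold E in *. change (radial y t = 0).
  assert (radial y t ^ 2 <= 0) by (apply (Rmult_le_reg_l (4 * mu)); lra).
  nra.
Qed.
End HyperSeries.

Lemma CV_radius_ge_of_convergence (u : nat -> R) (h : R) :
  ex_pseries u h -> Rbar_le (Rabs h) (CV_radius u).
Proof.
  intros [l Hl].
  assert (L : is_lim_seq (fun n => scal (pow_n h n) (u n)) 0)
    by (apply ex_series_lim_0; now exists l).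
  destruct (filterlim_bounded (K := R_AbsRing) (V := R_NormedModule)
              (fun n => scal (pow_n h n) (u n))) as [M HM].
  { exists 0. exact L. }
  apply (proj1 (CV_radius_bounded u)). exists M. intros n.
  specialize (HM n). unfold norm, scal in HM; simpl in HM.
  unfold mult, abs in HM; simpl in HM. rewrite pow_n_pow in HM.
  rewrite Rmult_comm, RPow_abs, Rabs_mult, Rabs_Rabsolu.
  now rewrite Rabs_mult in HM.
Qed.

(** One-sided vanishing is all that is known at the edge of the region where two
    continuations agree; continuity of the sum at 0 then kills the constant term. *)
Lemma pseries_zero_right_coef0 (u : nat -> R) (r : R) :
  0 < r -> (forall h, 0 < h < r -> is_pseries u h 0) -> u 0%nat = 0.
Proof.
  intros Hr Hu.
  assert (HR : Rbar_lt (Rabs 0) (CV_radius u)).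
  { rewrite Rabs_R0. eapply Rbar_lt_le_trans with (Rabs (r / 2)).
    - simpl. rewrite Rabs_pos_eq; lra.
    - apply CV_radius_ge_of_convergence. exists 0. apply Hu. lra. }
  assert (Hc := PSeries_continuity u 0 HR).
  apply continuity_pt_filterlim in Hc.
  rewrite PSeries_0 in Hc.
  apply (filterlim_locally_unique (K := R_AbsRing) (V := R_NormedModule)
           (F := at_right 0) (PSeries u)).
  - eapply filterlim_filter_le_1; [|exact Hc]. intros P HP. now apply filter_le_within.
  - apply (filterlim_ext_loc (fun _ => 0)); [|apply filterlim_const].
    exists (mkposreal r Hr). intros h Hh Hp. symmetry. apply is_pseries_unique, Hu.
    split; [easy|]. unfold ball in Hh; simpl in Hh. unfold AbsRing_ball, abs, minus, plus, opp in Hh.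
    simpl in Hh. apply Rabs_def2 in Hh. lra.
Qed.

Lemma pseries_zero_right (u : nat -> R) (r : R) :
  0 < r -> (forall h, 0 < h < r -> is_pseries u h 0) -> forall n, u n = 0.
Proof.
  intros Hr Hu n. revert u Hu. induction n as [|n IH]; intros u Hu.
  - now apply pseries_zero_right_coef0 with r.
  - apply (IH (PS_decr_1 u)). intros h Hh.
    assert (G := is_pseries_decr_1 u h (/ h) 0).
    rewrite (pseries_zero_right_coef0 u r Hr Hu) in G.
    assert (G' : is_pseries (PS_decr_1 u) h (/ h * (0 + - 0))).
    { apply G; [|now apply Hu]. unfold mult, one; simpl. field. lra. }
    replace (/ h * (0 + - 0)) with 0 in G' by ring. exact G'.
Qed.

Lemma analyticR_minus (f g : R -> R) (x0 : R) :
  analyticR f x0 -> analyticR g x0 -> analyticR (fun x => f x - g x) x0.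
Proof.
  intros [u [r [Hr Hu]]] [v [s [Hs Hv]]].
  exists (fun n => u n - v n), (Rmin r s). split; [now apply Rmin_pos|].
  intros x Hx. pose proof (Rmin_l r s). pose proof (Rmin_r r s).
  apply (is_pseries_minus u v); [apply Hu|apply Hv]; lra.
Qed.

(** Identity theorem.  If [T] is the largest number such that the difference
    vanishes on [(-T, 0]], then the power series at [-T] vanishes on the right of its
    centre, hence everywhere, and the difference vanishes beyond [-T] as well. *)
Lemma analytic_zero_left (D : R -> R) :
  (forall x, x <= 0 -> analyticR D x) ->
  (forall x, -1 < x <= 0 -> D x = 0) -> forall x, x <= 0 -> D x = 0.
Proof.
  intros Han H1 x Hx. apply NNPP. intros Hne.
  set (E := fun s => forall u, - s < u <= 0 -> D u = 0).
  destruct (completeness E) as [T [HT1 HT2]].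
  { exists (- x). intros s Hs. apply Rnot_lt_le. intros Hlt. apply Hne, Hs. lra. }
  { now exists 1. }
  assert (T1 : 1 <= T) by now apply HT1.
  assert (HT : forall u, - T < u <= 0 -> D u = 0).
  { intros u Hu. apply NNPP. intros Hn.
    assert (is_upper_bound E (- u)).
    { intros s Hs. apply Rnot_lt_le. intros Hlt. apply Hn, Hs. lra. }
    specialize (HT2 _ H). lra. }
  destruct (Han (- T) ltac:(lra)) as [u [r [Hr Hu]]].
  assert (Hz : forall n, u n = 0).
  { apply (pseries_zero_right u (Rmin r T)); [apply Rmin_pos; lra|].
    intros h Hh. pose proof (Rmin_l r T). pose proof (Rmin_r r T).
    specialize (Hu (- T + h)). replace (- T + h - - T) with h in Hu by ring.
    rewrite HT in Hu by lra. apply Hu. rewrite Rabs_pos_eq; lra. }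
  assert (T + r <= T); [|lra].
  apply HT1. intros v Hv. destruct (Rlt_dec (- T) v) as [HTv|HTv]; [apply HT; lra|].
  assert (Hv' : is_pseries u (v - - T) (D v)) by (apply Hu; apply Rabs_def1; lra).
  apply is_pseries_unique in Hv'. rewrite <- Hv'.
  rewrite (PSeries_ext u (fun _ => 0)) by easy. apply PSeries_const_0.
Qed.

(** A function equal near [x] to a solution is itself a solution, with its own
    derivatives: this is how solutions given piecewise are glued. *)
Lemma hyper_ode_transfer (al be mu : R) (f y y1 y2 : R -> R) (x : R) :
  locally x (fun u => y u = f u /\ hyper_ode al be mu y y1 y2 u) ->
  hyper_ode al be mu f (Derive f) (Derive (Derive f)) x.
Proof.
  intros HL.
  assert (D1 : locally x (fun u => is_derive f u (y1 u))).
  { apply locally_locally in HL. revert HL. apply filter_imp. intros u Hu.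
    apply (is_derive_ext_loc y).
    - revert Hu. apply filter_imp. now intros v [Hv _].
    - now destruct (locally_singleton _ _ Hu) as [_ [H _]]. }
  assert (E1 : locally x (fun u => y1 u = Derive f u)).
  { revert D1. apply filter_imp. intros u Hu. symmetry. now apply is_derive_unique. }
  destruct (locally_singleton _ _ HL) as [Hy [H1 [H2 H3]]].
  assert (D2 : is_derive (Derive f) x (y2 x)) by now apply (is_derive_ext_loc y1).
  assert (F1 := locally_singleton _ _ D1).
  split; [|split].
  - now rewrite (is_derive_unique _ _ _ F1).
  - now rewrite (is_derive_unique _ _ _ D2).
  - rewrite (is_derive_unique _ _ _ D2), (is_derive_unique _ _ _ F1), <- Hy. exact H3.
Qed.

Section Continuation.
Variables al be mu : R.
Hypothesis Hal : -1/2 < al.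
Hypothesis Hbe : -1/2 <= be.
Hypothesis Hab : be <= al.
Hypothesis Hmu : 0 < mu.

(** Both sides solve the Gauss equation near 0, are regular there and agree at 0. *)
Lemma pfaff_eq_hyper_series x : -1 < x <= 0 ->
  pfaff al be mu x = PSeries (hyper_coef al be mu) x.
Proof.
  intros Hx.
  set (t := arcsinh (sqrt (- x))).
  assert (Ht : 0 <= t).
  { unfold t. rewrite <- arcsinh_0. apply arcsinh_le, sqrt_pos. }
  assert (Hxt : sinh t ^ 2 = - x).
  { unfold t. rewrite sinh_arcsinh, <- Rsqr_pow2. apply Rsqr_sqrt. lra. }
  set (y := fun x => pfaff al be mu x - PSeries (hyper_coef al be mu) x).
  assert (Hy : y (- sinh t ^ 2) = 0).
  { apply (hyper_ode_unique al be mu Hal Hbe Hab Hmu y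
      (fun x => pfaff1 al be mu x - PSeries (PS_derive (hyper_coef al be mu)) x)
      (fun x => pfaff2 al be mu x
                - PSeries (PS_derive (PS_derive (hyper_coef al be mu))) x) 1); auto.
    - intros u Hu.
      destruct (pfaff_hyper_ode al be mu Hal Hbe Hab Hmu u ltac:(lra)) as [A1 [A2 A3]].
      destruct (hyper_series_ode al be mu Hal Hbe Hab Hmu u) as [B1 [B2 B3]].
      { apply Rabs_def1; lra. }
      split; [|split].
      + exact (is_derive_minus _ _ _ _ _ A1 B1).
      + exact (is_derive_minus _ _ _ _ _ A2 B2).
      + unfold y. lra.
    - unfold y, pfaff. replace (0 / (0 - 1)) with 0 by field. rewrite !PSeries_0.
      unfold pfaff_coef. simpl. ring.
    - lra. }
  rewrite Hxt, Ropp_involutive in Hy. unfold y in Hy. lra.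
Qed.

(** The function [2F1(a,b;c;x)] for [x < 1]. *)
Definition hyper (x : R) : R :=
  if Rlt_dec x 0 then pfaff al be mu x else PSeries (hyper_coef al be mu) x.

Lemma hyper_series x : Rabs x < 1 -> hyper x = PSeries (hyper_coef al be mu) x.
Proof.
  intros Hx. apply Rabs_def2 in Hx. unfold hyper. destruct (Rlt_dec x 0); [|easy].
  apply pfaff_eq_hyper_series. lra.
Qed.

Lemma hyper_solution x : x < 1 ->
  hyper_ode al be mu hyper (Derive hyper) (Derive (Derive hyper)) x.
Proof.
  intros Hx. destruct (Rlt_dec x 0) as [Hn|Hp].
  - apply (hyper_ode_transfer al be mu _ (pfaff al be mu) (pfaff1 al be mu) (pfaff2 al be mu)).
    apply (locally_interval _ x m_infty 0); [easy|exact Hn|]. intros u _ Hu. simpl in Hu.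
    split.
    + unfold hyper. destruct (Rlt_dec u 0); easy.
    + apply pfaff_hyper_ode; auto. lra.
  - eapply (hyper_ode_transfer al be mu _ (PSeries (hyper_coef al be mu))).
    apply (locally_interval _ x (-1) 1); [simpl; lra|exact Hx|]. simpl. intros u Hu1 Hu2.
    assert (Rabs u < 1) by (apply Rabs_def1; lra).
    split; [now rewrite hyper_series|]. now apply hyper_series_ode.
Qed.

(** Points other than 0 are regular for the Gauss equation; at 0 the Gauss series
    itself is the expansion. *)
Lemma hyper_analytic x0 : x0 < 1 -> analyticR hyper x0.
Proof.
  intros Hx. destruct (Req_dec x0 0) as [->|Hx0].
  - exists (hyper_coef al be mu), 1. split; [lra|]. intros x H1.
    rewrite Rminus_0_r in *. rewrite hyper_series by easy.
    apply PSeries_correct, CV_radius_inside. now rewrite hyper_coef_radius.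
  - apply (regular_solution_analytic (x0 * (1 - x0)) (1 - 2 * x0) (-1)
      (al + 1 - (al + be + 2) * x0) (- (al + be + 2)) (- mu)
      ltac:(apply Rmult_integral_contrapositive_currified; lra)
      hyper (Derive hyper) (Derive (Derive hyper)) x0 (1 - x0)); [lra| | |];
    intros x Hd; apply Rabs_def2 in Hd;
    destruct (hyper_solution x ltac:(lra)) as [A1 [A2 A3]]; auto.
    rewrite <- A3. ring.
Qed.

End Continuation.

(** * The complex Gauss function *)

Lemma is_pseries_C_iff (u : nat -> C) (x : R) (l : C) :
  is_pseries_C u x l <->
  is_pseries (fun n => Re (u n)) x (Re l) /\ is_pseries (fun n => Im (u n)) x (Im l).
Proof.
  unfold is_pseries_C, is_pseries, is_series.
  assert (E1 : forall n, fst (sum_n (fun k => @scal R_AbsRing C_R_NormedModule (pow_n x k) (u k)) n)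
      = sum_n (fun k => scal (pow_n x k) (Re (u k))) n).
  { induction n as [|n IH]; [now rewrite !sum_O|]. rewrite !sum_Sn, <- IH. easy. }
  assert (E2 : forall n, snd (sum_n (fun k => @scal R_AbsRing C_R_NormedModule (pow_n x k) (u k)) n)
      = sum_n (fun k => scal (pow_n x k) (Im (u k))) n).
  { induction n as [|n IH]; [now rewrite !sum_O|]. rewrite !sum_Sn, <- IH. easy. }
  split.
  - intros H. split.
    + apply (filterlim_ext _ _ E1).
      apply (filterlim_comp _ _ _ _ _ _ _ _ H). 
      intros P [e He]. exists e. intros z [Hz _]. now apply He.
    + apply (filterlim_ext _ _ E2).
      apply (filterlim_comp _ _ _ _ _ _ _ _ H). 
      intros P [e He]. exists e. intros z [_ Hz]. now apply He.
  - intros [H1 H2] P [e He].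
    assert (B1 := H1 (fun z => ball (Re l) e z) (ex_intro _ e (fun z Hz => Hz))).
    assert (B2 := H2 (fun z => ball (Im l) e z) (ex_intro _ e (fun z Hz => Hz))).
    unfold filtermap in *. generalize (filter_and _ _ B1 B2). apply filter_imp.
    intros n [N1 N2]. apply He. split; [now rewrite E1|now rewrite E2].
Qed.

Lemma RtoC_neq (x y : R) : x <> y -> RtoC x <> RtoC y.
Proof. intros H E. now apply H, RtoC_inj. Qed.

Section ComplexGauss.
Variables al be lam : R.
Hypothesis Hal : -1/2 < al.
Hypothesis Hbe : -1/2 <= be.
Hypothesis Hab : be <= al.
Let mu := ((al + be + 1) ^ 2 + lam ^ 2) / 4.
Let a : C := ((RtoC (rho al be) + Ci * RtoC lam) / RtoC 2)%C.
Let b : C := ((RtoC (rho al be) - Ci * RtoC lam) / RtoC 2)%C.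
Let c : C := RtoC (al + 1).

Lemma gauss_coef_real n : gauss_coef a b c n = RtoC (hyper_coef al be mu n).
Proof.
  assert (H2 : RtoC 2 <> 0) by (apply RtoC_neq; lra).
  assert (Hpc : forall n, exists w, w <> 0 /\ pochhammer c n = RtoC w).
  { intros k. induction k as [|m [w [Hw E]]]; [exists 1; split; [lra|easy]|].
    exists (w * (al + 1 + INR m)). split.
    - apply Rmult_integral_contrapositive_currified; [easy|]. generalize (pos_INR m). lra.
    - simpl. rewrite E. unfold c. now rewrite <- RtoC_plus, <- RtoC_mult. }
  assert (Hfac : forall n, RtoC (INR (fact n)) <> 0)
    by (intros m; apply RtoC_neq; apply INR_fact_neq_0).
  induction n as [|n IH].
  - unfold gauss_coef. simpl. field.
  - assert (Hn := pos_INR n).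
    change (hyper_coef al be mu (S n)) with (hyper_coef al be mu n
      * ((INR n ^ 2 + (al + be + 1) * INR n + mu) * / ((al + 1 + INR n) * (INR n + 1)))).
    rewrite RtoC_mult, <- IH. unfold gauss_coef.
    change (fact (S n)) with (S n * fact n)%nat.
    rewrite mult_INR, S_INR, (RtoC_mult (INR n + 1)).
    rewrite (RtoC_mult _ (/ _)), RtoC_inv, (RtoC_mult (al + 1 + INR n)).
    2:{ apply Rmult_integral_contrapositive_currified; lra. }
    change (pochhammer a (S n)) with (pochhammer a n * (a + INR n))%C.
    change (pochhammer b (S n)) with (pochhammer b n * (b + INR n))%C.
    change (pochhammer c (S n)) with (pochhammer c n * (c + INR n))%C.
    assert (E : ((a + INR n) * (b + INR n))%C =
                RtoC (INR n ^ 2 + (al + be + 1) * INR n + mu)).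
    { unfold a, b, mu, rho. apply injective_projections; simpl; field. }
    rewrite <- E.
    destruct (Hpc n) as [w [Hw Ew]]. rewrite Ew.
    assert (Hc1 : (c + INR n)%C = RtoC (al + 1 + INR n)) by (unfold c; now rewrite <- RtoC_plus).
    rewrite Hc1.
    assert (RtoC w <> 0) by now apply RtoC_neq.
    assert (RtoC (al + 1 + INR n) <> 0) by (apply RtoC_neq; lra).
    assert (RtoC (INR n + 1) <> 0) by (apply RtoC_neq; lra).
    specialize (Hfac n).
    field. repeat split; easy.
Qed.

Lemma mu_pos : 0 < mu.
Proof. unfold mu. nra. Qed.

Lemma hyper_is_gauss_2F1 : is_gauss_2F1 a b c (fun x => RtoC (hyper al be mu x)).
Proof.
  assert (Hmu := mu_pos).
  assert (Z : forall x : R, is_pseries (fun _ : nat => 0) x 0).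
  { intros x. assert (P : is_pseries (fun _ : nat => 0) x (PSeries (fun _ : nat => 0) x)).
    { apply PSeries_correct, CV_radius_inside. now rewrite CV_radius_const_0. }
    now rewrite PSeries_const_0 in P. }
  split.
  - intros x Hx. apply is_pseries_C_iff.
    change (Re (RtoC (hyper al be mu x))) with (hyper al be mu x).
    change (Im (RtoC (hyper al be mu x))) with 0. split.
    + rewrite hyper_series by easy.
      apply is_pseries_ext with (hyper_coef al be mu).
      * intros n. now rewrite gauss_coef_real.
      * apply PSeries_correct, CV_radius_inside. now rewrite hyper_coef_radius.
    + apply is_pseries_ext with (fun _ => 0); [|apply Z].
      intros n. now rewrite gauss_coef_real.
  - intros x Hx.
    destruct (hyper_analytic al be mu Hal Hbe Hab Hmu x Hx) as [u [r [Hr Hu]]].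
    exists (fun n => RtoC (u n)), r. split; [easy|]. intros v Hv.
    apply is_pseries_C_iff. split; simpl; [now apply Hu|apply Z].
Qed.

(** Whatever continuation the choice operator selects, the identity theorem makes
    it agree with [hyper]. *)
Lemma gauss_2F1_real x : x <= 0 -> Re (gauss_2F1 a b c x) = hyper al be mu x.
Proof.
  assert (Hmu := mu_pos).
  assert (HG : is_gauss_2F1 a b c (gauss_2F1 a b c)).
  { unfold gauss_2F1. apply epsilon_spec. eexists. apply hyper_is_gauss_2F1. }
  destruct HG as [G1 G2].
  intros Hx. apply Rminus_diag_uniq.
  apply (analytic_zero_left (fun x => Re (gauss_2F1 a b c x) - hyper al be mu x)); auto.
  - intros u Hu. apply analyticR_minus.
    + destruct (G2 u ltac:(lra)) as [v [r [Hr Hv]]].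
      exists (fun n => Re (v n)), r. split; [easy|]. intros w Hw.
      exact (proj1 (proj1 (is_pseries_C_iff v _ _) (Hv w Hw))).
    + apply hyper_analytic; auto. lra.
  - intros u Hu. assert (Hu1 : Rabs u < 1) by (apply Rabs_def1; lra).
    rewrite hyper_series by easy.
    destruct (proj1 (is_pseries_C_iff _ _ _) (G1 u Hu1)) as [P _].
    apply is_pseries_unique in P. rewrite <- P.
    rewrite (PSeries_ext _ (hyper_coef al be mu)); [ring|].
    intros n. now rewrite gauss_coef_real.
Qed.

Lemma jacobi_radial t : jacobi al be lam t = radial (hyper al be mu) t.
Proof.
  unfold jacobi. fold a b c. unfold radial. apply gauss_2F1_real.
  generalize (pow2_ge_0 (sinh t)). lra.
Qed.

End ComplexGauss.

(** * Bounds for Jacobi functions *)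

Lemma cosh_gt_sinh t : sinh t < cosh t.
Proof. unfold sinh, cosh. pose proof (exp_pos (- t)). lra. Qed.

Lemma cosh_ge_1 t : 1 <= cosh t.
Proof.
  assert (H := cosh_sqr t). pose proof (pow2_ge_0 (sinh t)).
  assert (0 < cosh t) by (unfold cosh; pose proof (exp_pos t); pose proof (exp_pos (- t)); lra).
  nra.
Qed.

Lemma sinh_ge_id t : 0 <= t -> t <= sinh t.
Proof.
  intros Ht.
  enough (sinh 0 - 0 <= sinh t - t) by (rewrite sinh_0 in *; lra).
  apply (derive_nonneg_increasing (fun x => sinh x - x) (fun x => cosh x - 1) 0 t Ht).
  - intros x Hx. auto_derive; [easy|ring].
  - intros x Hx. pose proof (cosh_ge_1 x). lra.
Qed.

Lemma is_derive_continuous_eps (f : R -> R) (x l eps : R) :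
  is_derive f x l -> 0 < eps ->
  exists d, 0 < d /\ forall y, Rabs (y - x) < d -> Rabs (f y - f x) < eps.
Proof.
  intros H He. apply is_derive_continuous in H.
  destruct (proj1 (filterlim_locally f (f x)) H (mkposreal eps He)) as [d Hd].
  exists d. split; [apply cond_pos|]. intros y Hy. now apply Hd.
Qed.

Section JacobiBounds.
Variables al be : R.
Hypothesis Hal : -1/2 < al.
Hypothesis Hbe : -1/2 <= be.
Hypothesis Hab : be <= al.
Let r := al + be + 1.

Lemma r_pos : 0 < r.
Proof. unfold r. lra. Qed.

(** Half the logarithmic derivative of the weight [m]. *)
Definition log_slope (t : R) : R :=
  (al + 1/2) * (cosh t / sinh t) + (be + 1/2) * (sinh t / cosh t).

(** The difference is a multiple of
    [(cosh t - sinh t) ((al + 1/2) cosh t - (be + 1/2) sinh t)]; this is where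
    [be <= al] enters. *)
Lemma log_slope_ge t : 0 < t -> r <= log_slope t.
Proof.
  intros Ht. assert (HS := sinh_pos t Ht). assert (HC := cosh_ge_1 t).
  assert (HSC := cosh_gt_sinh t).
  unfold log_slope, r.
  assert (E : (al + 1/2) * (cosh t / sinh t) + (be + 1/2) * (sinh t / cosh t) - (al + be + 1)
     = (cosh t - sinh t) * ((al + 1/2) * cosh t - (be + 1/2) * sinh t) / (sinh t * cosh t))
    by (field; lra).
  enough (0 <= (cosh t - sinh t) * ((al + 1/2) * cosh t - (be + 1/2) * sinh t) / (sinh t * cosh t))
    by lra.
  apply Rdiv_le_0_compat; [|nra].
  apply Rmult_le_pos; [lra|]. nra.
Qed.

Lemma jacobi_ode lam : exists p1 p2 : R -> R,
  (forall t, is_derive (jacobi al be lam) t (p1 t)) /\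
  (forall t, is_derive p1 t (p2 t)) /\
  (forall t, 0 < t ->
     p2 t = - 2 * log_slope t * p1 t - (r ^ 2 + lam ^ 2) * jacobi al be lam t) /\
  jacobi al be lam 0 = 1 /\ p1 0 = 0.
Proof.
  set (mu := ((al + be + 1) ^ 2 + lam ^ 2) / 4).
  assert (Hmu : 0 < mu) by (unfold mu; nra).
  set (y := hyper al be mu).
  assert (Hj : forall t, radial y t = jacobi al be lam t).
  { intros t. symmetry. now apply jacobi_radial. }
  assert (Hx : forall t, hyper_ode al be mu y (Derive y) (Derive (Derive y)) (- sinh t ^ 2)).
  { intros t. apply hyper_solution; auto. generalize (pow2_ge_0 (sinh t)). lra. }
  exists (radial1 (Derive y)), (radial2 al be mu y (Derive y)).
  split; [|split; [|split; [|split]]].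
  - intros t. apply (is_derive_ext (radial y)); [apply Hj|].
    now apply (radial_derive al be mu _ _ _ _ (Hx t)).
  - intros t. now apply (radial_derive al be mu _ _ _ _ (Hx t)).
  - intros t Ht. rewrite <- Hj. unfold radial, radial1, radial2, log_slope, r.
    assert (HS := sinh_pos t Ht). assert (HC := cosh_ge_1 t).
    set (w1 := Derive y (- sinh t ^ 2)). set (w0 := y (- sinh t ^ 2)).
    transitivity (2 * ((2 * al + 1) * cosh t ^ 2 + (2 * be + 1) * sinh t ^ 2) * w1 - 4 * mu * w0).
    + rewrite cosh_sqr. ring.
    + unfold mu. field. lra.
  - rewrite <- Hj. unfold radial. rewrite sinh_0. replace (- 0 ^ 2) with 0 by ring.
    unfold y. rewrite hyper_series; auto.
    + now rewrite PSeries_0.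
    + rewrite Rabs_R0. lra.
  - unfold radial1. rewrite sinh_0. ring.
Qed.

(** The weight [m] without its exponential growth; it increases because
    [log_slope t >= r]. *)
Definition tame_weight (t : R) : R :=
  Rpower (sinh t) (2 * al + 1) * Rpower (cosh t) (2 * be + 1) * exp (- 2 * r * t).

Lemma tame_weight_pos t : 0 < tame_weight t.
Proof. unfold tame_weight, Rpower. repeat apply Rmult_lt_0_compat; apply exp_pos. Qed.

Lemma tame_weight_derive t : 0 < t ->
  is_derive tame_weight t (2 * (log_slope t - r) * tame_weight t).
Proof.
  intros Ht. assert (HS := sinh_pos t Ht). assert (HC := cosh_ge_1 t).
  unfold tame_weight, Rpower. auto_derive.
  - repeat split; lra.
  - unfold log_slope. field. lra.
Qed.

Lemma tame_weight_le s t : 0 < s <= t -> tame_weight s <= tame_weight t.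
Proof.
  intros Hst.
  apply (derive_nonneg_increasing _ (fun t => 2 * (log_slope t - r) * tame_weight t)); [lra| |].
  - intros x Hx. apply tame_weight_derive. lra.
  - intros x Hx. pose proof (tame_weight_pos x). pose proof (log_slope_ge x ltac:(lra)).
    apply Rmult_le_pos; lra.
Qed.

(** In this section [g] stands for [exp(r t) phi_0(t)]. *)
Section GroundState.
Variables g g1 g2 : R -> R.
Hypothesis Hg : forall t, is_derive g t (g1 t).
Hypothesis Hg1 : forall t, is_derive g1 t (g2 t).
Hypothesis Hode : forall t, 0 < t -> g2 t = 2 * (log_slope t - r) * (r * g t - g1 t).
Hypothesis Hg0 : g 0 = 1.
Hypothesis Hg10 : g1 0 = r.

(** [(G (g' - r m))' = r G' (g - m) >= 0], where [G] is the tame weight, and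
    [g'(0) >= r m]: this is how a lower bound for [g] yields one for [g']. *)
Lemma slope_ge_of_value_ge m T : m <= 1 ->
  (forall t, 0 < t < T -> m <= g t) -> forall t, 0 < t < T -> r * m <= g1 t.
Proof.
  intros Hm HT t Ht. apply Rnot_lt_le. intros Hlt.
  assert (Hr := r_pos).
  destruct (is_derive_continuous_eps g1 0 _ (r * m - g1 t) (Hg1 0) ltac:(lra)) as [d [Hd Hcont]].
  set (s := Rmin (d / 2) t).
  assert (Hs : 0 < s <= t /\ s < d).
  { unfold s. pose proof (Rmin_l (d / 2) t). pose proof (Rmin_r (d / 2) t).
    assert (0 < Rmin (d / 2) t) by (apply Rmin_pos; lra). lra. }
  assert (HV : tame_weight s * (g1 s - r * m) <= tame_weight t * (g1 t - r * m)).
  { apply (derive_nonneg_increasing (fun x => tame_weight x * (g1 x - r * m))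
       (fun x => 2 * (log_slope x - r) * tame_weight x * (r * (g x - m)))); [lra| |].
    - intros x Hx. assert (D := tame_weight_derive x ltac:(lra)). assert (D1 := Hg1 x).
      auto_derive; [repeat split; eexists; eassumption|].
      rewrite_derive D. rewrite_derive D1. rewrite Hode by lra. ring.
    - intros x Hx. pose proof (tame_weight_pos x). pose proof (log_slope_ge x ltac:(lra)).
      pose proof (HT x ltac:(lra)).
      apply Rmult_le_pos; [apply Rmult_le_pos; lra|]. apply Rmult_le_pos; lra. }
  assert (HGs := tame_weight_pos s). assert (HGt := tame_weight_le s t ltac:(lra)).
  (* The tame weight is smaller at s than at t, so the negative value at t
     propagates to s, against the continuity of g' at 0. *)
  assert (Hs1 : g1 s - r * m <= g1 t - r * m).
  { apply Rnot_lt_le. intros Hc. nra. }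
  specialize (Hcont s). rewrite Rminus_0_r, Hg10 in Hcont.
  assert (Habs : Rabs (g1 s - r) < r * m - g1 t) by (apply Hcont; rewrite Rabs_pos_eq; lra).
  apply Rabs_def2 in Habs. nra.
Qed.

(** Up to a first zero [T] of [g] the previous lemma with [m = 0] gives [g' >= 0],
    hence [g(T) >= g(0) = 1]. *)
Lemma ground_positive t : 0 <= t -> 0 < g t.
Proof.
  intros Ht. apply Rnot_le_lt. intros Hle.
  set (E := fun s => 0 <= s /\ forall u, 0 <= u <= s -> 0 < g u).
  destruct (completeness E) as [T [HT1 HT2]].
  { exists t. intros s [Hs1 Hs2]. apply Rnot_lt_le. intros Hlt.
    specialize (Hs2 t ltac:(lra)). lra. }
  { exists 0. split; [lra|]. intros u Hu. replace u with 0 by lra. lra. }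
  assert (T0 : 0 <= T).
  { apply HT1. split; [lra|]. intros u Hu. replace u with 0 by lra. lra. }
  assert (Hpos : forall u, 0 <= u < T -> 0 < g u).
  { intros u Hu. apply NNPP. intros Hn.
    assert (is_upper_bound E u).
    { intros s [Hs1 Hs2]. apply Rnot_lt_le. intros Hlt. apply Hn, Hs2. lra. }
    specialize (HT2 _ H). lra. }
  assert (HgT : 1 <= g T).
  { rewrite <- Hg0. apply (derive_nonneg_increasing g g1 0 T T0); [auto|].
    intros x Hx. replace 0 with (r * 0) by ring.
    apply (slope_ge_of_value_ge 0 T); [lra| |easy]. intros u Hu. left. apply Hpos. lra. }
  destruct (is_derive_continuous_eps g T _ 1 (Hg T) ltac:(lra)) as [d [Hd Hcont]].
  assert (T + d / 2 <= T); [|lra].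
  apply HT1. split; [lra|]. intros u Hu.
  destruct (Rlt_dec u T) as [Hu'|Hu']; [apply Hpos; lra|].
  assert (Hc : Rabs (g u - g T) < 1) by (apply Hcont; apply Rabs_def1; lra).
  apply Rabs_def2 in Hc. lra.
Qed.

(** The same lemma is used twice: [m = 0] gives [g' >= 0], hence [g >= 1], and then
    [m = 1] gives [g' >= r]. *)
Lemma ground_slope t : 0 <= t -> r <= g1 t.
Proof.
  intros Ht. assert (Hr := r_pos).
  assert (H0 : forall t, 0 < t -> 0 <= g1 t).
  { intros s Hs. replace 0 with (r * 0) by ring.
    apply (slope_ge_of_value_ge 0 (s + 1)); try lra.
    intros u Hu. left. apply ground_positive. lra. }
  assert (H1 : forall t, 0 <= t -> 1 <= g t).
  { intros s Hs. rewrite <- Hg0. apply (derive_nonneg_increasing g g1 0 s Hs); [auto|].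
    intros x Hx. apply H0. lra. }
  destruct Ht as [Ht| <-]; [|lra].
  rewrite <- (Rmult_1_r r).
  apply (slope_ge_of_value_ge 1 (t + 1)); try lra.
  intros u Hu. apply H1. lra.
Qed.

Lemma ground_value t : 0 <= t -> 1 + r * t <= g t.
Proof.
  intros Ht.
  enough (g 0 - r * 0 <= g t - r * t) by lra.
  apply (derive_nonneg_increasing (fun x => g x - r * x) (fun x => g1 x - r) 0 t Ht).
  - intros x Hx. assert (D := Hg x). auto_derive; [eexists; eassumption|].
    rewrite_derive D. ring.
  - intros x Hx. generalize (ground_slope x ltac:(lra)). lra.
Qed.

End GroundState.

(** The last bound says that [m~ = phi_0^2 m] has a nonnegative logarithmic
    derivative [2 (log_slope + phi_0'/phi_0)]. *)
Lemma jacobi_0_ground : exists p1 : R -> R,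
  (forall t, is_derive (jacobi al be 0) t (p1 t)) /\ p1 0 = 0 /\
  (forall t, 0 <= t -> (1 + r * t) * exp (- r * t) <= jacobi al be 0 t) /\
  (forall t, 0 < t -> 0 <= log_slope t * jacobi al be 0 t + p1 t).
Proof.
  destruct (jacobi_ode 0) as [p1 [p2 [D1 [D2 [Hode [H0 H10]]]]]].
  set (f := jacobi al be 0) in *.
  exists p1. split; [easy|split; [easy|]].
  set (g := fun t => exp (r * t) * f t).
  set (g1 := fun t => exp (r * t) * (r * f t + p1 t)).
  set (g2 := fun t => exp (r * t) * (r * (r * f t + p1 t) + r * p1 t + p2 t)).
  assert (Hg : forall t, is_derive g t (g1 t)).
  { intros t. assert (E := D1 t). unfold g, g1. auto_derive; [eexists; eassumption|].
    rewrite_derive E. ring. }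
  assert (Hg1 : forall t, is_derive g1 t (g2 t)).
  { intros t. assert (E := D1 t). assert (E2 := D2 t). unfold g1, g2.
    auto_derive; [repeat split; eexists; eassumption|].
    rewrite_derive E. rewrite_derive E2. ring. }
  assert (Hg2 : forall t, 0 < t -> g2 t = 2 * (log_slope t - r) * (r * g t - g1 t)).
  { intros t Ht. unfold g2, g1, g. rewrite Hode by easy. ring. }
  assert (Hg0 : g 0 = 1) by (unfold g; rewrite H0, Rmult_0_r, exp_0; ring).
  assert (Hg10 : g1 0 = r) by (unfold g1; rewrite H0, H10, Rmult_0_r, exp_0; ring).
  assert (Hval := ground_value g g1 g2 Hg Hg1 Hg2 Hg0 Hg10).
  assert (Hslope := ground_slope g g1 g2 Hg Hg1 Hg2 Hg0 Hg10).
  assert (Hee : forall t, exp (- r * t) * exp (r * t) = 1).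
  { intros t. rewrite <- exp_plus. replace (- r * t + r * t) with 0 by ring. apply exp_0. }
  assert (Hr := r_pos).
  split.
  - intros t Ht. specialize (Hval t Ht). unfold g in Hval.
    assert (He := exp_pos (- r * t)).
    replace (f t) with (exp (- r * t) * (exp (r * t) * f t))
      by (rewrite <- Rmult_assoc, Hee; ring).
    rewrite (Rmult_comm (1 + r * t)). apply Rmult_le_compat_l; lra.
  - intros t Ht. assert (Hl := log_slope_ge t Ht).
    specialize (Hval t ltac:(lra)). specialize (Hslope t ltac:(lra)). unfold g in Hval. unfold g1 in Hslope.
    assert (He := exp_pos (r * t)).
    assert (0 < f t) by (apply (Rmult_lt_reg_l (exp (r * t))); nra).
    assert (0 < r * f t + p1 t) by (apply (Rmult_lt_reg_l (exp (r * t))); nra).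
    nra.
Qed.

Lemma jacobi_0_pos t : 0 <= t -> 0 < jacobi al be 0 t.
Proof.
  intros Ht. destruct jacobi_0_ground as [p1 [_ [_ [H _]]]].
  eapply Rlt_le_trans; [|now apply H].
  apply Rmult_lt_0_compat; [|apply exp_pos]. pose proof r_pos. nra.
Qed.

(** The quotient [u] of [phi_lam] by [phi_0] solves
    [u'' + (log m~)' u' + lam^2 u = 0] with [m~] increasing.  The energy
    [u'^2 + lam^2 u^2] therefore decreases, whence [|u'| <= lam]. *)
Lemma jacobi_tilde_ge lam t : 0 <= lam -> 0 <= t ->
  1 - lam * t <= jacobi_tilde al be lam t.
Proof.
  intros Hlam Ht.
  destruct (jacobi_ode lam) as [p1 [p2 [D1 [D2 [Hode [H0 H10]]]]]].
  destruct (jacobi_ode 0) as [q1 [q2 [B1 [B2 [Bode [B0 B10]]]]]].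
  destruct jacobi_0_ground as [q1' [B1' [_ [_ Hground]]]].
  assert (Hq : forall t, q1' t = q1 t).
  { intros s. rewrite <- (is_derive_unique _ _ _ (B1' s)). apply is_derive_unique, B1. }
  set (f := jacobi al be lam) in *.
  assert (Hpos := jacobi_0_pos).
  unfold jacobi_tilde. fold f. set (f0 := jacobi al be 0) in *.
  set (N := fun t => p1 t * f0 t - f t * q1 t).
  set (u := fun t => f t / f0 t).
  set (u1 := fun t => N t / f0 t ^ 2).
  set (u2 := fun t => (p2 t * f0 t - f t * q2 t) / f0 t ^ 2 - 2 * N t * q1 t / f0 t ^ 3).
  assert (Hu : forall t, 0 <= t -> is_derive u t (u1 t)).
  { intros s Hs. assert (Hf := Hpos s Hs). assert (E1 := D1 s). assert (E2 := B1 s).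
    unfold u, u1, N. auto_derive.
    - repeat split; try (eexists; eassumption). lra.
    - rewrite_derive E1. rewrite_derive E2. field. lra. }
  assert (Hu1 : forall t, 0 <= t -> is_derive u1 t (u2 t)).
  { intros s Hs. assert (Hf := Hpos s Hs). assert (E1 := D1 s). assert (E2 := B1 s).
    assert (E3 := D2 s). assert (E4 := B2 s).
    unfold u1, u2, N. auto_derive.
    - repeat split; try (eexists; eassumption).
      assert (0 < f0 s * (f0 s * 1)) by nra. lra.
    - rewrite_derive E1. rewrite_derive E2. rewrite_derive E3. rewrite_derive E4. field. lra. }
  set (E := fun t => u1 t ^ 2 + lam ^ 2 * u t ^ 2).
  set (E' := fun t => 2 * u1 t * u2 t + 2 * lam ^ 2 * u t * u1 t).
  assert (HE : forall s, 0 <= s -> E s <= lam ^ 2).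
  { intros s Hs. replace (lam ^ 2) with (E 0).
    - apply (derive_nonpos_decreasing E E' 0 s Hs).
      + intros x Hx. assert (G0 := Hu x ltac:(lra)). assert (G1 := Hu1 x ltac:(lra)).
        unfold E, E'. auto_derive; [repeat split; eexists; eassumption|].
        rewrite_derive G0. rewrite_derive G1. ring.
      + intros x Hx. assert (Hf := Hpos x ltac:(lra)).
        assert (Hgr := Hground x ltac:(lra)). rewrite Hq in Hgr. fold f0 in Hgr.
        assert (Eq : u2 x = - 2 * ((log_slope x * f0 x + q1 x) / f0 x) * u1 x - lam ^ 2 * u x).
        { unfold u2, u1, u, N. rewrite Hode, Bode by lra. fold f f0. field. lra. }
        unfold E'. rewrite Eq.
        assert (0 <= (log_slope x * f0 x + q1 x) / f0 x) by now apply Rdiv_le_0_compat.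
        assert (0 <= u1 x ^ 2) by apply pow2_ge_0.
        nra.
    - unfold E, u1, u, N. rewrite H0, H10, B0, B10. field. }
  assert (Hslope : forall s, 0 <= s -> - lam <= u1 s).
  { intros s Hs. specialize (HE s Hs). unfold E in HE.
    assert (0 <= lam ^ 2 * u s ^ 2) by (apply Rmult_le_pos; apply pow2_ge_0). nra. }
  enough (u 0 + lam * 0 <= u t + lam * t).
  { assert (u 0 = 1) by (unfold u; rewrite H0, B0; field). unfold u in *. lra. }
  apply (derive_nonneg_increasing (fun x => u x + lam * x) (fun x => u1 x + lam) 0 t Ht).
  - intros x Hx. assert (G := Hu x ltac:(lra)). auto_derive; [eexists; eassumption|].
    rewrite_derive G. ring.
  - intros x Hx. specialize (Hslope x ltac:(lra)). lra.
Qed.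

Lemma jacobi_continuous lam t : continuous (jacobi al be lam) t.
Proof.
  destruct (jacobi_ode lam) as [p1 [p2 [D1 _]]]. exact (is_derive_continuous _ _ _ (D1 t)).
Qed.

Lemma jacobi_tilde_continuous lam t : 0 <= t -> continuous (jacobi_tilde al be lam) t.
Proof.
  intros Ht. unfold jacobi_tilde, Rdiv.
  apply (continuous_mult (jacobi al be lam) (fun t => / jacobi al be 0 t)).
  - apply jacobi_continuous.
  - apply (continuous_comp (jacobi al be 0) Rinv); [apply jacobi_continuous|].
    apply continuous_Rinv. generalize (jacobi_0_pos t Ht). lra.
Qed.

Lemma m_tilde_continuous t : 0 < t -> continuous (m_tilde al be) t.
Proof.
  intros Ht. unfold m_tilde.
  apply (continuous_mult (fun t => jacobi al be 0 t ^ 2) (m_weight al be)).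
  - apply (continuous_comp (jacobi al be 0) (fun z => z ^ 2)); [apply jacobi_continuous|].
    apply (ex_derive_continuous (V := R_NormedModule)). auto_derive. easy.
  - apply (ex_derive_continuous (V := R_NormedModule)).
    unfold m_weight, Rpower. auto_derive.
    pose proof (sinh_pos t Ht). pose proof (cosh_ge_1 t). repeat split; lra.
Qed.

Let cm := / sqrt (2 * PI) * Rpower 2 (2 * r).

Lemma cm_pos : 0 < cm.
Proof.
  unfold cm. apply Rmult_lt_0_compat; [|apply exp_pos].
  apply Rinv_0_lt_compat, sqrt_lt_R0. pose proof PI_RGT_0. lra.
Qed.

Lemma m_tilde_pos t : 0 < t -> 0 < m_tilde al be t.
Proof.
  intros Ht. unfold m_tilde, m_weight. change (/ sqrt (2 * PI) * Rpower 2 (2 * rho al be)) with cm. pose proof cm_pos.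
  pose proof (jacobi_0_pos t ltac:(lra)).
  apply Rmult_lt_0_compat; [now apply pow_lt|].
  apply Rmult_lt_0_compat; [apply Rmult_lt_0_compat; [easy|]|]; apply exp_pos.
Qed.

Lemma m_tilde_lower_small : exists k, 0 < k /\
  forall t, 0 < t <= 1 -> k * Rpower t (2 * al + 1) <= m_tilde al be t.
Proof.
  exists (exp (- r) ^ 2 * cm). assert (Hcm := cm_pos). assert (He := exp_pos (- r)).
  split; [apply Rmult_lt_0_compat; [now apply pow_lt|easy]|].
  intros t Ht. unfold m_tilde, m_weight.
  change (/ sqrt (2 * PI) * Rpower 2 (2 * rho al be)) with cm.
  assert (Hr := r_pos).
  assert (Hj : exp (- r) <= jacobi al be 0 t).
  { destruct jacobi_0_ground as [p1 [_ [_ [H _]]]].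
    eapply Rle_trans; [|apply H; lra].
    assert (exp (- r) <= exp (- r * t)).
    { destruct (Req_dec t 1) as [->|]; [right; f_equal; ring|].
      left. apply exp_increasing. nra. }
    assert (0 < exp (- r * t)) by apply exp_pos.
    assert (0 <= r * t * exp (- r * t)) by (apply Rmult_le_pos; [apply Rmult_le_pos|]; lra). lra. }
  assert (HS : Rpower t (2 * al + 1) <= Rpower (sinh t) (2 * al + 1)).
  { apply Rle_Rpower_l; [lra|]. split; [lra|]. apply sinh_ge_id. lra. }
  assert (HC : 1 <= Rpower (cosh t) (2 * be + 1)).
  { apply Rle_trans with (Rpower (cosh t) 0).
    { rewrite Rpower_O; [lra|]. pose proof (cosh_ge_1 t). lra. }
    apply Rle_Rpower; [apply cosh_ge_1|lra]. }
  assert (0 < Rpower t (2 * al + 1)) by apply exp_pos.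
  rewrite Rmult_assoc.
  apply Rmult_le_compat; [apply pow2_ge_0|nra|apply pow_incr; lra|].
  rewrite Rmult_assoc. apply Rmult_le_compat_l; [lra|]. nra.
Qed.

(** The factor [exp(- 2 r t)] of [phi_0^2] cancels the growth of the weight, and
    [(1 + r t)^2] remains. *)
Lemma m_tilde_lower_large : exists k, 0 < k /\
  forall t, 1 <= t -> k * t ^ 2 <= m_tilde al be t.
Proof.
  assert (Hcm := cm_pos). assert (Hr := r_pos).
  exists (r ^ 2 * cm * Rpower (/ 4) (2 * r)). split.
  { apply Rmult_lt_0_compat; [|apply exp_pos]. apply Rmult_lt_0_compat; [now apply pow_lt|easy]. }
  intros t Ht. unfold m_tilde, m_weight.
  change (/ sqrt (2 * PI) * Rpower 2 (2 * rho al be)) with cm.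
  assert (Hj : r * t * exp (- r * t) <= jacobi al be 0 t).
  { destruct jacobi_0_ground as [p1 [_ [_ [H _]]]].
    eapply Rle_trans; [|apply H; lra]. apply Rmult_le_compat_r; [left; apply exp_pos|lra]. }
  assert (HS : exp t * / 4 <= sinh t).
  { unfold sinh. assert (exp (- t) <= 1).
    { rewrite <- exp_0. destruct (Req_dec t 0); [lra|]. left. apply exp_increasing. lra. }
    assert (2 <= exp t).
    { pose proof (exp_ineq1 t ltac:(lra)). lra. }
    lra. }
  assert (HS0 : 0 < exp t * / 4) by (pose proof (exp_pos t); lra).
  assert (HW : Rpower (/ 4) (2 * r) * exp (2 * r * t)
     <= Rpower (sinh t) (2 * al + 1) * Rpower (cosh t) (2 * be + 1)).
  { apply Rle_trans with (Rpower (sinh t) (2 * r)).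
    - apply Rle_trans with (Rpower (exp t * / 4) (2 * r)).
      + rewrite <- Rpower_mult_distr by (try apply exp_pos; lra).
        right. rewrite (Rmult_comm (Rpower (exp t) _)). f_equal.
        unfold Rpower. now rewrite ln_exp.
      + apply Rle_Rpower_l; [lra|]. lra.
    - replace (2 * r) with (2 * al + 1 + (2 * be + 1)) by (unfold r; ring).
      rewrite Rpower_plus. apply Rmult_le_compat_l; [left; apply exp_pos|].
      apply Rle_Rpower_l; [lra|]. pose proof (cosh_gt_sinh t). lra. }
  assert (He : exp (- r * t) ^ 2 * exp (2 * r * t) = 1).
  { simpl. rewrite Rmult_1_r, <- !exp_plus.
    replace (- r * t + - r * t + 2 * r * t) with 0 by ring. apply exp_0. }
  assert (HP : 0 < Rpower (/ 4) (2 * r)) by apply exp_pos.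
  set (P := Rpower (/ 4) (2 * r)) in *.
  replace (r ^ 2 * cm * P * t ^ 2)
    with ((r * t * exp (- r * t)) ^ 2 * (cm * (P * exp (2 * r * t))))
    by (transitivity (r ^ 2 * cm * P * t ^ 2 * (exp (- r * t) ^ 2 * exp (2 * r * t)));
        [ring|rewrite He; ring]).
  assert (H0 : 0 < exp (- r * t)) by apply exp_pos.
  assert (H1 : 0 < exp (2 * r * t)) by apply exp_pos.
  apply Rmult_le_compat; [apply pow2_ge_0|apply Rmult_le_pos; [lra|apply Rmult_le_pos; lra]| |].
  - apply pow_incr. split; [|easy]. apply Rmult_le_pos; [apply Rmult_le_pos|]; lra.
  - rewrite (Rmult_assoc cm). apply Rmult_le_compat_l; lra.
Qed.

End JacobiBounds.

(** * The Gamma function *)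

Lemma exp_taylor1 a : Rabs a <= 1 / 2 -> 0 <= exp a - 1 - a <= 2 * a ^ 2.
Proof.
  intros Ha. apply Rabs_le_between in Ha. split.
  - pose proof (exp_ineq1_le a). lra.
  - assert (He : exp a * (1 - a) <= 1).
    { assert (exp a * exp (- a) = 1) by (rewrite <- exp_plus, Rplus_opp_r; apply exp_0).
      pose proof (exp_ineq1_le (- a)). pose proof (exp_pos a). nra. }
    pose proof (exp_pos a).
    apply (Rmult_le_reg_r (1 - a)); [lra|].
    assert (0 <= a ^ 2 * (1 - 2 * a)) by (apply Rmult_le_pos; [apply pow2_ge_0|lra]).
    nra.
Qed.

Lemma cos_taylor1 b : 0 <= 1 - cos b <= b ^ 2 / 2.
Proof.
  split; [pose proof (COS_bound b); lra|].
  assert (E : 1 - cos b = 2 * sin (b / 2) ^ 2).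
  { replace b with (2 * (b / 2)) at 1 by field. rewrite cos_2a_sin. ring. }
  rewrite E.
  assert (H : forall z, 0 <= z -> sin z ^ 2 <= z ^ 2).
  { intros z Hz. apply pow_maj_Rabs. apply Rabs_le.
    destruct (Req_dec z 0) as [->|Hz']; [rewrite sin_0; lra|].
    assert (sin z <= z) by (left; apply sin_lt_x; lra).
    split; [|easy].
    destruct (Rle_dec z 1).
    - assert (0 <= sin z); [|lra]. apply sin_ge_0; [lra|]. pose proof PI2_1. lra.
    - pose proof (SIN_bound z). lra. }
  destruct (Rle_dec 0 b) as [Hb|Hb].
  - specialize (H (b / 2) ltac:(lra)). lra.
  - specialize (H (- (b / 2)) ltac:(lra)). rewrite sin_neg in H. nra.
Qed.

Lemma sin_taylor1 b : Rabs b <= 1 -> Rabs (sin b - b) <= b ^ 2.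
Proof.
  assert (H : forall z, 0 <= z <= 1 -> Rabs (sin z - z) <= z ^ 2).
  { intros z Hz. apply Rabs_le. split.
    - enough (0 ^ 2 + sin 0 - 0 <= z ^ 2 + sin z - z) by (rewrite sin_0 in *; lra).
      apply (derive_nonneg_increasing (fun z => z ^ 2 + sin z - z)
               (fun z => 2 * z + cos z - 1)); [lra| |].
      + intros x Hx. auto_derive; [easy|ring].
      + intros x Hx. pose proof (cos_taylor1 x). nra.
    - destruct (Req_dec z 0) as [->|]; [rewrite sin_0; lra|].
      assert (sin z < z) by (apply sin_lt_x; lra). nra. }
  intros Hb. apply Rabs_le_between in Hb. destruct (Rle_dec 0 b).
  - apply H. lra.
  - specialize (H (- b) ltac:(lra)). rewrite sin_neg in H.
    replace (- sin b - - b) with (- (sin b - b)) in H by ring. rewrite Rabs_Ropp in H. nra.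
Qed.

Lemma Cmod_le_abs (z : C) : Cmod z <= Rabs (Re z) + Rabs (Im z).
Proof.
  unfold Cmod. apply Rsqr_incr_0_var.
  - rewrite Rsqr_sqrt by nra. unfold Rsqr.
    pose proof (Rabs_pos (Re z)); pose proof (Rabs_pos (Im z)).
    rewrite <- (pow2_abs (fst z)), <- (pow2_abs (snd z)). unfold Re, Im in *. nra.
  - pose proof (Rabs_pos (Re z)); pose proof (Rabs_pos (Im z)). lra.
Qed.

Lemma im_le_Cmod (z : C) : Rabs (Im z) <= Cmod z.
Proof. eapply Rle_trans; [apply Rmax_r|apply Rmax_Cmod]. Qed.

Lemma Cexp_taylor1 (u : C) : Cmod u <= 1 / 2 -> Cmod (Cexp u - 1 - u)%C <= 8 * Cmod u ^ 2.
Proof.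
  intros Hu.
  assert (Ha := Rle_trans _ _ _ (re_le_Cmod u) Hu).
  assert (Hb := Rle_trans _ _ _ (im_le_Cmod u) Hu).
  rewrite Cmod2_alt.
  set (a := Re u) in *. set (b := Im u) in *.
  eapply Rle_trans; [apply Cmod_le_abs|].
  assert (ER : Re (Cexp u - 1 - u)%C = (exp a - 1 - a) - exp a * (1 - cos b)).
  { unfold Cexp. fold a b. simpl. fold (Re u). fold a. ring. }
  assert (EI : Im (Cexp u - 1 - u)%C = (exp a - 1) * sin b + (sin b - b)).
  { unfold Cexp. fold a b. simpl. fold (Im u). fold b. ring. }
  rewrite ER, EI.
  assert (T1 := exp_taylor1 a Ha). assert (T2 := cos_taylor1 b).
  assert (T3 := sin_taylor1 b ltac:(lra)).
  apply Rabs_le_between in Ha. apply Rabs_le_between in Hb.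
  assert (He : 0 < exp a <= 2) by (split; [apply exp_pos|nra]).
  assert (H1 : Rabs (exp a - 1 - a - exp a * (1 - cos b)) <= 2 * a ^ 2 + b ^ 2).
  { apply Rabs_le. assert (0 <= exp a * (1 - cos b) <= b ^ 2) by nra. lra. }
  assert (H2 : Rabs ((exp a - 1) * sin b) <= 2 * a ^ 2 + 2 * b ^ 2).
  { rewrite Rabs_mult.
    assert (Rabs (exp a - 1) <= 2 * Rabs a).
    { replace (exp a - 1) with ((exp a - 1 - a) + a) by ring.
      eapply Rle_trans; [apply Rabs_triang|].
      rewrite (Rabs_pos_eq (exp a - 1 - a)) by lra.
      assert (Rabs a <= 1 / 2) by (apply Rabs_le; lra).
      assert (a ^ 2 = Rabs a ^ 2) by (now rewrite pow2_abs).
      pose proof (Rabs_pos a). nra. }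
    assert (Rabs (sin b) <= 2 * Rabs b).
    { replace (sin b) with ((sin b - b) + b) by ring.
      eapply Rle_trans; [apply Rabs_triang|].
      assert (Rabs b <= 1 / 2) by (apply Rabs_le; lra).
      assert (b ^ 2 = Rabs b ^ 2) by (now rewrite pow2_abs).
      pose proof (Rabs_pos b). nra. }
    apply Rle_trans with (2 * Rabs a * (2 * Rabs b)).
    - apply Rmult_le_compat; try apply Rabs_pos; easy.
    - rewrite <- (pow2_abs a), <- (pow2_abs b). pose proof (pow2_ge_0 (Rabs a - Rabs b)). nra. }
  assert (H3 := Rabs_triang ((exp a - 1) * sin b) (sin b - b)).
  pose proof (pow2_ge_0 a). pose proof (pow2_ge_0 b). lra.
Qed.

(** A sequence whose successive quotients are [1 + O(1/n^2)] tends to a nonzero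
    limit: beyond a suitable rank [N] it stays within [|g_N|/2] of [g_N]. *)
Lemma product_converges (g : nat -> C) (M : R) (N0 : nat) :
  0 <= M ->
  (forall n, (N0 <= n)%nat -> g n <> RtoC 0) ->
  (forall n, (N0 <= n)%nat -> (1 <= n)%nat ->
     Cmod (g (S n) - g n)%C <= Cmod (g n) * (M / INR n ^ 2)) ->
  exists L : C, L <> RtoC 0 /\
    is_lim_seq (fun n => Re (g n)) (Re L) /\ is_lim_seq (fun n => Im (g n)) (Im L).
Proof.
  intros HM Hg0 Hstep.
  (* 8 M <= N makes the tail 4 M / N of the sum of the relative steps at most 1/2. *)
  destruct (nfloor_ex (8 * M)) as [k [_ Hk]]; [lra|].
  set (N := (N0 + k + 1)%nat).
  assert (HN : 8 * M <= INR N).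
  { unfold N. rewrite !plus_INR. simpl. pose proof (pos_INR N0). lra. }
  assert (HN1 : 1 <= INR N) by (unfold N; rewrite !plus_INR; simpl; pose proof (pos_INR N0); pose proof (pos_INR k); lra).
  set (c := Cmod (g N)).
  assert (Hc : 0 < c) by (apply Cmod_gt_0, Hg0; unfold N; lia).
  assert (HnR : forall n, (N <= n)%nat -> INR N <= INR n) by (intros; now apply le_INR).
  assert (Hinv : forall n, (N <= n)%nat -> M / INR n ^ 2 <= 2 * M * (/ INR n - / INR (S n))).
  { intros n Hn. specialize (HnR n Hn). rewrite S_INR.
    replace (2 * M * (/ INR n - / (INR n + 1))) with (M * (2 / (INR n * (INR n + 1))))
      by (field; lra).
    unfold Rdiv at 1. apply Rmult_le_compat_l; [easy|].
    apply (Rmult_le_reg_r (INR n ^ 2 * (INR n + 1))); [nra|].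
    replace (/ INR n ^ 2 * (INR n ^ 2 * (INR n + 1))) with (INR n + 1) by (field; lra).
    replace (2 / (INR n * (INR n + 1)) * (INR n ^ 2 * (INR n + 1))) with (2 * INR n) by (field; lra).
    lra. }
  assert (HMN : 4 * M * / INR N <= 1 / 2).
  { apply (Rmult_le_reg_r (INR N)); [lra|]. rewrite Rmult_assoc, Rinv_l by lra. lra. }
  assert (Hclose : forall j, Cmod (g (N + j)%nat - g N)%C
                    <= c * (4 * M * (/ INR N - / INR (N + j)%nat))).
  { induction j as [|j IH].
    - rewrite Nat.add_0_r. replace (g N - g N)%C with (RtoC 0) by ring. rewrite Cmod_0. nra.
    - replace (N + S j)%nat with (S (N + j)) by lia.
      assert (Hn : (N <= N + j)%nat) by lia.
      assert (Hni := HnR _ Hn). assert (Hnv := Hinv _ Hn).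
      assert (Hpos : 0 < / INR (N + j)) by (apply Rinv_0_lt_compat; lra).
      assert (Hgn : Cmod (g (N + j)%nat) <= 2 * c).
      { replace (g (N + j)%nat) with ((g (N + j)%nat - g N) + g N)%C by ring.
        eapply Rle_trans; [apply Cmod_triangle|]. fold c.
        assert (4 * M * (/ INR N - / INR (N + j)) <= 1 / 2) by nra. nra. }
      replace (g (S (N + j)) - g N)%C
        with ((g (S (N + j)) - g (N + j)%nat) + (g (N + j)%nat - g N))%C by ring.
      eapply Rle_trans; [apply Cmod_triangle|].
      assert (Hs := Hstep (N + j)%nat ltac:(unfold N; lia) ltac:(unfold N; lia)).
      assert (0 <= M / INR (N + j) ^ 2)
        by (apply Rdiv_le_0_compat; [easy|apply pow_lt; lra]).
      assert (Cmod (g (N + j)%nat) * (M / INR (N + j) ^ 2)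
              <= 2 * c * (2 * M * (/ INR (N + j) - / INR (S (N + j)))))
        by (apply Rmult_le_compat; try easy; apply Cmod_ge_0).
      nra. }
  assert (Hbound : forall n, (N <= n)%nat -> Cmod (g n) <= 2 * c /\ c / 2 <= Cmod (g n)).
  { intros n Hn. specialize (Hclose (n - N)%nat). replace (N + (n - N))%nat with n in Hclose by lia.
    assert (Hni := HnR _ Hn).
    assert (Hpos : 0 < / INR n) by (apply Rinv_0_lt_compat; lra).
    assert (4 * M * (/ INR N - / INR n) <= 1 / 2) by nra.
    assert (Cmod (g n - g N)%C <= c / 2) by nra.
    split.
    - replace (g n) with ((g n - g N) + g N)%C by ring.
      eapply Rle_trans; [apply Cmod_triangle|]. fold c. lra.
    - assert (c <= Cmod (g n) + Cmod (g n - g N)%C); [|lra].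
      unfold c. replace (g N) with (g n + - (g n - g N))%C at 1 by ring.
      eapply Rle_trans; [apply Cmod_triangle|]. rewrite Cmod_opp. lra. }
  assert (Hcauchy : forall n j, (N <= n)%nat -> Cmod (g (n + j)%nat - g n)%C
                    <= 4 * M * c * (/ INR n - / INR (n + j)%nat)).
  { intros n j Hn. induction j as [|j IH].
    - rewrite Nat.add_0_r. replace (g n - g n)%C with (RtoC 0) by ring. rewrite Cmod_0. nra.
    - replace (n + S j)%nat with (S (n + j)) by lia.
      assert (Hn' : (N <= n + j)%nat) by lia.
      assert (Hnv := Hinv _ Hn'). destruct (Hbound _ Hn') as [Hb _].
      replace (g (S (n + j)) - g n)%C
        with ((g (S (n + j)) - g (n + j)%nat) + (g (n + j)%nat - g n))%C by ring.
      eapply Rle_trans; [apply Cmod_triangle|].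
      assert (Hs := Hstep (n + j)%nat ltac:(unfold N in *; lia) ltac:(unfold N in *; lia)).
      assert (0 <= M / INR (n + j) ^ 2).
      { apply Rdiv_le_0_compat; [easy|]. apply pow_lt. specialize (HnR _ Hn'). lra. }
      assert (Cmod (g (n + j)%nat) * (M / INR (n + j) ^ 2)
              <= 2 * c * (2 * M * (/ INR (n + j) - / INR (S (n + j)))))
        by (apply Rmult_le_compat; try easy; apply Cmod_ge_0).
      nra. }
  assert (Hlim : forall h : C -> R,
     (forall z w, h z - h w = h (z - w)%C) -> (forall z, Rabs (h z) <= Cmod z) ->
     exists l : R, is_lim_seq (fun n => h (g n)) l).
  { intros h Hadd Hle. apply ex_lim_seq_cauchy_corr. intros eps.
    destruct (nfloor_ex (4 * M * c / eps)) as [n1 [_ Hn1]].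
    { apply Rdiv_le_0_compat; [nra|apply cond_pos]. }
    assert (He := cond_pos eps).
    set (n2 := (N + n1 + 1)%nat).
    assert (HQ : forall n m, (n2 <= n)%nat -> (n <= m)%nat -> Rabs (h (g m) - h (g n)) < eps).
    { intros n m Hn Hm. rewrite Hadd. eapply Rle_lt_trans; [apply Hle|].
      replace m with (n + (m - n))%nat by lia.
      eapply Rle_lt_trans; [apply Hcauchy; unfold n2 in *; lia|].
      assert (Hn2 : INR n1 + 1 <= INR n).
      { rewrite <- S_INR. apply le_INR. unfold n2 in *. lia. }
      assert (0 < / INR (n + (m - n))).
      { apply Rinv_0_lt_compat. replace (n + (m - n))%nat with m by lia.
        apply Rlt_le_trans with (INR n); [pose proof (pos_INR n1); lra|now apply le_INR]. }
      assert (0 <= 4 * M * c) by nra.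
      apply Rle_lt_trans with (4 * M * c * / INR n); [nra|].
      assert (0 < INR n) by (pose proof (pos_INR n1); lra).
      apply (Rmult_lt_reg_r (INR n)); [easy|]. rewrite Rmult_assoc, Rinv_l by lra.
      apply (Rmult_lt_reg_r (/ eps)); [now apply Rinv_0_lt_compat|].
      replace (eps * INR n * / eps) with (INR n) by (field; lra).
      unfold Rdiv in Hn1. lra. }
    exists n2. intros n m Hn Hm. destruct (Nat.le_gt_cases n m).
    - rewrite Rabs_minus_sym. now apply HQ.
    - apply HQ; lia. }
  destruct (Hlim Re) as [lr Hr].
  { intros z w. unfold Re. simpl. ring. } { apply re_le_Cmod. }
  destruct (Hlim Im) as [li Hi].
  { intros z w. unfold Im. simpl. ring. } { apply im_le_Cmod. }
  exists (lr, li). split; [|now split].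
  assert (HL : c ^ 2 / 4 <= lr ^ 2 + li ^ 2).
  { assert (Hlr := is_lim_seq_mult' _ _ _ _ Hr Hr).
    assert (Hli := is_lim_seq_mult' _ _ _ _ Hi Hi).
    assert (Hs := is_lim_seq_plus' _ _ _ _ Hlr Hli).
    replace (lr ^ 2 + li ^ 2) with (lr * lr + li * li) by ring.
    apply (is_lim_seq_le_loc (fun _ => c ^ 2 / 4) _ (c ^ 2 / 4) (lr * lr + li * li)
             ) with (3 := Hs); [|apply is_lim_seq_const].
    exists N. intros n Hn. destruct (Hbound n Hn) as [_ Hb].
    assert (E := Cmod2_alt (g n)). pose proof (Cmod_ge_0 (g n)). nra. }
  intros E. injection E. intros E1 E2. subst. nra.
Qed.

Definition not_pole (z : C) : Prop := forall n : nat, (z + RtoC (INR n))%C <> RtoC 0.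

Lemma pochhammer_neq_0 z n : not_pole z -> pochhammer z n <> RtoC 0.
Proof.
  intros Hz. induction n as [|n IH]; simpl.
  - intros E. injection E. lra.
  - apply Cmult_neq_0; [easy|apply Hz].
Qed.

Lemma Cmod_Cexp u : Cmod (Cexp u) = exp (Re u).
Proof.
  assert (H := exp_pos (Re u)).
  rewrite <- (sqrt_pow2 (exp (Re u))) by lra. unfold Cmod, Cexp. simpl. f_equal.
  pose proof (sin2_cos2 (Im u)). unfold Rsqr in *. nra.
Qed.

Lemma Cexp_plus u v : Cexp (u + v)%C = (Cexp u * Cexp v)%C.
Proof.
  unfold Cexp. apply injective_projections; simpl;
    fold (Re u) (Re v) (Im u) (Im v); rewrite exp_plus, ?cos_plus, ?sin_plus; ring.
Qed.

Lemma Cexp_neq_0 u : Cexp u <> RtoC 0.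
Proof.
  intros E. assert (H := Cmod_Cexp u). rewrite E, Cmod_0 in H. pose proof (exp_pos (Re u)). lra.
Qed.

Lemma ln_succ_bounds n : (1 <= n)%nat ->
  / (INR n + 1) <= ln (INR n + 1) - ln (INR n) <= / INR n.
Proof.
  intros Hn. assert (H1 : 1 <= INR n) by (apply (le_INR 1); lia).
  assert (HU : forall z, 0 < z -> ln z <= z - 1).
  { intros z Hz. pose proof (exp_ineq1_le (ln z)). rewrite exp_ln in H by easy. lra. }
  split.
  - assert (E := HU (INR n / (INR n + 1)) ltac:(apply Rdiv_lt_0_compat; lra)).
    rewrite ln_div in E by lra.
    replace (INR n / (INR n + 1) - 1) with (- / (INR n + 1)) in E by (field; lra). lra.
  - assert (E := HU ((INR n + 1) / INR n) ltac:(apply Rdiv_lt_0_compat; lra)).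
    rewrite ln_div in E by lra.
    replace ((INR n + 1) / INR n - 1) with (/ INR n) in E by (field; lra). lra.
Qed.

Lemma Gamma_approx_neq_0 z n : not_pole z -> Gamma_approx z n <> RtoC 0.
Proof.
  intros Hz. unfold Gamma_approx, Cdiv. apply Cmult_neq_0.
  - apply Cmult_neq_0; [|apply Cexp_neq_0].
    intros E. apply RtoC_inj in E. now apply (INR_fact_neq_0 n).
  - intros E. assert (HP := pochhammer_neq_0 z (S n) Hz).
    assert (E1 : (pochhammer z (S n) * / pochhammer z (S n))%C = RtoC 1) by (field; easy).
    rewrite E in E1. rewrite Cmult_0_r in E1. injection E1. lra.
Qed.

Lemma Gamma_approx_succ z n : not_pole z -> (1 <= n)%nat ->
  Gamma_approx z (S n) =
  (Gamma_approx z n * ((Cexp (z * RtoC (ln (INR n + 1) - ln (INR n)))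
                        * RtoC (INR n + 1)) / (z + RtoC (INR n + 1))))%C.
Proof.
  intros Hz Hn. unfold Gamma_approx, Rpow_C.
  change (pochhammer z (S (S n))) with (pochhammer z (S n) * (z + RtoC (INR (S n))))%C.
  change (fact (S n)) with (S n * fact n)%nat.
  rewrite mult_INR. assert (Hzn := Hz (S n)). rewrite S_INR in *.
  assert (HP := pochhammer_neq_0 z (S n) Hz).
  replace (z * RtoC (ln (INR n + 1)))%C
    with (z * RtoC (ln (INR n)) + z * RtoC (ln (INR n + 1) - ln (INR n)))%C
    by (rewrite RtoC_minus; ring).
  rewrite Cexp_plus, RtoC_mult. field. split; easy.
Qed.

(** The quotient of successive approximants is [(1 + 1/n)^z / (1 + z/(n+1))], and
    both numerator and denominator are [1 + z/n + O(1/n^2)]. *)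
Lemma Gamma_approx_step z n : not_pole z -> (1 <= n)%nat -> 2 * Cmod z <= INR n ->
  Cmod (Gamma_approx z (S n) - Gamma_approx z n)%C
  <= Cmod (Gamma_approx z n) * ((16 * Cmod z ^ 2 + 2 * Cmod z) / INR n ^ 2).
Proof.
  intros Hz Hn HzN. assert (H1 : 1 <= INR n) by (apply (le_INR 1); lia).
  rewrite Gamma_approx_succ by easy.
  assert (Hd := ln_succ_bounds n Hn). set (d := ln (INR n + 1) - ln (INR n)) in *.
  set (w := INR n + 1) in *. assert (Hw : INR n < w) by (unfold w; lra).
  assert (Hzw : (z + RtoC w)%C <> RtoC 0).
  { unfold w. rewrite <- S_INR. apply Hz. }
  assert (Hm : 0 <= Cmod z) by apply Cmod_ge_0.
  assert (Hw0 : RtoC w <> RtoC 0) by (intros E; apply RtoC_inj in E; lra).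
  set (g := Gamma_approx z n).
  assert (Hin : 0 < / INR n) by (apply Rinv_0_lt_compat; lra).
  assert (Hin1 : / INR n * INR n = 1) by (apply Rinv_l; lra).
  assert (Hzd : Cmod (z * RtoC d)%C = Cmod z * d).
  { rewrite Cmod_mult, Cmod_R, Rabs_pos_eq; [easy|].
    apply Rle_trans with (/ w); [left; apply Rinv_0_lt_compat; lra|easy]. }
  assert (Hzd2 : Cmod z * d <= Cmod z * / INR n) by (apply Rmult_le_compat_l; lra).
  assert (Hzd3 : Cmod z * / INR n <= 1 / 2) by nra.
  assert (HT := Cexp_taylor1 (z * RtoC d)%C ltac:(lra)). rewrite Hzd in HT.
  set (e := Cexp (z * RtoC d)%C) in *.
  replace (g * (e * RtoC w / (z + RtoC w)) - g)%C
    with (g * (((e - 1 - z * RtoC d) + z * RtoC (d - / w)) * (RtoC w / (z + RtoC w))))%C.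
  2:{ rewrite RtoC_minus, RtoC_inv by lra. field. split; easy. }
  rewrite !Cmod_mult. apply Rmult_le_compat_l; [apply Cmod_ge_0|].
  assert (Hq : Cmod (RtoC w / (z + RtoC w))%C <= 2).
  { rewrite Cmod_div, Cmod_R, Rabs_pos_eq by (easy || lra).
    assert (w / 2 <= Cmod (z + RtoC w)%C).
    { assert (w <= Cmod (z + RtoC w)%C + Cmod z); [|lra].
      rewrite <- (Cmod_opp z). rewrite <- (Rabs_pos_eq w) at 1 by lra. rewrite <- Cmod_R.
      replace (RtoC w) with ((z + RtoC w) + - z)%C at 1 by ring. apply Cmod_triangle. }
    apply (Rmult_le_reg_r (Cmod (z + RtoC w)%C)); [lra|].
    unfold Rdiv. rewrite Rmult_assoc, Rinv_l by lra. lra. }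
  assert (Hs : Cmod (e - 1 - z * RtoC d + z * RtoC (d - / w))%C
               <= (8 * Cmod z ^ 2 + Cmod z) * (/ INR n) ^ 2).
  { eapply Rle_trans; [apply Cmod_triangle|]. rewrite Rmult_plus_distr_r.
    apply Rplus_le_compat.
    - eapply Rle_trans; [exact HT|]. rewrite Rmult_assoc. apply Rmult_le_compat_l; [lra|].
      rewrite <- Rpow_mult_distr. apply pow_incr. split; [|easy].
      rewrite <- Hzd. apply Cmod_ge_0.
    - rewrite Cmod_mult. apply Rmult_le_compat_l; [easy|].
      rewrite Cmod_R, Rabs_pos_eq by lra.
      apply Rle_trans with (/ INR n - / w); [lra|].
      replace (/ INR n - / w) with (/ INR n * / w) by (unfold w; field; lra).
      simpl. rewrite Rmult_1_r. apply Rmult_le_compat_l; [lra|].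
      apply Rinv_le_contravar; lra. }
  apply Rle_trans with ((8 * Cmod z ^ 2 + Cmod z) * (/ INR n) ^ 2 * 2).
  - apply Rmult_le_compat; try apply Cmod_ge_0; easy.
  - right. field. lra.
Qed.

Lemma CGamma_limit z : not_pole z -> CGamma z <> RtoC 0 /\
  is_lim_seq (fun n => Cmod (Gamma_approx z n) ^ 2) (Cmod (CGamma z) ^ 2).
Proof.
  intros Hz.
  destruct (nfloor_ex (2 * Cmod z)) as [k [_ Hk]].
  { pose proof (Cmod_ge_0 z). lra. }
  destruct (product_converges (Gamma_approx z) (16 * Cmod z ^ 2 + 2 * Cmod z) (k + 1))
    as [L [HL [HR HI]]].
  - pose proof (Cmod_ge_0 z). pose proof (pow2_ge_0 (Cmod z)). lra.
  - intros n _. now apply Gamma_approx_neq_0.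
  - intros n Hn Hn1. apply Gamma_approx_step; auto.
    assert (INR (k + 1) <= INR n) by now apply le_INR. rewrite plus_INR in H. simpl in H. lra.
  - assert (E : CGamma z = L).
    { unfold CGamma. rewrite (is_lim_seq_unique _ _ HR), (is_lim_seq_unique _ _ HI).
      now destruct L. }
    rewrite E. split; [easy|].
    rewrite Cmod2_alt.
    apply is_lim_seq_ext with (fun n => Re (Gamma_approx z n) * Re (Gamma_approx z n)
                                 + Im (Gamma_approx z n) * Im (Gamma_approx z n)).
    + intros n. rewrite Cmod2_alt. ring.
    + replace (Re L ^ 2 + Im L ^ 2) with (Re L * Re L + Im L * Im L) by ring.
      apply is_lim_seq_plus'; now apply is_lim_seq_mult'.
Qed.

(** The squared modulus of the Pochhammer symbol of [x + i y]. *)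
Fixpoint sqprod (x y : R) (n : nat) : R :=
  match n with
  | O => 1
  | S k => sqprod x y k * ((x + INR k) ^ 2 + y ^ 2)
  end.

Lemma Cmod_pochhammer x y n : Cmod (pochhammer (x, y) n) ^ 2 = sqprod x y n.
Proof.
  induction n as [|n IH].
  - simpl pochhammer. rewrite Cmod_1. simpl. ring.
  - change (pochhammer (x, y) (S n)) with (pochhammer (x, y) n * ((x, y) + RtoC (INR n)))%C.
    rewrite Cmod_mult, Rpow_mult_distr, IH, Cmod2_alt. simpl. ring.
Qed.

Lemma sqprod_pos x y n : 0 < y -> 0 < sqprod x y n.
Proof.
  intros Hy. induction n as [|n IH]; cbn [sqprod]; [lra|].
  apply Rmult_lt_0_compat; [easy|].
  pose proof (pow2_ge_0 (x + INR n)). assert (0 < y ^ 2) by (apply pow_lt; lra). lra.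
Qed.

Lemma Cmod_Gamma_approx x y n : 0 < y -> (1 <= n)%nat ->
  Cmod (Gamma_approx (x, y) n) ^ 2
  = INR (fact n) ^ 2 * exp (2 * x * ln (INR n)) / sqprod x y (S n).
Proof.
  intros Hy Hn. unfold Gamma_approx.
  assert (HP : pochhammer (x, y) (S n) <> RtoC 0).
  { intros E. assert (H := Cmod_pochhammer x y (S n)). rewrite E, Cmod_0 in H.
    pose proof (sqprod_pos x y (S n) Hy). lra. }
  rewrite Cmod_div by easy. unfold Rdiv. rewrite Rpow_mult_distr, pow_inv, Cmod_pochhammer.
  f_equal. rewrite Cmod_mult, Rpow_mult_distr, Cmod_R, pow2_abs. f_equal.
  unfold Rpow_C. rewrite Cmod_Cexp. simpl. rewrite Rmult_1_r, <- exp_plus. f_equal. ring.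
Qed.

(** * The Plancherel density *)

Lemma ln_sqr_taylor y k x : 0 < y -> 1 <= k -> 0 <= x ->
  Rabs (ln ((k + x) ^ 2 + y ^ 2) - ln (k ^ 2 + y ^ 2) - x * (2 * k / (k ^ 2 + y ^ 2)))
  <= 2 * x ^ 2 / k ^ 2.
Proof.
  intros Hy Hk Hx.
  assert (Hy2 : 0 < y ^ 2) by now apply pow_lt.
  destruct (Req_dec x 0) as [->|Hx0].
  { rewrite Rplus_0_r. replace (_ - _ - _) with 0 by ring. rewrite Rabs_R0.
    replace (2 * 0 ^ 2 / k ^ 2) with 0 by (field; lra). lra. }
  destruct (MVT_cor2 (fun u => ln (u ^ 2 + y ^ 2)) (fun u => 2 * u / (u ^ 2 + y ^ 2)) k (k + x))
    as [u [Hu1 Hu2]]; [lra| |].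
  { intros u Hu. apply is_derive_Reals. pose proof (pow2_ge_0 u).
    auto_derive; [simpl in *; nra|]. field. lra. }
  rewrite Hu1. replace (k + x - k) with x by ring.
  replace (2 * u / (u ^ 2 + y ^ 2) * x - x * (2 * k / (k ^ 2 + y ^ 2)))
    with (x * (2 * u / (u ^ 2 + y ^ 2) - 2 * k / (k ^ 2 + y ^ 2))) by ring.
  rewrite Rabs_mult, (Rabs_pos_eq x) by lra.
  assert (Hk2 : 0 < k ^ 2) by (apply pow_lt; lra).
  assert (Hu3 : 0 < u ^ 2) by (apply pow_lt; lra).
  assert (E : 2 * u / (u ^ 2 + y ^ 2) - 2 * k / (k ^ 2 + y ^ 2)
    = 2 * (u - k) * ((y ^ 2 - u * k) / (u ^ 2 + y ^ 2)) * / (k ^ 2 + y ^ 2)) by (field; lra).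
  rewrite E, !Rabs_mult, (Rabs_pos_eq 2), (Rabs_pos_eq (u - k)) by lra.
  rewrite (Rabs_pos_eq (/ (k ^ 2 + y ^ 2))) by (left; apply Rinv_0_lt_compat; lra).
  assert (H1 : Rabs ((y ^ 2 - u * k) / (u ^ 2 + y ^ 2)) <= 1).
  { unfold Rdiv. rewrite Rabs_mult, Rabs_inv, (Rabs_pos_eq (u ^ 2 + y ^ 2)) by lra.
    apply (Rmult_le_reg_r (u ^ 2 + y ^ 2)); [lra|].
    rewrite Rmult_assoc, Rinv_l by lra. rewrite Rmult_1_r, Rmult_1_l.
    apply Rabs_le. assert (0 <= u * k <= u ^ 2) by nra. lra. }
  assert (H2 : / (k ^ 2 + y ^ 2) <= / k ^ 2) by (apply Rinv_le_contravar; lra).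
  assert (H3 : 0 < / (k ^ 2 + y ^ 2)) by (apply Rinv_0_lt_compat; lra).
  assert (H0 := Rabs_pos ((y ^ 2 - u * k) / (u ^ 2 + y ^ 2))).
  replace (2 * x ^ 2 / k ^ 2) with (x * (2 * x * 1 * / k ^ 2)) by (field; lra).
  apply Rmult_le_compat_l; [lra|].
  apply Rmult_le_compat; [|lra| |easy].
  - apply Rmult_le_pos; lra.
  - apply Rmult_le_compat; lra.
Qed.

(** With [f(u) = ln (u^2 + y^2)] one has [f(k+x) - f(k) = x (f(k+1) - f(k)) + O(1/k^2)]
    uniformly in [y], and the main term telescopes.  The factor [k = 0] is kept
    exact, because it carries the singularity at [y = 0]. *)
Lemma ln_sqprod_shift x y N : 0 < y -> 0 <= x ->
  Rabs (ln (sqprod x y (S N)) - ln (sqprod 0 y (S N)) - (ln (x ^ 2 + y ^ 2) - ln (y ^ 2))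
        - x * (ln ((INR N + 1) ^ 2 + y ^ 2) - ln (1 + y ^ 2)))
  <= 4 * (x ^ 2 + x).
Proof.
  intros Hy Hx. assert (Hy2 : 0 < y ^ 2) by now apply pow_lt.
  (* The factor 1 - 1/(N+1) makes the induction absorb the error O(1/k^2). *)
  enough (Rabs (ln (sqprod x y (S N)) - ln (sqprod 0 y (S N)) - (ln (x ^ 2 + y ^ 2) - ln (y ^ 2))
        - x * (ln ((INR N + 1) ^ 2 + y ^ 2) - ln (1 + y ^ 2)))
        <= 4 * (x ^ 2 + x) * (1 - / (INR N + 1))).
  { assert (0 < / (INR N + 1)) by (apply Rinv_0_lt_compat; pose proof (pos_INR N); lra).
    assert (0 <= x ^ 2 + x) by nra. nra. }
  induction N as [|N IH].
  - simpl INR. cbn [sqprod]. simpl INR. rewrite !Rmult_1_l, !Rplus_0_r, Rplus_0_l.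
    replace (0 ^ 2 + y ^ 2) with (y ^ 2) by ring. replace (1 ^ 2 + y ^ 2) with (1 + y ^ 2) by ring.
    replace (_ - _ - _) with 0 by ring. rewrite Rabs_R0, Rinv_1. lra.
  - change (sqprod x y (S (S N))) with (sqprod x y (S N) * ((x + INR (S N)) ^ 2 + y ^ 2)).
    change (sqprod 0 y (S (S N))) with (sqprod 0 y (S N) * ((0 + INR (S N)) ^ 2 + y ^ 2)).
    pose proof (sqprod_pos x y (S N) Hy). pose proof (sqprod_pos 0 y (S N) Hy).
    assert (HN := pos_INR N).
    rewrite S_INR in *. set (k := INR N + 1) in *. assert (Hk : 1 <= k) by (unfold k; lra).
    pose proof (pow2_ge_0 (x + k)). pose proof (pow2_ge_0 (0 + k)).
    rewrite !ln_mult by lra. rewrite Rplus_0_l in *.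
    assert (T1 := ln_sqr_taylor y k x Hy Hk Hx).
    assert (T2 := ln_sqr_taylor y k 1 Hy Hk ltac:(lra)).
    rewrite (Rplus_comm x k).
    set (A := ln (sqprod x y (S N)) - ln (sqprod 0 y (S N)) - (ln (x ^ 2 + y ^ 2) - ln (y ^ 2))
        - x * (ln (k ^ 2 + y ^ 2) - ln (1 + y ^ 2))) in *.
    set (U := ln ((k + x) ^ 2 + y ^ 2) - ln (k ^ 2 + y ^ 2) - x * (2 * k / (k ^ 2 + y ^ 2))) in *.
    set (V := ln ((k + 1) ^ 2 + y ^ 2) - ln (k ^ 2 + y ^ 2) - 1 * (2 * k / (k ^ 2 + y ^ 2))) in *.
    replace (ln (sqprod x y (S N)) + ln ((k + x) ^ 2 + y ^ 2) -
      (ln (sqprod 0 y (S N)) + ln (k ^ 2 + y ^ 2)) - (ln (x ^ 2 + y ^ 2) - ln (y ^ 2)) -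
      x * (ln ((k + 1) ^ 2 + y ^ 2) - ln (1 + y ^ 2))) with (A + (U + - (x * V)))
      by (unfold A, U, V; ring).
    eapply Rle_trans; [apply Rabs_triang|].
    assert (Rabs (U + - (x * V)) <= 2 * (x ^ 2 + x) / k ^ 2).
    { eapply Rle_trans; [apply Rabs_triang|].
      rewrite Rabs_Ropp, Rabs_mult, (Rabs_pos_eq x) by lra.
      replace (2 * (x ^ 2 + x) / k ^ 2) with (2 * x ^ 2 / k ^ 2 + x * (2 * 1 ^ 2 / k ^ 2))
        by (field; lra).
      apply Rplus_le_compat; [easy|]. now apply Rmult_le_compat_l. }
    assert (/ k ^ 2 <= 2 * (/ k - / (k + 1))).
    { replace (2 * (/ k - / (k + 1))) with (2 / (k * (k + 1))) by (field; lra).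
      apply (Rmult_le_reg_r (k ^ 2 * (k + 1))); [nra|].
      replace (/ k ^ 2 * (k ^ 2 * (k + 1))) with (k + 1) by (field; lra).
      replace (2 / (k * (k + 1)) * (k ^ 2 * (k + 1))) with (2 * k) by (field; lra). lra. }
    assert (2 * (x ^ 2 + x) / k ^ 2 <= 2 * (x ^ 2 + x) * (2 * (/ k - / (k + 1)))).
    { apply Rmult_le_compat_l; [nra|easy]. }
    lra.
Qed.

(** The duplication formula for Gamma at finite level:
    [k^2 + (2y)^2 = 4 ((k/2)^2 + y^2)], with even and odd [k] separated. *)
Lemma sqprod_duplication y N :
  sqprod 0 (2 * y) (2 * N + 2) = 16 ^ (N + 1) * (sqprod 0 y (S N) * sqprod (1 / 2) y (S N)).
Proof.
  induction N as [|N IH].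
  - simpl. field.
  - replace (2 * S N + 2)%nat with (S (S (2 * N + 2))) by lia.
    cbn [sqprod]. cbn [sqprod] in IH. rewrite IH.
    replace (S N + 1)%nat with (S (N + 1)) by lia.
    rewrite <- (tech_pow_Rmult 16 (N + 1)).
    rewrite !S_INR, !plus_INR, !mult_INR. simpl INR. field.
Qed.

(** Passing from [N] to [N + 1] requires
    [(N + 3/2)^2 (N + c) <= (N + 1)^2 (N + 1 + c)], which holds for [c = 3/4] but
    fails for [c = 1]. *)
Lemma central_factorial_bound N :
  INR (fact (2 * N + 1)) ^ 2 <= 4 / 3 * (INR N + 3 / 4) * 16 ^ N * INR (fact N) ^ 4.
Proof.
  induction N as [|N IH].
  - simpl. lra.
  - replace (2 * S N + 1)%nat with (S (S (2 * N + 1))) by lia.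
    change (fact (S (S (2 * N + 1)))) with (S (S (2 * N + 1)) * (S (2 * N + 1) * fact (2 * N + 1)))%nat.
    change (fact (S N)) with (S N * fact N)%nat.
    rewrite <- (tech_pow_Rmult 16 N).
    rewrite !mult_INR, !S_INR, plus_INR, mult_INR. simpl (INR 2). simpl (INR 1).
    set (F := INR (fact (2 * N + 1))) in *. set (G := INR (fact N)) in *.
    assert (Hn := pos_INR N). set (n := INR N) in *.
    replace (((1 + 1) * n + 1 + 1 + 1) * (((1 + 1) * n + 1 + 1) * F)) with
      ((2 * n + 3) * (2 * (n + 1)) * F) by ring.
    rewrite !Rpow_mult_distr.
    apply Rle_trans with (((2 * n + 3) ^ 2 * (2 ^ 2 * (n + 1) ^ 2)) *
        (4 / 3 * (n + 3 / 4) * 16 ^ N * G ^ 4)).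
    + apply Rmult_le_compat_l; [|easy].
      pose proof (pow2_ge_0 (2 * n + 3)). pose proof (pow2_ge_0 (n + 1)).
      apply Rmult_le_pos; lra.
    + assert (0 <= 16 ^ N * G ^ 4).
      { apply Rmult_le_pos; [apply pow_le; lra|]. apply pow_le. apply pos_INR. }
      replace (4 / 3 * (n + 1 + 3 / 4) * (16 * 16 ^ N) * ((n + 1) ^ 4 * G ^ 4))
        with (4 / 3 * 16 * ((n + 1) ^ 2 * ((n + 7 / 4) * (n + 1) ^ 2)) * (16 ^ N * G ^ 4)) by field.
      replace ((2 * n + 3) ^ 2 * (2 ^ 2 * (n + 1) ^ 2) * (4 / 3 * (n + 3 / 4) * 16 ^ N * G ^ 4))
        with (4 / 3 * 16 * ((n + 1) ^ 2 * ((n + 3 / 2) ^ 2 * (n + 3 / 4))) * (16 ^ N * G ^ 4)) by field.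
      apply Rmult_le_compat_r; [easy|]. apply Rmult_le_compat_l; [lra|].
      apply Rmult_le_compat_l; [apply pow2_ge_0|]. nra.
Qed.

Section Plancherel.
Variables al be : R.
Hypothesis Hal : -1/2 < al.
Hypothesis Hbe : -1/2 <= be.
Hypothesis Hab : be <= al.
Let x1 := (al + be + 1) / 2.
Let x2 := (al - be + 1) / 2.
Let th := al + 1 / 2.

(** The majorant of [|c(2 y)|^2], up to a constant: of order [y^(-2)] at 0 and
    [y^(- (2 al + 1))] at infinity. *)
Definition plancherel_bound (y : R) : R := (1 + / y ^ 2) * exp (- th * ln (1 + y ^ 2)).

Lemma sqprod_ratio_bound : exists K, 0 < K /\
  forall y N, 0 < y -> (1 <= N)%nat -> y <= INR N ->
    sqprod x1 y (S N) * sqprod x2 y (S N)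
    <= K * plancherel_bound y * exp (2 * th * ln (INR N))
       * (sqprod 0 y (S N) * sqprod (1 / 2) y (S N)).
Proof.
  set (B := 4 * (x1 ^ 2 + x1) + 4 * (x2 ^ 2 + x2) + 4 * ((1/2) ^ 2 + 1/2)).
  exists ((4 * x1 ^ 2 + 1) * (1 + x2 ^ 2) * exp (B + th * ln 8)).
  split.
  { pose proof (pow2_ge_0 x1). pose proof (pow2_ge_0 x2).
    apply Rmult_lt_0_compat; [apply Rmult_lt_0_compat; lra|apply exp_pos]. }
  intros y N Hy HN HyN. assert (Hy2 : 0 < y ^ 2) by now apply pow_lt.
  assert (HN1 : 1 <= INR N) by (apply (le_INR 1); lia).
  assert (A1 := ln_sqprod_shift x1 y N Hy ltac:(unfold x1; lra)).
  assert (A2 := ln_sqprod_shift x2 y N Hy ltac:(unfold x2; lra)).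
  assert (A3 := ln_sqprod_shift (1/2) y N Hy ltac:(lra)).
  assert (P1 := sqprod_pos x1 y (S N) Hy). assert (P2 := sqprod_pos x2 y (S N) Hy).
  assert (P0 := sqprod_pos 0 y (S N) Hy). assert (P3 := sqprod_pos (1/2) y (S N) Hy).
  set (S1 := sqprod x1 y (S N)) in *. set (S2 := sqprod x2 y (S N)) in *.
  set (S0 := sqprod 0 y (S N)) in *. set (S3 := sqprod (1/2) y (S N)) in *.
  apply Rabs_le_between in A1. apply Rabs_le_between in A2. apply Rabs_le_between in A3.
  pose proof (pow2_ge_0 x1). pose proof (pow2_ge_0 x2).
  assert (HT : ln ((INR N + 1) ^ 2 + y ^ 2) <= ln 8 + 2 * ln (INR N)).
  { replace (ln 8 + 2 * ln (INR N)) with (ln (8 * INR N ^ 2)).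
    - apply ln_le; nra.
    - rewrite ln_mult by nra. simpl. rewrite Rmult_1_r, ln_mult by lra. ring. }
  set (T := ln ((INR N + 1) ^ 2 + y ^ 2)) in *.
  assert (L1 : ln (x1 ^ 2 + y ^ 2) <= ln (4 * x1 ^ 2 + 1) + ln ((1/2) ^ 2 + y ^ 2)).
  { rewrite <- ln_mult by nra. apply ln_le; nra. }
  assert (L2 : ln (x2 ^ 2 + y ^ 2) <= ln (1 + x2 ^ 2) + ln (1 + / y ^ 2) + ln (y ^ 2)).
  { assert (0 < / y ^ 2) by now apply Rinv_0_lt_compat.
    rewrite <- !ln_mult by nra. apply ln_le; [nra|].
    replace ((1 + x2 ^ 2) * (1 + / y ^ 2) * y ^ 2) with (1 + y ^ 2 + x2 ^ 2 * y ^ 2 + x2 ^ 2)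
      by (field; lra). nra. }
  assert (Hth : 0 < th) by (unfold th; lra).
  assert (Hx12 : x1 + x2 = th + 1 / 2) by (unfold x1, x2, th; field).
  rewrite <- (exp_ln (S1 * S2)) by nra.
  rewrite <- (exp_ln (S0 * S3)) by nra.
  unfold plancherel_bound.
  rewrite <- (exp_ln (4 * x1 ^ 2 + 1)) by lra.
  rewrite <- (exp_ln (1 + x2 ^ 2)) by lra.
  assert (Hi : 0 < / y ^ 2) by now apply Rinv_0_lt_compat.
  rewrite <- (exp_ln (1 + / y ^ 2)) by lra.
  rewrite <- !exp_plus, !ln_mult by easy.
  assert (HTh : th * (T - ln (1 + y ^ 2)) <= th * (ln 8 + 2 * ln (INR N) - ln (1 + y ^ 2)))
    by (apply Rmult_le_compat_l; lra).
  set (Q := ln (1 + y ^ 2)) in *.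
  assert (HX : x1 * (T - Q) + x2 * (T - Q) = th * (T - Q) + 1 / 2 * (T - Q))
    by (rewrite <- Rmult_plus_distr_r, Hx12; ring).
  assert (HF : ln S1 + ln S2 <=
    ln (4 * x1 ^ 2 + 1) + ln (1 + x2 ^ 2) + (B + th * ln 8)
    + (ln (1 + / y ^ 2) + - th * Q) + 2 * th * ln (INR N) + (ln S0 + ln S3)).
  { unfold B. lra. }
  destruct HF as [HF|HF]; [left; now apply exp_increasing|rewrite HF; now right].
Qed.

Lemma not_pole_im x y : y <> 0 -> not_pole (x, y).
Proof. intros Hy n E. injection E. intros E1 _. rewrite Rplus_0_r in E1. easy. Qed.

(** The Gamma quotient of the c-function: by the duplication formula
    [Gamma(2iy)] behaves like [Gamma(iy) Gamma(1/2+iy)], and shifting the real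
    parts to [x1] and [x2] costs the factor [plancherel_bound].  The approximant of
    index [2N + 1] on the left is compared with those of index [N] on the right. *)
Lemma Gamma_quotient_bound : exists K, 0 < K /\ forall y, 0 < y ->
  Cmod (CGamma (0, 2 * y)) ^ 2
  <= K * plancherel_bound y * (Cmod (CGamma (x1, y)) ^ 2 * Cmod (CGamma (x2, y)) ^ 2).
Proof.
  destruct sqprod_ratio_bound as [K [HK HB]].
  exists K. split; [easy|]. intros y Hy.
  destruct (CGamma_limit (0, 2 * y)) as [_ L0]; [apply not_pole_im; lra|].
  destruct (CGamma_limit (x1, y)) as [_ L1]; [apply not_pole_im; lra|].
  destruct (CGamma_limit (x2, y)) as [_ L2]; [apply not_pole_im; lra|].
  assert (L0' : is_lim_seq (fun N => Cmod (Gamma_approx (0, 2 * y) (2 * N + 1)) ^ 2)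
                  (Cmod (CGamma (0, 2 * y)) ^ 2)).
  { apply (is_lim_seq_subseq (fun n => Cmod (Gamma_approx (0, 2 * y) n) ^ 2) _
             (fun N => (2 * N + 1)%nat)); [|easy].
    apply eventually_subseq. intros n. lia. }
  assert (L3 := is_lim_seq_scal_l _ (K * plancherel_bound y) _ (is_lim_seq_mult' _ _ _ _ L1 L2)).
  apply (fun H => is_lim_seq_le_loc _ _ _ _ H L0' L3).
  destruct (nfloor_ex y) as [k [_ Hk]]; [lra|].
  exists (k + 1)%nat. intros N HN.
  assert (HN1 : (1 <= N)%nat) by lia.
  assert (HyN : y <= INR N).
  { assert (INR (k + 1) <= INR N) by now apply le_INR. rewrite plus_INR in H. simpl in H. lra. }
  specialize (HB y N Hy HN1 HyN).
  rewrite !Cmod_Gamma_approx by (lra || lia).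
  replace (S (2 * N + 1)) with (2 * N + 2)%nat by lia.
  rewrite sqprod_duplication.
  assert (HF := central_factorial_bound N).
  assert (P1 := sqprod_pos x1 y (S N) Hy). assert (P2 := sqprod_pos x2 y (S N) Hy).
  assert (P0 := sqprod_pos 0 y (S N) Hy). assert (P3 := sqprod_pos (1/2) y (S N) Hy).
  set (S1 := sqprod x1 y (S N)) in *. set (S2 := sqprod x2 y (S N)) in *.
  set (S0 := sqprod 0 y (S N)) in *. set (S3 := sqprod (1/2) y (S N)) in *.
  assert (HNR : 1 <= INR N) by (apply (le_INR 1); lia).
  set (F := INR (fact (2 * N + 1))) in *. set (G := INR (fact N)) in *.
  assert (HG : 0 < G) by apply INR_fact_lt_0.
  replace (2 * 0 * ln (INR (2 * N + 1))) with 0 by ring. rewrite exp_0, Rmult_1_r.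
  assert (EE : exp (2 * x1 * ln (INR N)) * exp (2 * x2 * ln (INR N))
               = INR N * exp (2 * th * ln (INR N))).
  { rewrite <- (exp_ln (INR N)) at 3 by lra. rewrite <- !exp_plus. f_equal.
    unfold x1, x2, th. field. }
  set (E1 := exp (2 * x1 * ln (INR N))) in *. set (E2 := exp (2 * x2 * ln (INR N))) in *.
  set (E3 := exp (2 * th * ln (INR N))) in *.
  assert (HE3 : 0 < E3) by apply exp_pos.
  set (KQ := K * plancherel_bound y) in *.
  assert (H16 : 0 < 16 ^ N) by (apply pow_lt; lra).
  assert (HF' : F ^ 2 <= 16 ^ (N + 1) * INR N * G ^ 4).
  { rewrite pow_add. simpl (16 ^ 1). eapply Rle_trans; [exact HF|].
    assert (0 < G ^ 4) by now apply pow_lt.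
    replace (4 / 3 * (INR N + 3 / 4) * 16 ^ N * G ^ 4)
      with ((16 ^ N * G ^ 4) * (4 / 3 * (INR N + 3 / 4))) by ring.
    replace (16 ^ N * (16 * 1) * INR N * G ^ 4) with ((16 ^ N * G ^ 4) * (16 * INR N)) by ring.
    apply Rmult_le_compat_l; [|lra]. apply Rmult_le_pos; lra. }
  set (W := 16 ^ (N + 1)) in *. assert (HW : 0 < W) by (apply pow_lt; lra).
  assert (Hpos : 0 < S0 * S3) by now apply Rmult_lt_0_compat.
  assert (Hpos2 : 0 < S1 * S2) by now apply Rmult_lt_0_compat.
  apply (Rmult_le_reg_r (W * (S0 * S3) * (S1 * S2))).
  { apply Rmult_lt_0_compat; [apply Rmult_lt_0_compat|]; easy. }
  replace (F ^ 2 / (W * (S0 * S3)) * (W * (S0 * S3) * (S1 * S2))) with (F ^ 2 * (S1 * S2))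
    by (field; lra).
  replace (KQ * (G ^ 2 * E1 / S1 * (G ^ 2 * E2 / S2)) * (W * (S0 * S3) * (S1 * S2)))
    with ((E1 * E2) * KQ * G ^ 4 * W * (S0 * S3)) by (field; lra).
  rewrite EE.
  apply Rle_trans with (W * INR N * G ^ 4 * (S1 * S2)).
  { apply Rmult_le_compat_r; lra. }
  replace (INR N * E3 * KQ * G ^ 4 * W * (S0 * S3))
    with ((W * INR N * G ^ 4) * (KQ * E3 * (S0 * S3))) by ring.
  apply Rmult_le_compat_l; [|easy].
  apply Rmult_le_pos; [apply Rmult_le_pos; lra|]. apply pow_le. lra.
Qed.

Lemma n_weight_lower : exists k, 0 < k /\ forall lam, 0 < lam ->
  k <= n_weight al be lam * plancherel_bound (lam / 2).
Proof.
  destruct Gamma_quotient_bound as [K [HK HB]].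
  destruct (CGamma_limit (RtoC (al + 1))) as [HGa _].
  { intros n E. injection E. pose proof (pos_INR n). lra. }
  set (Ga := Cmod (CGamma (RtoC (al + 1)))).
  assert (HGa' : 0 < Ga) by now apply Cmod_gt_0.
  assert (Hpi : 0 < / sqrt (2 * PI)).
  { apply Rinv_0_lt_compat, sqrt_lt_R0. pose proof PI_RGT_0. lra. }
  set (W := (exp (rho al be * ln 2) * Ga) ^ 2).
  assert (HW : 0 < W) by (apply pow_lt, Rmult_lt_0_compat; [apply exp_pos|easy]).
  exists (/ sqrt (2 * PI) * / (W * K)). split.
  { apply Rmult_lt_0_compat; [easy|]. apply Rinv_0_lt_compat, Rmult_lt_0_compat; easy. }
  intros lam Hlam. set (y := lam / 2).
  assert (Hy : 0 < y) by (unfold y; lra).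
  specialize (HB y Hy).
  destruct (CGamma_limit (0, 2 * y)) as [N0 _]; [apply not_pole_im; lra|].
  destruct (CGamma_limit (x1, y)) as [N1 _]; [apply not_pole_im; lra|].
  destruct (CGamma_limit (x2, y)) as [N2 _]; [apply not_pole_im; lra|].
  assert (Q1 : ((RtoC (rho al be) + Ci * RtoC lam) / RtoC 2)%C = (x1, y)).
  { unfold x1, y, rho. apply injective_projections; simpl; field. }
  assert (Q2 : ((x1, y) - RtoC be)%C = (x2, y)).
  { unfold x1, x2. apply injective_projections; simpl; field. }
  assert (Q3 : (Ci * RtoC lam)%C = (0, 2 * y)).
  { unfold y. apply injective_projections; simpl; field. }
  assert (Ec : Cmod (c_function al be lam) ^ 2
     = W * Cmod (CGamma (0, 2 * y)) ^ 2 / (Cmod (CGamma (x1, y)) ^ 2 * Cmod (CGamma (x2, y)) ^ 2)).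
  { unfold c_function. rewrite Q1, Q2, Q3.
    rewrite Cmod_div by now apply Cmult_neq_0.
    rewrite !Cmod_mult. fold Ga. unfold Rpow_C. rewrite Cmod_Cexp.
    replace (Re ((RtoC (rho al be) - (0%R, (2 * y)%R)) * RtoC (ln 2))%C) with (rho al be * ln 2)
      by (simpl; ring).
    unfold W. apply Cmod_gt_0 in N1. apply Cmod_gt_0 in N2. field. lra. }
  unfold n_weight. rewrite Ec. fold y.
  apply Cmod_gt_0 in N0. apply Cmod_gt_0 in N1. apply Cmod_gt_0 in N2.
  set (G0 := Cmod (CGamma (0, 2 * y)) ^ 2) in *.
  set (G12 := Cmod (CGamma (x1, y)) ^ 2 * Cmod (CGamma (x2, y)) ^ 2) in *.
  assert (HG0 : 0 < G0) by now apply pow_lt.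
  assert (HG12 : 0 < G12) by (apply Rmult_lt_0_compat; now apply pow_lt).
  rewrite Rmult_assoc. apply Rmult_le_compat_l; [lra|].
  apply (Rmult_le_reg_r (W * K * G0));
    [apply Rmult_lt_0_compat; [apply Rmult_lt_0_compat|]; easy|].
  replace (/ (W * K) * (W * K * G0)) with G0 by (field; lra).
  replace (/ (W * G0 / G12) * plancherel_bound y * (W * K * G0))
    with (K * plancherel_bound y * G12) by (field; lra).
  easy.
Qed.

Lemma n_weight_lower_small : exists k, 0 < k /\
  forall lam, 0 < lam <= 1 -> k * lam ^ 2 <= n_weight al be lam.
Proof.
  destruct n_weight_lower as [k [Hk HB]].
  exists (k / 5). split; [lra|]. intros lam Hlam.
  specialize (HB lam ltac:(lra)). unfold plancherel_bound in HB.
  set (y := lam / 2) in *. assert (Hy : 0 < y <= 1 / 2) by (unfold y; lra).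
  assert (Hy2 : 0 < y ^ 2) by (apply pow_lt; lra).
  assert (He : exp (- th * ln (1 + y ^ 2)) <= 1).
  { apply Rle_trans with (exp 0); [|rewrite exp_0; lra].
    assert (0 < ln (1 + y ^ 2)) by (rewrite <- ln_1; apply ln_increasing; lra).
    assert (0 < th * ln (1 + y ^ 2)) by (apply Rmult_lt_0_compat; unfold th; lra).
    left. apply exp_increasing. lra. }
  assert (He0 := exp_pos (- th * ln (1 + y ^ 2))).
  set (e := exp (- th * ln (1 + y ^ 2))) in *.
  set (n := n_weight al be lam) in *.
  assert (Hi : / y ^ 2 * y ^ 2 = 1) by (apply Rinv_l; lra).
  assert (Hi0 : 0 < / y ^ 2) by now apply Rinv_0_lt_compat.
  assert (Hn : 0 < n).
  { apply Rnot_le_lt. intros Hn.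
    assert (n * ((1 + / y ^ 2) * e) <= 0); [|lra].
    assert (0 < (1 + / y ^ 2) * e) by (apply Rmult_lt_0_compat; lra). nra. }
  assert (k <= n * (1 + / y ^ 2)).
  { eapply Rle_trans; [exact HB|]. apply Rmult_le_compat_l; [lra|]. nra. }
  assert (k * y ^ 2 <= n * (1 + / y ^ 2) * y ^ 2) by (apply Rmult_le_compat_r; lra).
  replace (n * (1 + / y ^ 2) * y ^ 2) with (n * (y ^ 2 + / y ^ 2 * y ^ 2)) in H0 by ring.
  rewrite Hi in H0. assert (y ^ 2 <= 1 / 4) by nra.
  replace (lam ^ 2) with (4 * y ^ 2) by (unfold y; field). nra.
Qed.

Lemma n_weight_lower_large : exists k, 0 < k /\
  forall lam, 1 <= lam -> k * Rpower lam (2 * al + 1) <= n_weight al be lam.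
Proof.
  destruct n_weight_lower as [k [Hk HB]].
  set (c := Rpower 2 (2 * al + 1)). assert (Hc : 0 < c) by apply exp_pos.
  exists (k / 5 / c). split; [apply Rdiv_lt_0_compat; lra|]. intros lam Hlam.
  specialize (HB lam ltac:(lra)). unfold plancherel_bound in HB.
  set (y := lam / 2) in *. assert (Hy : 1 / 2 <= y) by (unfold y; lra).
  assert (Hy2 : 1 / 4 <= y ^ 2) by nra.
  set (P := Rpower y (2 * al + 1)). assert (HP : 0 < P) by apply exp_pos.
  assert (He : exp (- th * ln (1 + y ^ 2)) <= / P).
  { unfold P, Rpower. rewrite <- exp_Ropp.
    assert (Hl : 2 * ln y <= ln (1 + y ^ 2)).
    { replace (2 * ln y) with (ln (y ^ 2)) by (simpl; rewrite Rmult_1_r, ln_mult by lra; ring).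
      apply ln_le; lra. }
    assert (Ht : - th * ln (1 + y ^ 2) <= - ((2 * al + 1) * ln y)) by (unfold th; nra).
    destruct Ht as [Ht|Ht]; [left; now apply exp_increasing|rewrite Ht; lra]. }
  assert (He0 := exp_pos (- th * ln (1 + y ^ 2))).
  set (e := exp (- th * ln (1 + y ^ 2))) in *.
  set (n := n_weight al be lam) in *.
  assert (Hi0 : 0 < / y ^ 2) by (apply Rinv_0_lt_compat; lra).
  assert (Hi : / y ^ 2 <= 4).
  { replace 4 with (/ (1 / 4)) by field. apply Rinv_le_contravar; lra. }
  assert (Hn : 0 < n).
  { apply Rnot_le_lt. intros Hn.
    assert (n * ((1 + / y ^ 2) * e) <= 0); [|lra].
    assert (0 < (1 + / y ^ 2) * e) by (apply Rmult_lt_0_compat; lra). nra. }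
  assert (H5 : k <= n * (5 * / P)).
  { eapply Rle_trans; [exact HB|]. apply Rmult_le_compat_l; [lra|].
    apply Rmult_le_compat; lra. }
  assert (EP : Rpower lam (2 * al + 1) = P * c).
  { unfold P, c. rewrite Rpower_mult_distr by lra. f_equal. unfold y. field. }
  rewrite EP. replace (k / 5 / c * (P * c)) with (k * (P / 5)) by (field; lra).
  apply Rle_trans with (n * (5 * / P) * (P / 5)).
  - apply Rmult_le_compat_r; lra.
  - right. field. lra.
Qed.

End Plancherel.

(** * Test functions *)

(** [n]-fold differentiability as an explicit chain of derivatives, which is stable
    under products and affine substitutions by plain induction. *)
Fixpoint differentiable_n (n : nat) (f : R -> R) : Prop :=
  match n with
  | O => True
  | S k => exists f' : R -> R, (forall x, is_derive f x (f' x)) /\ differentiable_n k f'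
  end.

Lemma differentiable_n_pred n f : differentiable_n (S n) f -> differentiable_n n f.
Proof.
  revert f. induction n as [|n IH]; intros f [f' [Hf Hf']]; [easy|].
  exists f'. split; [easy|now apply IH].
Qed.

Lemma differentiable_n_ex_derive_n n f x : differentiable_n n f -> ex_derive_n f n x.
Proof.
  revert f x. destruct n as [|n]; [easy|].
  induction n as [|n IH]; intros f x [f' [Hf Hf']].
  - simpl. now exists (f' x).
  - apply (ex_derive_ext (Derive_n f' n)); [|now apply IH].
    intros t. replace (S n) with (n + 1)%nat by lia. rewrite <- Derive_n_comp.
    apply Derive_n_ext. intros s. symmetry. simpl.
    transitivity (Derive f s); [now apply Derive_ext|]. now apply is_derive_unique.
Qed.

Lemma differentiable_n_const n c : differentiable_n n (fun _ => c).
Proof.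
  revert c. induction n as [|n IH]; intros c; [easy|].
  exists (fun _ => 0). split; [|apply IH]. intros x. auto_derive; easy.
Qed.

Lemma differentiable_n_plus n f g :
  differentiable_n n f -> differentiable_n n g -> differentiable_n n (fun x => f x + g x).
Proof.
  revert f g. induction n as [|n IH]; intros f g; [easy|].
  intros [f' [Hf Hf']] [g' [Hg Hg']].
  exists (fun x => f' x + g' x). split; [|now apply IH].
  intros x. exact (is_derive_plus _ _ _ _ _ (Hf x) (Hg x)).
Qed.

Lemma differentiable_n_mult n f g :
  differentiable_n n f -> differentiable_n n g -> differentiable_n n (fun x => f x * g x).
Proof.
  revert f g. induction n as [|n IH]; intros f g; [easy|].
  intros Df Dg. assert (Df0 := differentiable_n_pred _ _ Df).
  assert (Dg0 := differentiable_n_pred _ _ Dg).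
  destruct Df as [f' [Hf Hf']]. destruct Dg as [g' [Hg Hg']].
  exists (fun x => f' x * g x + f x * g' x). split.
  - intros x. exact (is_derive_mult _ _ _ _ _ (Hf x) (Hg x) Rmult_comm).
  - apply differentiable_n_plus; now apply IH.
Qed.

Lemma differentiable_n_affine n f c d :
  differentiable_n n f -> differentiable_n n (fun x => f (c * x + d)).
Proof.
  revert f. induction n as [|n IH]; intros f; [easy|].
  intros [f' [Hf Hf']].
  exists (fun x => c * f' (c * x + d)). split.
  - intros x. assert (G := Hf (c * x + d)).
    auto_derive; [eexists; eassumption|]. rewrite_derive G. ring.
  - apply differentiable_n_mult; [apply differentiable_n_const|now apply IH].
Qed.

Lemma differentiable_n_quadratic_power n c r : 0 < c ->
  differentiable_n n (fun x => Rpower (x ^ 2 + c) r).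
Proof.
  intros Hc. revert r. induction n as [|n IH]; intros r; [easy|].
  exists (fun x => (2 * r) * ((1 * x + 0) * Rpower (x ^ 2 + c) (r - 1))). split.
  - intros x. pose proof (pow2_ge_0 x).
    replace (r - 1) with (r + - (1)) by ring.
    rewrite Rpower_plus, Rpower_Ropp, Rpower_1 by lra.
    unfold Rpower. auto_derive; [simpl in *; lra|].
    simpl. field. simpl in *. lra.
  - apply differentiable_n_mult; [apply differentiable_n_const|].
    apply differentiable_n_mult; [|apply IH].
    apply (differentiable_n_affine n (fun x => x)).
    destruct n as [|n]; [easy|]. exists (fun _ => 1).
    split; [|apply differentiable_n_const]. intros x. auto_derive; easy.
Qed.

(** [exp(-1/x) / x^m], extended by 0: the span of this family is closed under
    differentiation. *)
Definition flat (m : nat) (x : R) : R :=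
  if Rlt_dec 0 x then exp (- / x) * (/ x) ^ m else 0.

Lemma pow_le_exp k y : 0 < y -> y ^ k <= INR k ^ k * exp y.
Proof.
  intros Hy. destruct k as [|k].
  - simpl. pose proof (exp_ineq1_le y). lra.
  - set (n := S k). assert (Hn : 0 < INR n) by (apply lt_0_INR; unfold n; lia).
    replace (exp y) with (exp (y / INR n) ^ n).
    + rewrite <- Rpow_mult_distr. apply pow_incr. split; [lra|].
      pose proof (exp_ineq1_le (y / INR n)).
      assert (INR n * (y / INR n) = y) by (field; lra). nra.
    + rewrite <- Rpower_pow by apply exp_pos. unfold Rpower. rewrite ln_exp.
      f_equal. field. lra.
Qed.

(** The bound by [x^2] gives differentiability at 0 with derivative 0. *)
Lemma flat_quadratic m : exists K, 0 < K /\ forall x, Rabs (flat m x) <= K * x ^ 2.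
Proof.
  exists (INR (m + 2) ^ (m + 2) + 1).
  assert (H0 : 0 <= INR (m + 2) ^ (m + 2)) by (apply pow_le, pos_INR).
  split; [lra|]. intros x. pose proof (pow2_ge_0 x).
  unfold flat. destruct (Rlt_dec 0 x) as [Hx|Hx].
  - assert (Hi : 0 < / x) by now apply Rinv_0_lt_compat.
    assert (He := exp_pos (- / x)).
    assert (HP := pow_le_exp (m + 2) (/ x) Hi).
    assert (Hm : 0 < (/ x) ^ m) by now apply pow_lt.
    rewrite Rabs_pos_eq by nra.
    assert (E1 : exp (- / x) * exp (/ x) = 1).
    { rewrite <- exp_plus. replace (- / x + / x) with 0 by ring. apply exp_0. }
    assert (E2 : exp (- / x) * (/ x) ^ (m + 2) <= INR (m + 2) ^ (m + 2)).
    { apply Rle_trans with (exp (- / x) * (INR (m + 2) ^ (m + 2) * exp (/ x))).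
      - apply Rmult_le_compat_l; lra.
      - right. rewrite <- (Rmult_1_r (INR _ ^ _)) at 2. rewrite <- E1. ring. }
    replace (exp (- / x) * (/ x) ^ m) with (exp (- / x) * (/ x) ^ (m + 2) * x ^ 2)
      by (rewrite pow_add; field; lra).
    apply Rmult_le_compat_r; lra.
  - rewrite Rabs_R0. nra.
Qed.

Lemma flat_derive m x : is_derive (flat m) x (flat (m + 2) x + - INR m * flat (m + 1) x).
Proof.
  destruct (Rtotal_order 0 x) as [Hx|[<-|Hx]].
  - apply (is_derive_ext_loc (fun u => exp (- / u) * (/ u) ^ m)).
    + apply (locally_interval _ x 0 p_infty); [exact Hx|easy|].
      intros u Hu _. simpl in Hu. unfold flat. destruct (Rlt_dec 0 u); [easy|lra].
    + unfold flat. destruct (Rlt_dec 0 x); [|lra].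
      auto_derive; [repeat split; lra|].
      rewrite !pow_add. destruct m as [|m]; simpl; field; lra.
  - replace (flat (m + 2) 0 + - INR m * flat (m + 1) 0) with 0
      by (unfold flat; destruct (Rlt_dec 0 0); [lra|ring]).
    destruct (flat_quadratic m) as [K [HK HF]].
    apply is_derive_Reals. intros eps He.
    assert (Hd : 0 < eps / K) by now apply Rdiv_lt_0_compat.
    exists (mkposreal _ Hd). simpl. intros h Hh Hhd.
    assert (F0 : flat m 0 = 0) by (unfold flat; destruct (Rlt_dec 0 0); [lra|easy]).
    rewrite F0, Rplus_0_l, !Rminus_0_r. unfold Rdiv. rewrite Rabs_mult, Rabs_inv.
    assert (Hh0 : 0 < Rabs h) by now apply Rabs_pos_lt.
    apply (Rmult_lt_reg_r (Rabs h)); [easy|]. rewrite Rmult_assoc, Rinv_l, Rmult_1_r by lra.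
    eapply Rle_lt_trans; [apply HF|]. rewrite <- pow2_abs.
    replace (K * Rabs h ^ 2) with ((K * Rabs h) * Rabs h) by ring.
    apply Rmult_lt_compat_r; [easy|].
    apply (Rmult_lt_reg_r (/ K)); [now apply Rinv_0_lt_compat|].
    replace (K * Rabs h * / K) with (Rabs h) by (field; lra). exact Hhd.
  - apply (is_derive_ext_loc (fun _ => 0)).
    + apply (locally_interval _ x m_infty 0); [easy|exact Hx|].
      intros u _ Hu. simpl in Hu. unfold flat. destruct (Rlt_dec 0 u); [lra|easy].
    + unfold flat. destruct (Rlt_dec 0 x); [lra|].
      auto_derive; [easy|ring].
Qed.

Lemma differentiable_n_flat n m : differentiable_n n (flat m).
Proof.
  revert m. induction n as [|n IH]; intros m; [easy|].
  exists (fun x => flat (m + 2) x + - INR m * flat (m + 1) x).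
  split; [apply flat_derive|].
  apply differentiable_n_plus; [apply IH|].
  apply differentiable_n_mult; [apply differentiable_n_const|apply IH].
Qed.

Lemma flat_0_bounds x : 0 <= flat 0 x <= 1.
Proof.
  unfold flat. destruct (Rlt_dec 0 x) as [Hx|]; [|lra].
  simpl. rewrite Rmult_1_r. split; [left; apply exp_pos|].
  rewrite <- exp_0. left. apply exp_increasing.
  assert (0 < / x) by now apply Rinv_0_lt_compat. lra.
Qed.

Lemma flat_0_plateau x : 1 <= x -> exp (-1) <= flat 0 x.
Proof.
  intros Hx. unfold flat. destruct (Rlt_dec 0 x); [|lra]. simpl. rewrite Rmult_1_r.
  assert (/ x <= 1) by (rewrite <- Rinv_1; apply Rinv_le_contravar; lra).
  assert (H' : -1 <= - / x) by lra.
  destruct H' as [H'|H']; [left; now apply exp_increasing|rewrite H'; lra].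
Qed.

Lemma flat_nonpos m x : x <= 0 -> flat m x = 0.
Proof. intros Hx. unfold flat. destruct (Rlt_dec 0 x); [lra|easy]. Qed.

(** A smooth function comparable to [t^s] on [[2a, b]] and supported in [[a, 2b]];
    the factor [(t^2 + a^2)^(s/2)] stands for [t^s] because it is smooth at 0. *)
Definition bump (a b s t : R) : R :=
  Rpower (t ^ 2 + a ^ 2) (s / 2) * (flat 0 (/ a * t + - 1) * flat 0 (- / b * t + 2)).

Lemma differentiable_n_bump n a b s : 0 < a -> differentiable_n n (bump a b s).
Proof.
  intros Ha. unfold bump. apply differentiable_n_mult.
  - apply differentiable_n_quadratic_power. now apply pow_lt.
  - apply differentiable_n_mult;
      apply (differentiable_n_affine n (flat 0)); apply differentiable_n_flat.
Qed.

Lemma bump_zero a b s t : 0 < a -> 0 < b -> t <= a \/ 2 * b <= t -> bump a b s t = 0.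
Proof.
  intros Ha Hb Ht. unfold bump.
  assert (Hia : / a * a = 1) by (apply Rinv_l; lra).
  assert (Hib : / b * b = 1) by (apply Rinv_l; lra).
  assert (Hia0 : 0 < / a) by now apply Rinv_0_lt_compat.
  assert (Hib0 : 0 < / b) by now apply Rinv_0_lt_compat.
  destruct Ht as [Ht|Ht].
  - rewrite (flat_nonpos 0 (/ a * t + - 1)); [ring|]. nra.
  - rewrite (flat_nonpos 0 (- / b * t + 2)); [ring|]. nra.
Qed.

Lemma bump_nonneg a b s t : 0 <= bump a b s t.
Proof.
  unfold bump. destruct (flat_0_bounds (/ a * t + - 1)). destruct (flat_0_bounds (- / b * t + 2)).
  apply Rmult_le_pos; [left; apply exp_pos|]. now apply Rmult_le_pos.
Qed.

Lemma bump_test_function a b s : 0 < a -> a < 2 * b ->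
  test_function (fun t => RtoC (bump a b s t)).
Proof.
  intros Ha Hb. split; [|split].
  - intros n t. simpl. apply (differentiable_n_ex_derive_n n (bump a b s)).
    now apply differentiable_n_bump.
  - intros n t. simpl. apply (differentiable_n_ex_derive_n n (fun _ => 0)).
    apply differentiable_n_const.
  - exists a, (2 * b). split; [easy|split; [easy|]]. intros t Ht.
    apply NNPP. intros Hn. apply Ht. rewrite bump_zero; [easy|easy|lra|].
    destruct (Rle_dec t a); [now left|]. right. lra.
Qed.

Lemma bump_continuous a b s t : 0 < a -> continuous (bump a b s) t.
Proof.
  intros Ha. destruct (differentiable_n_bump 1 a b s Ha) as [f' [Hf _]].
  exact (is_derive_continuous _ _ _ (Hf t)).
Qed.

(** * Comparison of powers *)

Lemma Rpower_pos x y : 0 < Rpower x y.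
Proof. apply exp_pos. Qed.

(** The constant does not depend on the sign of [r]. *)
Lemma Rpower_comparable c u z r : 0 < c <= 1 -> 0 < u -> c * u <= z <= u / c ->
  Rpower c (Rabs r) * Rpower u r <= Rpower z r.
Proof.
  intros Hc Hu Hz. unfold Rpower. rewrite <- exp_plus.
  assert (H0 : 0 < c * u) by now apply Rmult_lt_0_compat.
  assert (L1 : ln c + ln u <= ln z) by (rewrite <- ln_mult by lra; apply ln_le; lra).
  assert (L2 : ln z <= ln u - ln c) by (rewrite <- ln_div by lra; apply ln_le; lra).
  assert (Rabs (ln z - ln u) <= - ln c) by (apply Rabs_le; lra).
  assert (Rabs (r * (ln z - ln u)) <= Rabs r * - ln c).
  { rewrite Rabs_mult. apply Rmult_le_compat_l; [apply Rabs_pos|easy]. }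
  apply Rabs_le_between in H1.
  assert (H2 : Rabs r * ln c + r * ln u <= r * ln z) by lra.
  destruct H2 as [H2|H2]; [left; now apply exp_increasing|rewrite H2; lra].
Qed.

Lemma Rpower_sqr t r : 0 < t -> Rpower (t ^ 2) (r / 2) = Rpower t r.
Proof.
  intros Ht. unfold Rpower. f_equal. simpl. rewrite Rmult_1_r, ln_mult by lra. field.
Qed.

(** * Size of the test functions *)

Lemma bump_upper a b s t : 0 < a <= t ->
  bump a b s t <= / Rpower (1 / 2) (Rabs (s / 2)) * Rpower t s.
Proof.
  intros Hat. unfold bump.
  destruct (flat_0_bounds (/ a * t + - 1)) as [A1 A2].
  destruct (flat_0_bounds (- / b * t + 2)) as [B1 B2].
  assert (HQ : Rpower (1 / 2) (Rabs (s / 2)) * Rpower (t ^ 2 + a ^ 2) (s / 2) <= Rpower (t ^ 2) (s / 2)).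
  { apply Rpower_comparable; [lra|nra|]. assert (a ^ 2 <= t ^ 2) by (apply pow_incr; lra).
    pose proof (pow2_ge_0 a). lra. }
  rewrite Rpower_sqr in HQ by lra.
  assert (Hc := Rpower_pos (1 / 2) (Rabs (s / 2))).
  set (c := Rpower (1 / 2) (Rabs (s / 2))) in *.
  assert (HP := Rpower_pos (t ^ 2 + a ^ 2) (s / 2)).
  set (P := Rpower (t ^ 2 + a ^ 2) (s / 2)) in *.
  apply Rle_trans with P.
  - rewrite <- (Rmult_1_r P) at 2. apply Rmult_le_compat_l; [lra|]. nra.
  - apply (Rmult_le_reg_l c); [easy|]. rewrite <- Rmult_assoc, Rinv_r, Rmult_1_l by lra. easy.
Qed.

Lemma bump_lower a b s t : 0 < a -> 2 * a <= t <= b ->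
  Rpower (1 / 2) (Rabs (s / 2)) * exp (-1) ^ 2 * Rpower t s <= bump a b s t.
Proof.
  intros Ha Hat. unfold bump.
  assert (Hia : / a * a = 1) by (apply Rinv_l; lra).
  assert (Hib : / b * b = 1) by (apply Rinv_l; lra).
  assert (Hia0 : 0 < / a) by (apply Rinv_0_lt_compat; lra).
  assert (Hib0 : 0 < / b) by (apply Rinv_0_lt_compat; lra).
  assert (A1 := flat_0_plateau (/ a * t + - 1) ltac:(nra)).
  assert (B1 := flat_0_plateau (- / b * t + 2) ltac:(nra)).
  assert (HQ : Rpower (1 / 2) (Rabs (s / 2)) * Rpower (t ^ 2) (s / 2) <= Rpower (t ^ 2 + a ^ 2) (s / 2)).
  { apply Rpower_comparable; [lra|nra|]. assert (a ^ 2 <= t ^ 2) by (apply pow_incr; lra).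
    pose proof (pow2_ge_0 a). lra. }
  rewrite Rpower_sqr in HQ by lra.
  assert (He := exp_pos (-1)).
  assert (Hc := Rpower_pos (1 / 2) (Rabs (s / 2))).
  assert (HP := Rpower_pos t s).
  replace (Rpower (1 / 2) (Rabs (s / 2)) * exp (-1) ^ 2 * Rpower t s)
    with (Rpower (1 / 2) (Rabs (s / 2)) * Rpower t s * (exp (-1) * exp (-1))) by ring.
  apply Rmult_le_compat; [nra|nra|easy|].
  apply Rmult_le_compat; lra.
Qed.

(** * Improper integrals *)

Lemma RInt_le_RInt_gen (h g : R -> R) (I l1 l2 : R) :
  0 < l1 < l2 -> is_RInt_gen g (at_right 0) (Rbar_locally p_infty) I ->
  (forall x, 0 < x -> 0 <= g x) -> ex_RInt h l1 l2 ->
  (forall x, l1 < x < l2 -> h x <= g x) -> RInt h l1 l2 <= I.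
Proof.
  intros Hl HI Hg Hh Hle. apply Rnot_lt_le. intros Hlt.
  assert (He : 0 < RInt h l1 l2 - I) by lra.
  destruct (HI (ball I (mkposreal _ He)) (locally_ball I (mkposreal _ He)))
    as [Qa Qb [d Hd] [M HM] HQ].
  set (a := Rmin (d / 2) (l1 / 2)).
  assert (Hd0 := cond_pos d).
  assert (Ha : 0 < a /\ a < d /\ a < l1).
  { pose proof (Rmin_l (d / 2) (l1 / 2)). pose proof (Rmin_r (d / 2) (l1 / 2)).
    assert (0 < a) by (apply Rmin_pos; lra). unfold a in *. lra. }
  set (b := Rmax (M + 1) (l2 + 1)).
  assert (Hb : M < b /\ l2 < b).
  { pose proof (Rmax_l (M + 1) (l2 + 1)). pose proof (Rmax_r (M + 1) (l2 + 1)).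
    unfold b. lra. }
  destruct (HQ a b) as [y [Hy1 Hy2]].
  - apply Hd; [|lra]. change (Rabs (a - 0) < d). rewrite Rminus_0_r, Rabs_pos_eq; lra.
  - apply HM. lra.
  - simpl in Hy1. change (Rabs (y - I) < RInt h l1 l2 - I) in Hy2. apply Rabs_def2 in Hy2.
    assert (X0 : ex_RInt g a b) by now exists y.
    assert (X1 : ex_RInt g a l2) by (apply (ex_RInt_Chasles_1 g a l2 b); [lra|easy]).
    assert (X2 : ex_RInt g l2 b) by (apply (ex_RInt_Chasles_2 g a l2 b); [lra|easy]).
    assert (X3 : ex_RInt g a l1) by (apply (ex_RInt_Chasles_1 g a l1 l2); [lra|easy]).
    assert (X4 : ex_RInt g l1 l2) by (apply (ex_RInt_Chasles_2 g a l1 l2); [lra|easy]).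
    assert (E1 := RInt_Chasles g a l1 l2 X3 X4). assert (E2 := RInt_Chasles g a l2 b X1 X2).
    assert (E3 := is_RInt_unique (V := R_CompleteNormedModule) _ _ _ _ Hy1). rewrite E3 in E2.
    assert (C1 : 0 <= RInt g a l1) by (apply RInt_ge_0; [lra|easy|intros; apply Hg; lra]).
    assert (C2 : 0 <= RInt g l2 b) by (apply RInt_ge_0; [lra|easy|intros; apply Hg; lra]).
    assert (C3 : RInt h l1 l2 <= RInt g l1 l2) by (apply RInt_le; [lra|easy|easy|easy]).
    unfold plus in E1, E2; simpl in E1, E2. lra.
Qed.

Lemma is_RInt_gen_compact {V : NormedModule R_AbsRing} (f : R -> V) (a b : R) (I : V) :
  0 < a < b -> (forall x, x < a \/ b < x -> f x = zero) -> is_RInt f a b I ->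
  is_RInt_gen f (at_right 0) (Rbar_locally p_infty) I.
Proof.
  intros Hab Hf HI P HP.
  assert (Ha : 0 < a) by lra.
  assert (Z : forall u v, u <= v -> (forall x, u < x < v -> x < a \/ b < x) -> is_RInt f u v zero).
  { intros u v Huv Hx. apply (is_RInt_ext (fun _ => zero)).
    - rewrite Rmin_left, Rmax_right by easy. intros x Hx'. symmetry. now apply Hf, Hx.
    - evar_last; [apply is_RInt_const|
        exact (scal_zero_r (V := NormedModule.ModuleSpace R_AbsRing V) (v - u))]. }
  apply (Filter_prod _ _ _ (fun u => 0 < u < a) (fun v => b < v)).
  - exists (mkposreal a Ha). intros u Hu Hu0. change (Rabs (u - 0) < a) in Hu.
    rewrite Rminus_0_r in Hu. apply Rabs_def2 in Hu. lra.
  - now exists b.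
  - intros u v Hu Hv. exists I. split; [|now apply locally_singleton].
    assert (Z1 : is_RInt f u a zero) by (apply Z; [lra|]; intros x Hx; left; lra).
    assert (Z2 : is_RInt f b v zero) by (apply Z; [lra|]; intros x Hx; right; lra).
    evar_last; [exact (is_RInt_Chasles f u b v _ _ (is_RInt_Chasles f u a b _ _ Z1 HI) Z2)|].
    rewrite (plus_zero_r (G := NormedModule.AbelianMonoid R_AbsRing V)).
    apply (plus_zero_l (G := NormedModule.AbelianMonoid R_AbsRing V)).
Qed.

Lemma is_RInt_RtoC (h : R -> R) (a b X : R) :
  is_RInt h a b X -> @is_RInt C_R_NormedModule (fun t => RtoC (h t)) a b (RtoC X).
Proof.
  intros H.
  apply (is_RInt_fct_extend_pair (U := R_NormedModule) (V := R_NormedModule)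
           (fun t => RtoC (h t)) a b X 0); simpl; [exact H|].
  assert (Z := is_RInt_const (V := R_NormedModule) a b 0).
  now rewrite (scal_zero_r (V := R_NormedModule)) in Z.
Qed.

Lemma RInt_gen_RtoC (F : R -> C) (h : R -> R) (a b : R) :
  0 < a < b -> (forall t, F t = RtoC (h t)) ->
  (forall x, x < a \/ b < x -> h x = 0) -> ex_RInt h a b ->
  @RInt_gen C_R_CompleteNormedModule F (at_right 0) (Rbar_locally p_infty)
  = RtoC (RInt h a b).
Proof.
  intros Hab HF Hh HI.
  apply (is_RInt_gen_unique (V := C_R_CompleteNormedModule)).
  apply (is_RInt_gen_compact (V := C_R_NormedModule) _ a b); [easy| |].
  - intros x Hx. rewrite HF. now rewrite Hh.
  - apply (is_RInt_ext (fun t => RtoC (h t))); [intros; now rewrite HF|].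
    apply is_RInt_RtoC. now apply (RInt_correct (V := R_CompleteNormedModule)).
Qed.

Lemma RInt_gen_le (g h : R -> R) (I J : R) :
  is_RInt_gen g (at_right 0) (Rbar_locally p_infty) I ->
  is_RInt_gen h (at_right 0) (Rbar_locally p_infty) J ->
  (forall t, 0 < t -> 0 <= g t <= h t) -> 0 <= I <= J.
Proof.
  intros HI HJ Hgh. split.
  - assert (H := RInt_le_RInt_gen (fun _ => 0) g I 1 2 ltac:(lra) HI).
    rewrite RInt_const in H. unfold scal in H; simpl in H; unfold mult in H; simpl in H.
    rewrite Rmult_0_r in H. apply H.
    + intros x Hx. now apply Hgh.
    + apply ex_RInt_const.
    + intros x Hx. apply Hgh. lra.
  - apply Rle_trans with (Rabs I); [apply Rle_abs|].
    assert (HF : forall P : R * R -> Prop, (forall u v, 0 < u < 1 -> 1 < v -> P (u, v)) ->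
       filter_prod (at_right 0) (Rbar_locally p_infty) P).
    { intros P HP. apply (Filter_prod _ _ _ (fun u => 0 < u < 1) (fun v => 1 < v)); [| |easy].
      - exists (mkposreal 1 Rlt_0_1). intros u Hu Hu0. change (Rabs (u - 0) < 1) in Hu.
        rewrite Rminus_0_r in Hu. apply Rabs_def2 in Hu. lra.
      - now exists 1. }
    apply (RInt_gen_norm (V := R_CompleteNormedModule) (Fa := at_right 0)
      (Fb := Rbar_locally p_infty) g h I J); [| |exact HI|exact HJ].
    + apply HF. intros u v Hu Hv. simpl. lra.
    + apply HF. intros u v Hu Hv x Hx. simpl in Hx. change (Rabs (g x) <= h x).
      rewrite Rabs_pos_eq; apply Hgh; lra.
Qed.

Lemma RInt_scal_R (f : R -> R) (a b k : R) :
  ex_RInt f a b -> RInt (fun t => k * f t) a b = k * RInt f a b.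
Proof. exact (RInt_scal (V := R_CompleteNormedModule) f a b k). Qed.

Lemma rpow_pos_base x y : 0 < x -> rpow x y = Rpower x y.
Proof. intros Hx. unfold rpow. destruct (Req_EM_T x 0); [lra|easy]. Qed.

Lemma rpow_0 y : rpow 0 y = 0.
Proof. unfold rpow. destruct (Req_EM_T 0 0); [easy|lra]. Qed.

Lemma rpow_nonneg x y : 0 <= rpow x y.
Proof. unfold rpow. destruct (Req_EM_T x 0); [lra|left; apply Rpower_pos]. Qed.

Lemma rpow_le x z y : 0 <= y -> 0 <= x <= z -> 0 < z -> rpow x y <= Rpower z y.
Proof.
  intros Hy Hx Hz. unfold rpow. destruct (Req_EM_T x 0) as [->|Hne].
  - left. apply Rpower_pos.
  - apply Rle_Rpower_l; lra.
Qed.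

Lemma Rpower_continuous r t : 0 < t -> continuous (fun t => Rpower t r) t.
Proof.
  intros Ht. apply (ex_derive_continuous (V := R_NormedModule)).
  unfold Rpower. auto_derive. lra.
Qed.

Lemma ex_RInt_continuous_pos (f : R -> R) a b :
  0 < a <= b -> (forall t, 0 < t -> continuous f t) -> ex_RInt f a b.
Proof.
  intros Hab Hf. apply (ex_RInt_continuous (V := R_CompleteNormedModule)).
  intros t Ht. rewrite Rmin_left in Ht by lra. apply Hf. lra.
Qed.

(** * The main inequality *)

(** The integrals of [t^(-kappa p') m~] and of [(lam^2 + zeta^2)^(-sigma q/2) n] are
    replaced by those of arbitrary integrable minorants [Y] and [N]: the
    minorants used below are explicit functions with elementary integrals. *)
Definition product_inequality (al be zeta p q kappa sigma K' : R) : Prop :=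
  forall (a b l1 l2 : R) (Y N : R -> R),
  0 < a -> 2 * a < b -> 0 < l1 < l2 -> l2 <= / (4 * b) ->
  ex_RInt Y (2 * a) b -> ex_RInt N l1 l2 ->
  (forall t, 2 * a < t < b ->
     Y t <= Rpower t (- (kappa * (p / (p - 1)))) * m_tilde al be t) ->
  (forall lam, l1 < lam < l2 ->
     N lam <= Rpower (lam ^ 2 + zeta ^ 2) (- (sigma / 2) * q) * n_weight al be lam) ->
  0 < RInt Y (2 * a) b -> 0 < RInt N l1 l2 ->
  Rpower (RInt Y (2 * a) b) (1 - 1 / p) * Rpower (RInt N l1 l2) (1 / q) <= K'.

Section MainInequality.
Variables al be zeta p q kappa sigma : R.
Hypothesis Hbe : -1/2 <= be.
Hypothesis Hab : be <= al.
Hypothesis Hal : -1/2 < al.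
Hypothesis Hp : 1 < p.
Hypothesis Hq : 1 < q.
Hypothesis Hineq : exists K : R, forall f : R -> C, test_function f ->
     exists A B : R,
       is_weighted_norm (n_weight al be) q
         (jacobi_transform al be zeta kappa sigma f) A /\
       is_weighted_norm (m_tilde al be) p f B /\
       A <= K * B.

(* The Hoelder-extremal exponent: s (p - 1) = - kappa and s - kappa = - kappa p'. *)
Let s := - (kappa / (p - 1)).
Let cs := Rpower (1 / 2) (Rabs (s / 2)).

(** The integrand of the transform of [bump a b s] with [phi~_lam] replaced by 1. *)
Definition pairing (a b t : R) : R := Rpower t (- kappa) * bump a b s t * m_tilde al be t.

Lemma pairing_continuous a b t : 0 < a -> 0 < t -> continuous (pairing a b) t.
Proof.
  intros Ha Ht. unfold pairing.
  apply (continuous_mult (fun t => Rpower t (- kappa) * bump a b s t) (m_tilde al be)).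
  - apply (continuous_mult (fun t => Rpower t (- kappa)) (bump a b s)).
    + now apply Rpower_continuous.
    + now apply bump_continuous.
  - now apply m_tilde_continuous.
Qed.

Lemma pairing_nonneg a b t : 0 < t -> 0 <= pairing a b t.
Proof.
  intros Ht. unfold pairing. apply Rmult_le_pos; [apply Rmult_le_pos|].
  - left. apply Rpower_pos.
  - apply bump_nonneg.
  - left. now apply m_tilde_pos.
Qed.

Lemma pairing_zero a b t : 0 < a -> 0 < b -> t < a \/ 2 * b < t -> pairing a b t = 0.
Proof.
  intros Ha Hb Ht. unfold pairing. rewrite bump_zero; [ring|easy|easy|]. lra.
Qed.

(** On the support of the test function [lam t <= 1/2], so [phi~_lam >= 1/2]. *)
Lemma transform_lower a b lam : 0 < a -> 2 * a < b -> 0 < lam <= / (4 * b) ->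
  Rpower (lam ^ 2 + zeta ^ 2) (- (sigma / 2)) * (RInt (pairing a b) a (2 * b) / 2)
  <= Cmod (jacobi_transform al be zeta kappa sigma (fun t => RtoC (bump a b s t)) lam).
Proof.
  intros Ha Hb Hlam.
  assert (Hlb : lam * (4 * b) <= 1).
  { replace 1 with (/ (4 * b) * (4 * b)) by (field; lra). apply Rmult_le_compat_r; lra. }
  set (h := fun t => Rpower t (- kappa) * bump a b s t * jacobi_tilde al be lam t * m_tilde al be t).
  assert (Hh : forall t, h t = pairing a b t * jacobi_tilde al be lam t).
  { intros t. unfold h, pairing. ring. }
  assert (Hhc : ex_RInt h a (2 * b)).
  { apply ex_RInt_continuous_pos; [lra|]. intros t Ht.
    apply (continuous_ext (fun t => pairing a b t * jacobi_tilde al be lam t)).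
    { intros u. now rewrite Hh. }
    apply (continuous_mult (pairing a b) (jacobi_tilde al be lam)).
    - now apply pairing_continuous.
    - apply jacobi_tilde_continuous; auto. lra. }
  assert (HX : RInt (pairing a b) a (2 * b) / 2 <= RInt h a (2 * b)).
  { assert (Hpc : ex_RInt (pairing a b) a (2 * b)).
    { apply ex_RInt_continuous_pos; [lra|]. intros t Ht. now apply pairing_continuous. }
    replace (RInt (pairing a b) a (2 * b) / 2) with (RInt (fun t => / 2 * pairing a b t) a (2 * b)).
    - apply RInt_le; [lra| |easy|].
      + now apply (ex_RInt_scal (V := R_NormedModule)).
      + intros t Ht. rewrite Hh, Rmult_comm. apply Rmult_le_compat_l; [apply pairing_nonneg; lra|].
        eapply Rle_trans; [|apply jacobi_tilde_ge; auto; lra].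
        assert (lam * t <= lam * (2 * b)) by (apply Rmult_le_compat_l; lra). lra.
    - rewrite (RInt_scal_R (pairing a b)) by easy. apply Rmult_comm. }
  unfold jacobi_transform.
  rewrite (RInt_gen_RtoC _ h a (2 * b)); [|lra| | |easy].
  - rewrite Cmod_mult, !Cmod_R, (Rabs_pos_eq (Rpower _ _)) by (left; apply Rpower_pos).
    apply Rmult_le_compat_l; [left; apply Rpower_pos|].
    eapply Rle_trans; [exact HX|apply Rle_abs].
  - intros t. unfold h. now rewrite !RtoC_mult.
  - intros t Ht. rewrite Hh, pairing_zero; [ring|easy|lra|easy].
Qed.

Lemma pairing_RInt_gen a b : 0 < a -> 2 * a < b ->
  is_RInt_gen (pairing a b) (at_right 0) (Rbar_locally p_infty) (RInt (pairing a b) a (2 * b)).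
Proof.
  intros Ha Hb. apply (is_RInt_gen_compact (V := R_NormedModule) _ a (2 * b)); [lra| |].
  - intros t Ht. apply pairing_zero; lra.
  - apply (RInt_correct (V := R_CompleteNormedModule)).
    apply ex_RInt_continuous_pos; [lra|]. intros t Ht. now apply pairing_continuous.
Qed.

(** [f^(p-1)] is at most a constant times [t^(s (p-1)) = t^(-kappa)], so [f^p] is
    dominated by [t^(-kappa) f]. *)
Lemma bump_norm_upper a b : 0 < a -> 2 * a < b -> forall B,
  is_weighted_norm (m_tilde al be) p (fun t => RtoC (bump a b s t)) B ->
  0 < RInt (pairing a b) a (2 * b) ->
  0 <= B <= Rpower (Rpower (/ cs) (p - 1) * RInt (pairing a b) a (2 * b)) (1 / p).
Proof.
  intros Ha Hb B [I [HI HB]] HX.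
  set (X := RInt (pairing a b) a (2 * b)) in *.
  set (D := Rpower (/ cs) (p - 1)).
  assert (HD : 0 < D) by apply Rpower_pos.
  assert (Hcs : 0 < cs) by apply Rpower_pos.
  set (g := fun t => rpow (bump a b s t) p * m_tilde al be t).
  assert (Hg : forall t, 0 < t -> 0 <= g t <= D * pairing a b t).
  { intros t Ht. assert (Hm := m_tilde_pos al be Hal Hbe Hab t Ht).
    unfold g. split; [apply Rmult_le_pos; [apply rpow_nonneg|lra]|].
    unfold pairing. rewrite <- Rmult_assoc. apply Rmult_le_compat_r; [lra|].
    destruct (bump_nonneg a b s t) as [Hpos|Hz].
    - rewrite rpow_pos_base by easy.
      assert (Hta : a <= t).
      { apply Rnot_lt_le. intros Hlt. rewrite bump_zero in Hpos; lra. }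
      assert (HU := bump_upper a b s t ltac:(lra)). fold cs in HU.
      set (f := bump a b s t) in *.
      replace p with ((p - 1) + 1) at 1 by ring.
      rewrite Rpower_plus, Rpower_1 by easy.
      rewrite <- Rmult_assoc. apply Rmult_le_compat_r; [lra|].
      apply Rle_trans with (Rpower (/ cs * Rpower t s) (p - 1)).
      { apply Rle_Rpower_l; lra. }
      rewrite <- Rpower_mult_distr; [|now apply Rinv_0_lt_compat|apply Rpower_pos].
      right. unfold D. f_equal. rewrite Rpower_mult. f_equal. unfold s. field. lra.
    - rewrite <- Hz, rpow_0. lra. }
  assert (HI' : is_RInt_gen g (at_right 0) (Rbar_locally p_infty) I).
  { revert HI. apply is_RInt_gen_ext. apply filter_forall. intros uv t _. unfold g.
    rewrite Cmod_R, Rabs_pos_eq; [easy|apply bump_nonneg]. }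
  assert (HJ := is_RInt_gen_scal _ D _ (pairing_RInt_gen a b Ha Hb)).
  destruct (RInt_gen_le _ _ _ _ HI' HJ Hg) as [I0 I1].
  unfold scal in I1; simpl in I1; unfold mult in I1; simpl in I1. fold X in I1.
  rewrite HB. split; [apply rpow_nonneg|].
  apply rpow_le; [|lra|now apply Rmult_lt_0_compat].
  left. apply Rdiv_lt_0_compat; lra.
Qed.

(** The test function [f = bump a b s] gives
    [X/2 * N^(1/q) <= |K| (D X)^(1/p)] with [X >= c Y]; divide by [X^(1/p)]. *)
Lemma main_inequality : exists K',
  product_inequality al be zeta p q kappa sigma K'.
Proof.
  destruct Hineq as [K HK].
  set (c := cs * exp (-1) ^ 2). set (D := Rpower (/ cs) (p - 1)).
  assert (Hcs : 0 < cs) by apply Rpower_pos.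
  assert (Hc : 0 < c) by (apply Rmult_lt_0_compat; [easy|apply pow_lt, exp_pos]).
  assert (HD : 0 < D) by apply Rpower_pos.
  exists (2 * Rabs K * Rpower D (1 / p) / Rpower c (1 - 1 / p)).
  intros a b l1 l2 Y N Ha Hb Hl Hl2 HYi HNi HY HN HY0 HN0.
  set (Y0 := RInt Y (2 * a) b) in *. set (N0 := RInt N l1 l2) in *.
  set (X := RInt (pairing a b) a (2 * b)).
  assert (HXY : c * Y0 <= X).
  { assert (H := RInt_le_RInt_gen (fun t => c * Y t) (pairing a b) X (2 * a) b
                   ltac:(lra) (pairing_RInt_gen a b Ha Hb)).
    rewrite (RInt_scal_R Y) in H by easy.
    apply H.
    - intros x Hx. now apply pairing_nonneg.
    - now apply (ex_RInt_scal (V := R_NormedModule)).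
    - intros t Ht. unfold pairing.
      assert (Hm := m_tilde_pos al be Hal Hbe Hab t ltac:(lra)).
      apply Rle_trans with (c * (Rpower t (- (kappa * (p / (p - 1)))) * m_tilde al be t)).
      + apply Rmult_le_compat_l; [lra|]. apply HY. lra.
      + rewrite <- Rmult_assoc. apply Rmult_le_compat_r; [lra|].
        replace (- (kappa * (p / (p - 1)))) with (- kappa + s) by (unfold s; field; lra).
        rewrite Rpower_plus.
        replace (c * (Rpower t (- kappa) * Rpower t s))
          with (Rpower t (- kappa) * (c * Rpower t s)) by ring.
        apply Rmult_le_compat_l; [left; apply Rpower_pos|].
        apply bump_lower; lra. }
  assert (HX : 0 < X) by (assert (0 < c * Y0) by (now apply Rmult_lt_0_compat); lra).
  destruct (HK _ (bump_test_function a b s Ha ltac:(lra))) as [A [B [HA [HB HAB]]]].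
  assert (HB' := bump_norm_upper a b Ha Hb B HB HX). fold X D in HB'.
  destruct HA as [I [HI HA]].
  assert (HIX : Rpower (X / 2) q * N0 <= I).
  { assert (H := RInt_le_RInt_gen (fun lam => Rpower (X / 2) q * N lam) _ I l1 l2 Hl HI).
    rewrite (RInt_scal_R N) in H by easy.
    assert (Hn : forall lam, 0 <= n_weight al be lam).
    { intros lam. unfold n_weight. apply Rmult_le_pos.
      - left. apply Rinv_0_lt_compat, sqrt_lt_R0. pose proof PI_RGT_0. lra.
      - rewrite <- pow_inv. apply pow2_ge_0. }
    apply H.
    - intros lam _. apply Rmult_le_pos; [apply rpow_nonneg|apply Hn].
    - now apply (ex_RInt_scal (V := R_NormedModule)).
    - intros lam Hlam. cbv beta.
      assert (HT := transform_lower a b lam Ha Hb ltac:(lra)). fold X in HT.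
      set (J := Cmod _) in *. set (w := Rpower (lam ^ 2 + zeta ^ 2) (- (sigma / 2))) in *.
      assert (Hw : 0 < w) by apply Rpower_pos.
      assert (HwX : 0 < w * (X / 2)) by (apply Rmult_lt_0_compat; lra).
      rewrite rpow_pos_base by lra.
      apply Rle_trans with (Rpower (X / 2) q * (Rpower w q * n_weight al be lam)).
      + apply Rmult_le_compat_l; [left; apply Rpower_pos|].
        unfold w. rewrite Rpower_mult. apply HN. lra.
      + rewrite <- Rmult_assoc. apply Rmult_le_compat_r; [apply Hn|].
        rewrite Rmult_comm, Rpower_mult_distr by lra. apply Rle_Rpower_l; lra. }
  assert (HI0 : 0 < Rpower (X / 2) q * N0)
    by (apply Rmult_lt_0_compat; [apply Rpower_pos|easy]).
  assert (HA' : X / 2 * Rpower N0 (1 / q) <= A).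
  { rewrite HA, rpow_pos_base by lra.
    apply Rle_trans with (Rpower (Rpower (X / 2) q * N0) (1 / q)).
    - rewrite <- Rpower_mult_distr by (easy || apply Rpower_pos).
      rewrite Rpower_mult. replace (q * (1 / q)) with 1 by (field; lra).
      rewrite Rpower_1 by lra. lra.
    - apply Rle_Rpower_l; [|lra]. left. apply Rdiv_lt_0_compat; lra. }
  set (n0 := Rpower N0 (1 / q)) in *. assert (Hn0 : 0 < n0) by apply Rpower_pos.
  assert (HAK : X / 2 * n0 <= Rabs K * (Rpower D (1 / p) * Rpower X (1 / p))).
  { rewrite Rpower_mult_distr by lra.
    eapply Rle_trans; [exact HA'|]. eapply Rle_trans; [exact HAB|].
    apply Rle_trans with (Rabs K * B).
    - apply Rmult_le_compat_r; [lra|apply Rle_abs].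
    - apply Rmult_le_compat_l; [apply Rabs_pos|lra]. }
  assert (HXX : X = Rpower X (1 / p) * Rpower X (1 - 1 / p)).
  { rewrite <- Rpower_plus. replace (1 / p + (1 - 1 / p)) with 1 by ring.
    now rewrite Rpower_1. }
  assert (HXp : 0 < Rpower X (1 / p)) by apply Rpower_pos.
  assert (HcY : Rpower c (1 - 1 / p) * Rpower Y0 (1 - 1 / p) <= Rpower X (1 - 1 / p)).
  { rewrite Rpower_mult_distr by lra. apply Rle_Rpower_l; [|split; [now apply Rmult_lt_0_compat|easy]].
    assert (1 / p < 1); [|lra]. apply (Rmult_lt_reg_r p); [lra|]. unfold Rdiv.
    rewrite Rmult_assoc, Rinv_l by lra. lra. }
  assert (Hcp : 0 < Rpower c (1 - 1 / p)) by apply Rpower_pos.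
  set (cp := Rpower c (1 - 1 / p)) in *. set (yp := Rpower Y0 (1 - 1 / p)) in *.
  set (xp := Rpower X (1 / p)) in *. set (xq := Rpower X (1 - 1 / p)) in *.
  set (dp := Rpower D (1 / p)) in *.
  assert (H1 : xq * n0 <= 2 * Rabs K * dp).
  { apply (Rmult_le_reg_l xp); [easy|]. rewrite HXX in HAK. lra. }
  apply (Rmult_le_reg_l cp); [easy|].
  replace (cp * (2 * Rabs K * dp / cp)) with (2 * Rabs K * dp) by (field; lra).
  assert (cp * yp * n0 <= xq * n0) by (apply Rmult_le_compat_r; lra). lra.
Qed.

End MainInequality.

(** * Consequences of the main inequality *)

Lemma Rpower_Rinv x y : 0 < x -> Rpower (/ x) y = Rpower x (- y).
Proof. intros Hx. unfold Rpower. rewrite ln_Rinv by easy. f_equal. ring. Qed.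

Lemma Rpower_2 x : 0 < x -> Rpower x 2 = x ^ 2.
Proof. intros Hx. rewrite <- Rpower_pow by easy. f_equal. Qed.

Lemma Rpower_1_base y : Rpower 1 y = 1.
Proof. unfold Rpower. rewrite ln_1, Rmult_0_r. apply exp_0. Qed.

Lemma Rpower_antitone x y z : 0 < x <= 1 -> y <= z -> Rpower x z <= Rpower x y.
Proof.
  intros Hx Hyz. unfold Rpower.
  assert (Hl : ln x <= 0) by (rewrite <- ln_1; apply ln_le; lra).
  assert (H : z * ln x <= y * ln x) by nra.
  destruct H as [H|H]; [left; now apply exp_increasing|rewrite H; lra].
Qed.

Lemma exponent_nonneg c E K R0 : 0 < c -> 0 < R0 ->
  (forall r, 0 < r <= R0 -> c * Rpower r E <= K) -> 0 <= E.
Proof.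
  intros Hc HR H. apply Rnot_lt_le. intros HE.
  assert (HV : 0 < (Rabs K + 1) / c)
    by (apply Rdiv_lt_0_compat; [pose proof (Rabs_pos K); lra|easy]).
  set (L := ln ((Rabs K + 1) / c)).
  (* r = exp w is small enough that r^E >= (|K| + 1)/c, and at most R0. *)
  set (w := Rmin (L / E) (ln R0)).
  assert (Hw1 : w <= L / E) by apply Rmin_l. assert (Hw2 : w <= ln R0) by apply Rmin_r.
  specialize (H (exp w)).
  assert (HL : L <= E * w).
  { replace L with (E * (L / E)) by (field; lra). nra. }
  assert (HP : (Rabs K + 1) / c <= Rpower (exp w) E).
  { unfold Rpower. rewrite ln_exp, <- (exp_ln _ HV). fold L.
    destruct HL as [HL|HL]; [left; now apply exp_increasing|rewrite HL; lra]. }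
  assert (HX : c * Rpower (exp w) E <= K).
  { apply H. split; [apply exp_pos|]. rewrite <- (exp_ln R0) by easy.
    destruct Hw2 as [Hw|Hw]; [left; now apply exp_increasing|rewrite Hw; lra]. }
  assert (c * ((Rabs K + 1) / c) <= c * Rpower (exp w) E) by (apply Rmult_le_compat_l; lra).
  replace (c * ((Rabs K + 1) / c)) with (Rabs K + 1) in H0 by (field; lra).
  pose proof (Rle_abs K). lra.
Qed.

Lemma exponent_nonpos c E K R0 : 0 < c -> 0 < R0 ->
  (forall r, R0 <= r -> c * Rpower r E <= K) -> E <= 0.
Proof.
  intros Hc HR H. enough (0 <= - E) by lra.
  apply (exponent_nonneg c (- E) K (/ R0)); [easy|now apply Rinv_0_lt_compat|].
  intros r Hr. rewrite <- Rpower_Rinv by lra. apply H.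
  rewrite <- (Rinv_inv R0). apply Rinv_le_contravar; lra.
Qed.

Lemma Rpower_unbounded c r K : 0 < c -> 0 < r ->
  ~ (forall Y, 0 < Y -> c * Rpower Y r <= K).
Proof.
  intros Hc Hr H. assert (r <= 0); [|lra].
  apply (exponent_nonpos c r K 1); [easy|lra|]. intros Y HY. apply H. lra.
Qed.

Lemma is_RInt_reciprocal k a b : 0 < a <= b ->
  is_RInt (fun t => k * / t) a b (k * (ln b - ln a)).
Proof.
  intros Hab. evar_last.
  - apply (is_RInt_derive (V := R_CompleteNormedModule) (fun t => k * ln t)).
    + rewrite Rmin_left, Rmax_right by lra. intros x Hx. auto_derive; [lra|]. field. lra.
    + rewrite Rmin_left, Rmax_right by lra. intros x Hx.
      apply (ex_derive_continuous (V := R_NormedModule)). auto_derive. lra.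
  - unfold minus, plus, opp; simpl. ring.
Qed.

Lemma RInt_const_R (c a b : R) : RInt (fun _ => c) a b = (b - a) * c.
Proof. exact (RInt_const a b c). Qed.

Section Scaling.
Variables al be zeta p q kappa sigma K' : R.
Hypothesis Hbe : -1/2 <= be.
Hypothesis Hab : be <= al.
Hypothesis Hal : -1/2 < al.
Hypothesis Hp : 1 < p.
Hypothesis Hq : 1 < q.
Hypothesis Hmain : product_inequality al be zeta p q kappa sigma K'.

Let e1 := kappa * (p / (p - 1)).

Lemma conjugate_pos : 0 < 1 - 1 / p.
Proof.
  assert (1 / p < 1); [|lra]. apply (Rmult_lt_reg_r p); [lra|]. unfold Rdiv.
  rewrite Rmult_assoc, Rinv_l by lra. lra.
Qed.

(** The intervals [[r/2, r]] and [[1/(8r), 1/(4r)]]: if on them [m~] is at least of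
    order [t^mu], [n] of order [lam^nu] and the multiplier of order [r^tau], then
    the exponent of [r] below controls what happens as [r -> 0] or [r -> oo]. *)
Lemma scaling_bound mu nu tau k1 k2 k3 : 0 < k1 -> 0 < k2 -> 0 < k3 ->
  exists c, 0 < c /\ forall r, 0 < r ->
    (forall t, r / 2 < t < r -> k1 * Rpower t mu <= m_tilde al be t) ->
    (forall lam, / (8 * r) < lam < / (4 * r) -> k2 * Rpower lam nu <= n_weight al be lam) ->
    (forall lam, / (8 * r) < lam < / (4 * r) ->
       k3 * Rpower r tau <= Rpower (lam ^ 2 + zeta ^ 2) (- (sigma / 2))) ->
    c * Rpower r ((mu + 1) * (1 - 1 / p) - kappa + tau - (nu + 1) / q) <= K'.
Proof.
  intros Hk1 Hk2 Hk3.
  set (C1 := k1 * Rpower (1 / 2) (Rabs (mu - e1)) / 2).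
  set (C2 := k2 * Rpower (1 / 8) (Rabs nu) * Rpower k3 q / 8).
  assert (HC1 : 0 < C1).
  { unfold C1. apply Rdiv_lt_0_compat; [|lra]. apply Rmult_lt_0_compat; [easy|apply Rpower_pos]. }
  assert (HC2 : 0 < C2).
  { unfold C2. apply Rdiv_lt_0_compat; [|lra].
    apply Rmult_lt_0_compat; [|apply Rpower_pos]. apply Rmult_lt_0_compat; [easy|apply Rpower_pos]. }
  exists (Rpower C1 (1 - 1 / p) * Rpower C2 (1 / q)).
  split; [apply Rmult_lt_0_compat; apply Rpower_pos|].
  intros r Hr Hm Hn Hw.
  set (Y := 2 * C1 * Rpower r (mu - e1)).
  set (N := 8 * C2 * Rpower r (tau * q - nu)).
  assert (Hr8 : 0 < / (8 * r)) by (apply Rinv_0_lt_compat; lra).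
  assert (HY0 : RInt (fun _ => Y) (2 * (r / 4)) r = C1 * Rpower r (mu - e1 + 1)).
  { rewrite RInt_const_R. unfold Y. rewrite Rpower_plus, Rpower_1 by easy. real_eq. field. }
  assert (HN0 : RInt (fun _ => N) (/ (8 * r)) (/ (4 * r)) = C2 * Rpower r (tau * q - nu - 1)).
  { rewrite RInt_const_R. unfold N.
    replace (tau * q - nu - 1) with (tau * q - nu + - (1)) by ring.
    rewrite (Rpower_plus _ (- (1))), Rpower_Ropp, Rpower_1 by easy. real_eq. field. lra. }
  assert (H := Hmain (r / 4) r (/ (8 * r)) (/ (4 * r)) (fun _ => Y) (fun _ => N)).
  rewrite HY0, HN0 in H.
  rewrite <- !Rpower_mult_distr, !Rpower_mult in H by (easy || apply Rpower_pos).
  replace (Rpower C1 (1 - 1 / p) * Rpower C2 (1 / q)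
           * Rpower r ((mu + 1) * (1 - 1 / p) - kappa + tau - (nu + 1) / q))
    with (Rpower C1 (1 - 1 / p) * Rpower r ((mu - e1 + 1) * (1 - 1 / p))
          * (Rpower C2 (1 / q) * Rpower r ((tau * q - nu - 1) * (1 / q)))).
  2:{ replace ((mu + 1) * (1 - 1 / p) - kappa + tau - (nu + 1) / q)
        with ((mu - e1 + 1) * (1 - 1 / p) + (tau * q - nu - 1) * (1 / q))
        by (unfold e1; field; lra).
      rewrite Rpower_plus. ring. }
  apply H.
  - lra.
  - lra.
  - split; [easy|]. apply Rinv_lt_contravar; [nra|lra].
  - lra.
  - apply ex_RInt_const.
  - apply ex_RInt_const.
  - intros t Ht. specialize (Hm t ltac:(lra)). fold e1.
    apply Rle_trans with (Rpower t (- e1) * (k1 * Rpower t mu)).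
    2:{ apply Rmult_le_compat_l; [left; apply Rpower_pos|easy]. }
    replace (Rpower t (- e1) * (k1 * Rpower t mu)) with (k1 * Rpower t (mu - e1))
      by (unfold Rminus; rewrite Rpower_plus; ring).
    unfold Y, C1.
    replace (2 * (k1 * Rpower (1 / 2) (Rabs (mu - e1)) / 2) * Rpower r (mu - e1))
      with (k1 * (Rpower (1 / 2) (Rabs (mu - e1)) * Rpower r (mu - e1))) by field.
    apply Rmult_le_compat_l; [lra|]. apply Rpower_comparable; lra.
  - intros lam Hlam. specialize (Hn lam Hlam). specialize (Hw lam Hlam).
    assert (Hlam0 : 0 < lam) by lra.
    assert (Hir : 0 < / r) by now apply Rinv_0_lt_compat.
    assert (E8 : / (8 * r) = 1 / 8 * / r) by (field; lra).
    assert (E4 : / (4 * r) = 1 / 4 * / r) by (field; lra).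
    rewrite <- Rpower_mult.
    assert (W1 : Rpower k3 q * Rpower r (tau * q)
                 <= Rpower (Rpower (lam ^ 2 + zeta ^ 2) (- (sigma / 2))) q).
    { rewrite <- (Rpower_mult r), Rpower_mult_distr by (easy || apply Rpower_pos).
      apply Rle_Rpower_l; [lra|]. split; [|easy].
      apply Rmult_lt_0_compat; [easy|apply Rpower_pos]. }
    assert (W2 : k2 * (Rpower (1 / 8) (Rabs nu) * Rpower r (- nu)) <= n_weight al be lam).
    { eapply Rle_trans; [|exact Hn]. apply Rmult_le_compat_l; [lra|].
      rewrite <- Rpower_Rinv by easy. apply Rpower_comparable; [lra|easy|lra]. }
    unfold N, C2.
    replace (8 * (k2 * Rpower (1 / 8) (Rabs nu) * Rpower k3 q / 8) * Rpower r (tau * q - nu))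
      with ((Rpower k3 q * Rpower r (tau * q)) * (k2 * (Rpower (1 / 8) (Rabs nu) * Rpower r (- nu))))
      by (unfold Rminus; rewrite Rpower_plus; field).
    apply Rmult_le_compat; [| |easy|easy].
    + apply Rmult_le_pos; left; apply Rpower_pos.
    + apply Rmult_le_pos; [lra|]. apply Rmult_le_pos; left; apply Rpower_pos.
  - apply Rmult_lt_0_compat; [easy|apply Rpower_pos].
  - apply Rmult_lt_0_compat; [easy|apply Rpower_pos].
Qed.

(** Otherwise [t^(-kappa p') m~(t)] is not integrable at 0, and the first factor of
    the main inequality blows up as [a -> 0]. *)
Lemma kappa_condition : kappa * (p / (p - 1)) < 2 * (al + 1).
Proof.
  apply Rnot_le_lt. intros Hge. fold e1 in Hge.
  destruct (m_tilde_lower_small al be Hal Hbe Hab) as [k [Hk Hm]].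
  destruct (n_weight_lower_large al be Hal Hbe Hab) as [kn [Hkn Hn]].
  pose proof (pow2_ge_0 zeta) as Hz.
  set (d := / (4 + zeta ^ 2)).
  assert (Hd : d * (4 + zeta ^ 2) = 1) by (apply Rinv_l; lra).
  assert (Hd0 : 0 < d) by (apply Rinv_0_lt_compat; lra).
  set (N := Rpower d (Rabs (- (sigma / 2) * q)) * kn).
  assert (HN : 0 < N) by (apply Rmult_lt_0_compat; [apply Rpower_pos|easy]).
  apply (Rpower_unbounded (Rpower N (1 / q)) (1 - 1 / p) K'); [apply Rpower_pos|apply conjugate_pos|].
  intros Y HY.
  (* This a makes the integral of k/t over [2a, 1/8] equal to Y. *)
  set (a := exp (- (Y / k)) / 16).
  assert (HYk : 0 < Y / k) by now apply Rdiv_lt_0_compat.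
  assert (Ha : 0 < a /\ 2 * a < 1 / 8).
  { unfold a. pose proof (exp_pos (- (Y / k))).
    assert (exp (- (Y / k)) < 1) by (rewrite <- exp_0; apply exp_increasing; lra). lra. }
  assert (HIY : is_RInt (fun t => k * / t) (2 * a) (1 / 8) Y).
  { evar_last; [apply is_RInt_reciprocal; lra|].
    replace (2 * a) with (1 / 8 * exp (- (Y / k))) by (unfold a; field).
    rewrite ln_mult, ln_exp by (try apply exp_pos; lra). real_eq. field. lra. }
  assert (H := Hmain a (1 / 8) 1 2 (fun t => k * / t) (fun _ => N)).
  rewrite (is_RInt_unique (V := R_CompleteNormedModule) _ _ _ _ HIY) in H.
  rewrite RInt_const_R in H. replace ((2 - 1) * N) with N in H by ring.
  rewrite Rmult_comm. apply H; try lra.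
  - now exists Y.
  - apply ex_RInt_const.
  - intros t Ht. fold e1.
    apply Rle_trans with (Rpower t (- e1) * (k * Rpower t (2 * al + 1))).
    2:{ apply Rmult_le_compat_l; [left; apply Rpower_pos|]. apply Hm. lra. }
    replace (Rpower t (- e1) * (k * Rpower t (2 * al + 1))) with (k * Rpower t (2 * al + 1 + - e1))
      by (rewrite Rpower_plus; ring).
    apply Rmult_le_compat_l; [lra|].
    rewrite <- (Rpower_1 t) at 1 by lra. rewrite <- Rpower_Ropp.
    apply Rpower_antitone; lra.
  - intros lam Hlam. unfold N. apply Rmult_le_compat.
    + left; apply Rpower_pos.
    + lra.
    + rewrite <- (Rmult_1_r (Rpower d _)). replace (Rpower d (Rabs (- (sigma / 2) * q)) * 1) with
        (Rpower d (Rabs (- (sigma / 2) * q)) * Rpower 1 (- (sigma / 2) * q))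
        by now rewrite Rpower_1_base.
      apply Rpower_comparable; [nra|lra|]. unfold Rdiv, d. rewrite Rinv_inv. fold d. nra.
    + eapply Rle_trans; [|apply Hn; lra]. rewrite <- (Rmult_1_r kn) at 1.
      apply Rmult_le_compat_l; [lra|].
      apply Rle_trans with (Rpower 1 (2 * al + 1)); [rewrite Rpower_1_base; lra|].
      apply Rle_Rpower_l; lra.
Qed.

(** [t -> 0], [lam -> oo]: here [m~(t) ~ t^(2 al + 1)], [n(lam) ~ lam^(2 al + 1)]. *)
Lemma local_condition : sigma - kappa >= 2 * (al + 1) * (1 / p + 1 / q - 1).
Proof.
  destruct (m_tilde_lower_small al be Hal Hbe Hab) as [k1 [Hk1 Hm]].
  destruct (n_weight_lower_large al be Hal Hbe Hab) as [k2 [Hk2 Hn]].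
  pose proof (pow2_ge_0 zeta) as Hz.
  set (d := / (64 * (1 + zeta ^ 2))).
  assert (Hd : d * (64 * (1 + zeta ^ 2)) = 1) by (apply Rinv_l; lra).
  assert (Hd0 : 0 < d) by (apply Rinv_0_lt_compat; lra).
  destruct (scaling_bound (2 * al + 1) (2 * al + 1) sigma k1 k2
              (Rpower d (Rabs (- (sigma / 2)))) Hk1 Hk2 (Rpower_pos _ _)) as [c [Hc HB]].
  set (E := (2 * al + 1 + 1) * (1 - 1 / p) - kappa + sigma - (2 * al + 1 + 1) / q) in *.
  assert (HE : 0 <= E).
  { apply (exponent_nonneg c E K' (1 / 8)); [easy|lra|]. intros r Hr.
    assert (Hir : 8 <= / r).
    { replace 8 with (/ (1 / 8)) by field. apply Rinv_le_contravar; lra. }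
    assert (E8 : / (8 * r) = 1 / 8 * / r) by (field; lra).
    assert (E4 : / (4 * r) = 1 / 4 * / r) by (field; lra).
    apply HB; [lra| | |].
    - intros t Ht. apply Hm. lra.
    - intros lam Hlam. apply Hn. lra.
    - intros lam Hlam.
      rewrite <- (Ropp_involutive sigma) at 2. rewrite <- Rpower_Rinv by lra.
      rewrite <- (Rpower_sqr (/ r)) by lra. replace (- sigma / 2) with (- (sigma / 2)) by field.
      rewrite E8, E4 in Hlam. set (u := / r) in *.
      assert (U1 : (1 / 8 * u) ^ 2 <= lam ^ 2) by (apply pow_incr; lra).
      assert (U2 : lam ^ 2 <= (1 / 4 * u) ^ 2) by (apply pow_incr; lra).
      apply Rpower_comparable; [nra|apply pow_lt; lra|].
      assert (U3 : 64 <= u ^ 2) by nra.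
      unfold Rdiv at 1. unfold d at 2. rewrite Rinv_inv. nra. }
  unfold E in HE. unfold Rdiv in *. apply Rle_ge. lra.
Qed.

(** [t -> oo], [lam -> 0]: here [m~(t) ~ t^2], [n(lam) ~ lam^2].  The multiplier
    [(lam^2 + zeta^2)^(-sigma/2)] is of order [r^tau] with [tau = 0] if [zeta <> 0]
    and [tau = sigma] if [zeta = 0]. *)
Lemma global_condition tau k3 : 0 < k3 ->
  (forall r lam, 2 <= r -> / (8 * r) < lam < / (4 * r) ->
       k3 * Rpower r tau <= Rpower (lam ^ 2 + zeta ^ 2) (- (sigma / 2))) ->
  3 * (1 - 1 / p) - kappa + tau - 3 / q <= 0.
Proof.
  intros Hk3 Hw.
  destruct (m_tilde_lower_large al be Hal Hbe Hab) as [k1 [Hk1 Hm]].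
  destruct (n_weight_lower_small al be Hal Hbe Hab) as [k2 [Hk2 Hn]].
  destruct (scaling_bound 2 2 tau k1 k2 k3 Hk1 Hk2 Hk3) as [c [Hc HB]].
  replace 3 with (2 + 1) by ring.
  apply (exponent_nonpos c _ K' 2); [easy|lra|]. intros r Hr.
  assert (Hir : / r <= 1 / 2).
  { replace (1 / 2) with (/ 2) by field. apply Rinv_le_contravar; lra. }
  assert (Hir0 : 0 < / r) by (apply Rinv_0_lt_compat; lra).
  assert (E8 : / (8 * r) = 1 / 8 * / r) by (field; lra).
  assert (E4 : / (4 * r) = 1 / 4 * / r) by (field; lra).
  apply HB; [lra| | |].
  - intros t Ht. rewrite Rpower_2 by lra. apply Hm. lra.
  - intros lam Hlam. rewrite Rpower_2 by lra. apply Hn. lra.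
  - intros lam Hlam. now apply Hw.
Qed.

(** If [sigma q >= 3] then [lam^(- sigma q) n(lam)] is not integrable at 0. *)
Lemma sigma_condition : zeta = 0 -> sigma * q < 3.
Proof.
  intros Hz. apply Rnot_le_lt. intros Hge.
  destruct (m_tilde_lower_small al be Hal Hbe Hab) as [k1 [Hk1 Hm]].
  destruct (n_weight_lower_small al be Hal Hbe Hab) as [k2 [Hk2 Hn]].
  set (ex := 2 * al + 1 + - e1).
  set (Y := k1 * (Rpower (1 / 2) (Rabs ex) * Rpower (1 / 4) ex)).
  assert (HY : 0 < Y).
  { apply Rmult_lt_0_compat; [easy|]. apply Rmult_lt_0_compat; apply Rpower_pos. }
  apply (Rpower_unbounded (Rpower (1 / 8 * Y) (1 - 1 / p)) (1 / q) K');
    [apply Rpower_pos|apply Rdiv_lt_0_compat; lra|].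
  intros N HN.
  (* This l makes the integral of k2/lam over [l, 1] equal to N. *)
  set (l := exp (- (N / k2))).
  assert (HNk : 0 < N / k2) by now apply Rdiv_lt_0_compat.
  assert (Hl : 0 < l < 1).
  { unfold l. split; [apply exp_pos|]. rewrite <- exp_0. apply exp_increasing. lra. }
  assert (HIN : is_RInt (fun t => k2 * / t) l 1 N).
  { evar_last; [apply is_RInt_reciprocal; lra|].
    unfold l. rewrite ln_exp, ln_1. real_eq. field. lra. }
  assert (H := Hmain (1 / 16) (1 / 4) l 1 (fun _ => Y) (fun t => k2 * / t)).
  rewrite (is_RInt_unique (V := R_CompleteNormedModule) _ _ _ _ HIN) in H.
  rewrite RInt_const_R in H.
  replace ((1 / 4 - 2 * (1 / 16)) * Y) with (1 / 8 * Y) in H by field.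
  apply H; try lra.
  - apply ex_RInt_const.
  - now exists N.
  - intros t Ht. fold e1.
    apply Rle_trans with (Rpower t (- e1) * (k1 * Rpower t (2 * al + 1))).
    2:{ apply Rmult_le_compat_l; [left; apply Rpower_pos|]. apply Hm. lra. }
    replace (Rpower t (- e1) * (k1 * Rpower t (2 * al + 1))) with (k1 * Rpower t ex)
      by (unfold ex; rewrite Rpower_plus; ring).
    apply Rmult_le_compat_l; [lra|]. apply Rpower_comparable; lra.
  - intros lam Hlam. rewrite Hz. replace (lam ^ 2 + 0 ^ 2) with (lam ^ 2) by ring.
    replace (- (sigma / 2) * q) with (- (sigma * q) / 2) by field.
    rewrite Rpower_sqr by lra.
    apply Rle_trans with (Rpower lam (- (sigma * q)) * (k2 * lam ^ 2)).
    2:{ apply Rmult_le_compat_l; [left; apply Rpower_pos|]. apply Hn. lra. }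
    rewrite <- Rpower_2 by lra.
    replace (Rpower lam (- (sigma * q)) * (k2 * Rpower lam 2))
      with (k2 * Rpower lam (- (sigma * q) + 2)) by (rewrite Rpower_plus; ring).
    apply Rmult_le_compat_l; [lra|].
    rewrite <- (Rpower_1 lam) at 1 by lra. rewrite <- Rpower_Ropp.
    apply Rpower_antitone; lra.
Qed.

End Scaling.

Theorem theorem4p8 (alpha beta zeta p q kappa sigma : R)
  (Hbeta : -1/2 <= beta) (Hab : beta <= alpha) (Halpha : -1/2 < alpha)
  (Hzeta : 0 <= zeta) (Hp : 1 < p) (Hq : 1 < q)
  (Hineq : exists K : R, forall f : R -> C, test_function f ->
     exists A B : R,
       is_weighted_norm (n_weight alpha beta) q
         (jacobi_transform alpha beta zeta kappa sigma f) A /\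
       is_weighted_norm (m_tilde alpha beta) p f B /\
       A <= K * B) :
  (zeta <> 0 ->
     kappa * (p / (p - 1)) < 2 * (alpha + 1) /\
     sigma - kappa >= 2 * (alpha + 1) * (1 / p + 1 / q - 1) /\
     kappa >= 3 * (1 - 1 / p - 1 / q)) /\
  (zeta = 0 ->
     kappa * (p / (p - 1)) < 2 * (alpha + 1) /\
     sigma * q < 3 /\
     sigma - kappa >= 2 * (alpha + 1) * (1 / p + 1 / q - 1) /\
     sigma - kappa <= 3 * (1 / p + 1 / q - 1)).
Proof.
  destruct (main_inequality alpha beta zeta p q kappa sigma Hbeta Hab Halpha Hp Hq Hineq)
    as [K' Hmain].
  assert (Hkappa := kappa_condition alpha beta zeta p q kappa sigma K' Hbeta Hab Halpha Hp Hmain).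
  assert (Hlocal := local_condition alpha beta zeta p q kappa sigma K' Hbeta Hab Halpha Hp Hq Hmain).
  assert (Hglobal := global_condition alpha beta zeta p q kappa sigma K' Hbeta Hab Halpha Hp Hq Hmain).
  split; intros Hz.
  - split; [easy|split; [easy|]].
    assert (Hz2 : 0 < zeta ^ 2) by (apply pow_lt; lra).
    set (d := zeta ^ 2 / (1 + zeta ^ 2)).
    assert (Hd : 0 < d) by (apply Rdiv_lt_0_compat; lra).
    assert (Hd1 : d * (1 + zeta ^ 2) = zeta ^ 2) by (unfold d; field; lra).
    set (k := Rpower d (Rabs (- (sigma / 2))) * Rpower (zeta ^ 2) (- (sigma / 2))).
    assert (HE : 3 * (1 - 1 / p) - kappa + 0 - 3 / q <= 0).
    { apply (Hglobal 0 k).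
      - apply Rmult_lt_0_compat; apply Rpower_pos.
      - intros r lam Hr Hlam. rewrite Rpower_O, Rmult_1_r by lra.
        assert (Hlam0 : 0 < lam <= 1).
        { assert (0 < / (8 * r)) by (apply Rinv_0_lt_compat; lra).
          assert (/ (4 * r) <= / 1) by (apply Rinv_le_contravar; lra).
          rewrite Rinv_1 in *. lra. }
        assert (lam ^ 2 <= 1 ^ 2) by (apply pow_incr; lra).
        pose proof (pow2_ge_0 lam).
        apply Rpower_comparable; [nra|easy|].
        replace (zeta ^ 2 / d) with (1 + zeta ^ 2) by (unfold d; field; lra). nra. }
    unfold Rdiv in *. apply Rle_ge. lra.
  - split; [easy|split; [|split; [easy|]]].
    + exact (sigma_condition alpha beta zeta p q kappa sigma K' Hbeta Hab Halpha Hq Hmain Hz).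
    + assert (HE : 3 * (1 - 1 / p) - kappa + sigma - 3 / q <= 0).
      { apply (Hglobal sigma (Rpower (1 / 64) (Rabs (- (sigma / 2))))); [apply Rpower_pos|].
        intros r lam Hr Hlam. rewrite Hz. replace (lam ^ 2 + 0 ^ 2) with (lam ^ 2) by ring.
        rewrite <- (Ropp_involutive sigma) at 2. rewrite <- Rpower_Rinv by lra.
        assert (Hir0 : 0 < / r) by (apply Rinv_0_lt_compat; lra).
        rewrite <- (Rpower_sqr (/ r)) by lra. replace (- sigma / 2) with (- (sigma / 2)) by field.
        assert (E8 : / (8 * r) = 1 / 8 * / r) by (field; lra).
        assert (E4 : / (4 * r) = 1 / 4 * / r) by (field; lra).
        rewrite E8, E4 in Hlam. set (u := / r) in *.
        assert (U1 : (1 / 8 * u) ^ 2 <= lam ^ 2) by (apply pow_incr; lra).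
        assert (U2 : lam ^ 2 <= (1 / 4 * u) ^ 2) by (apply pow_incr; lra).
        apply Rpower_comparable; [lra|apply pow_lt; lra|].
        pose proof (pow2_ge_0 u). lra. }
      unfold Rdiv in *. lra.
Qed.
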